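(* Let $n\in\{3,4\}$, $\kappa>0$, and consider the operator $\Delta_n-\kappa^2$ on $\mathbb{R}^n$. The asymptotic parametrix construction, with integration contour $\Gamma_{\frac{n+4}{2}-\gamma}=\{w\in\mathbb{C}:\mathrm{Re}\,w=\frac{n+4}2-\gamma\}$ taken for $2-\frac n2<\gamma<3-\frac n2$, yields a fundamental solution $$u=\mathrm{Pf.}\,k(r),\qquad k(r):=k_0(r)+r\,k_1(r)+r^2k_2(r)+\cdots ,$$ where the functions $k_j$, $j=0,1,\dots$, are the ones obtained from the parametrix symbols as defined in the context; that is, $(\Delta_n-\kappa^2)\,\mathrm{Pf.}\,k=\delta$ in $\mathcal D'(\mathbb{R}^n)$.
   Context: $\Delta_n$ is the Laplace operator on $\mathbb{R}^n$, $r=|x|$, and $\delta$ is the Dirac distribution at $0$. For a function $k$ on $\mathbb{R}^n\setminus\{0\}$ (written in polar coordinates) that is locally integrable on $\mathbb{R}^n$, $\mathrm{Pf.}\,k$ denotes the corresponding regular distribution on $\mathbb{R}^n$. **Symbols.** In polar coordinates $\Delta_n-\kappa^2=r^{-2}[(-r\partial_r)^2-(n-2)(-r\partial_r)+\Delta_{S^{n-1}}-r^2\kappa^2]$. The eigenvalues of $-\Delta_{S^{n-1}}$ are $\lambda_\ell=\ell(\ell+n-2)$, $\ell=0,1,2,\dots$; the functions $k_j$ involve only $\lambda_0=0$. The parametrix symbols are defined recursively by $$h^{(-1)}_0(w,\lambda)=\frac1{h_0(w-2,\lambda)},\qquad h^{(-1)}_j(w,\lambda)=-\Bigl(\sum_{i=1}^jh^{(-1)}_{j-i}(w-i,\lambda)h_i(w-2,\lambda)\Bigr)h^{(-1)}_0(w,\lambda),$$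 with $h_0(w,\lambda)=w^2-(n-2)w-\lambda$, $h_2=-\kappa^2$ and $h_i=0$ for all other $i$. In particular $h_0^{(-1)}(w,0)=\frac1{(w-2)(w-n)}$, $h^{(-1)}_{2m}(w,0)=\kappa^{2m}\prod_{j=0}^mh_0^{(-1)}(w-2j,0)$ and $h_{2m+1}^{(-1)}=0$. **The functions $k_j$.** Let $p_0=1/\mathrm{vol}(S^{n-1})$, the constant integral kernel of the projection of $L^2(S^{n-1})$ onto constants. The contour lies to the left of the point $w=n$. Then: * if $h_j^{(-1)}(\cdot,0)$ has a simple pole at $w=n$, $k_j(r)=-r^{2-n}\,p_0\,\mathrm{Res}_{w=n}h_j^{(-1)}(\cdot,0)$; * if $h_j^{(-1)}(\cdot,0)$ has a pole of order 2 at $w=n$, $$k_j(r)=r^{2-n}\,p_0\bigl[\ln(r)\,\mathrm{Res}^{(1)}_nh_j^{(-1)}(\cdot,0)-\mathrm{Res}^{(2)}_nh_j^{(-1)}(\cdot,0)\bigr],$$ where $\mathrm{Res}^{(1)}_nf=\lim_{w\to n}(w-n)^2f(w)$ and $\mathrm{Res}^{(2)}_nf=\lim_{w\to n}\frac d{dw}[(w-n)^2f(w)]$; * if $h_j^{(-1)}(\cdot,0)$ has no pole at $w=n$, $k_j=0$. *)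

(* Defs.v *)
From HB Require Import structures.
From mathcomp Require Import all_boot all_order all_algebra.
From mathcomp Require Import all_classical all_reals all_analysis.
From mathcomp Require Import complex.
Set Implicit Arguments.
Unset Strict Implicit.
Unset Printing Implicit Defensive.
Import Order.TTheory GRing.Theory Num.Theory numFieldNormedType.Exports.
Local Open Scope classical_set_scope.
Local Open Scope ring_scope.

(* The complex numbers, packaged as a numClosedFieldType so that they inherit
   the normed topology and the complex derivative of MathComp-Analysis. *)
Definition CC (R : realType) : numClosedFieldType := R[i].

Definition ofR (R : realType) (x : R) : CC R := (x%:C)%C.
Definition ReC (R : realType) (z : CC R) : R := complex.Re z.
Definition ImC (R : realType) (z : CC R) : R := complex.Im z.
Definition mkC (R : realType) (x y : R) : CC R := (x +i* y)%C.

Section Poles.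
Variable K : numClosedFieldType.
Implicit Types (f g : K -> K) (a : K).

Definition holomorphic_near g a := \forall w \near a, derivable g w 1.

Definition pole_of_order (m : nat) f a := exists g : K -> K,
  [/\ holomorphic_near g a, g a != 0 &
      \forall w \near a^', f w = g w / (w - a) ^+ m].

(* The coefficient of (w - a)^-1 in the Laurent expansion of f at a: the
   polynomial P, taken at (w - a)^-1, collects the finitely many negative
   powers. *)
Definition is_residue f a (c : K) := exists (P : {poly K}) (g : K -> K),
  [/\ holomorphic_near g a,
      (\forall w \near a^', f w = P.[(w - a)^-1] + g w) & P`_1 = c].

Definition residue f a : K := xget 0 [set c | is_residue f a c].

Definition Res1 f a : K := lim ((w - a) ^+ 2 * f w @[w --> a^']).

Definition Res2 f a : K :=
  lim (derive1 (fun z : K => (z - a) ^+ 2 * f z) w @[w --> a^']).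

End Poles.

Section Symbols.
Variables (R : realType) (n : nat) (kappa : R).
Implicit Types w lam : CC R.

Definition hsym (i : nat) w lam : CC R :=
  match i with
  | 0%N => w ^+ 2 - (n%:R - 2) * w - lam
  | 2%N => - ofR kappa ^+ 2
  | _ => 0
  end.

(* The fuel m only serves the termination check; see hinv0 and hinvS. At the
   poles the totalised inverse returns 0, but residues and pole orders only
   look at punctured neighbourhoods. *)
Fixpoint hinv_rec (m j : nat) w lam {struct m} : CC R :=
  match m, j with
  | m'.+1, j'.+1 =>
      - (\sum_(1 <= i < j.+1)
           hinv_rec m' (j - i) (w - i%:R) lam * hsym i (w - 2) lam)
      * (hsym 0 (w - 2) lam)^-1
  | _, _ => (hsym 0 (w - 2) lam)^-1
  end.

Definition hinv (j : nat) w lam : CC R := hinv_rec j j w lam.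

Lemma hinv0 w lam : hinv 0 w lam = (hsym 0 (w - 2) lam)^-1.
Proof. by []. Qed.

Lemma hinv_rec_stable m j w lam :
  (j <= m)%N -> hinv_rec m j w lam = hinv j w lam.
Proof.
elim: m {-2}m (leqnn m) j w lam => [|M IH] [|m] // mM [|j] // w lam jm.
rewrite /hinv /=; congr (- _ * _).
apply: eq_big_nat => -[|i] // /andP[_ ij]; rewrite subSS.
have ji : (j - i <= j)%N by exact: leq_subr.
by rewrite (IH m)// ?(leq_trans ji)// (IH j)//; exact: leq_trans jm mM.
Qed.

Lemma hinvS j w lam : (0 < j)%N ->
  hinv j w lam =
    - (\sum_(1 <= i < j.+1) hinv (j - i) (w - i%:R) lam * hsym i (w - 2) lam)
    * hinv 0 w lam.
Proof.
case: j => // j _; rewrite {1}/hinv /=; congr (- _ * _).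
apply: eq_big_nat => -[|i] // /andP[_ ij]; rewrite subSS.
by rewrite hinv_rec_stable // leq_subr.
Qed.

End Symbols.

Section Euclidean.
Variables (R : realType) (n : nat).

Definition enorm (x : 'rV[R]_n) : R := Num.sqrt (\sum_i x 0 i ^+ 2).

(* R^n has its topology and derivatives as 'rV[R]_n, its sigma-algebra and
   Lebesgue measure as n.-tuple R; rv identifies the two. The norm of
   'rV[R]_n is the sup norm, hence enorm. *)
Definition rv (t : n.-tuple R) : 'rV[R]_n := \row_i tnth t i.

End Euclidean.

Section PowerMeasure.
Context d (T : measurableType d) (R : realType).
Variable m : {sigma_finite_measure set T -> \bar R}.

Definition tcons (n : nat) (p : T * n.-tuple T) : n.+1.-tuple T :=
  [tuple of p.1 :: p.2].

Lemma measurable_tcons n : measurable_fun [set: _] (@tcons n).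
Proof. exact: measurable_cons. Qed.

Section step.
Variables (n : nat) (mu : {sigma_finite_measure set (n.-tuple T) -> \bar R}).

Let mtcons : measurable_fun [set: _] (@tcons n) := @measurable_tcons n.

Definition power_step := pushforward (m \x mu)%E (@tcons n).

Let step0 : power_step set0 = 0%E.
Proof. exact: measure0. Qed.

Let step_ge0 A : (0 <= power_step A)%E.
Proof. exact: measure_ge0. Qed.

Let step_sigma_additive : semi_sigma_additive power_step.
Proof. exact: measure_semi_sigma_additive. Qed.

HB.instance Definition _ := isMeasure.Build _ _ _ power_step
  step0 step_ge0 step_sigma_additive.

Let step_sigma_finite : sigma_finite setT power_step.
Proof.
have /sigma_finiteP[F [TF ndF Foo]] := sigma_finiteT m.
have /sigma_finiteP[G [TG ndG Goo]] := sigma_finiteT mu.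
pose h (t : n.+1.-tuple T) := (thead t, [tuple of behead t]).
have mh : measurable_fun [set: _] h.
  by apply: measurable_fun_pair; [exact: measurable_tnth|exact: measurable_behead].
exists (fun k => h @^-1` (F k `*` G k)) => [|k].
  apply/seteqP; split => // t _.
  have [i _ Fi] : (\bigcup_i F i) (h t).1 by rewrite -TF.
  have [j _ Gj] : (\bigcup_i G i) (h t).2 by rewrite -TG.
  exists (maxn i j) => //; split.
    by move: Fi; exact/subsetPset/ndF/leq_maxl.
  by move: Gj; exact/subsetPset/ndG/leq_maxr.
have [[mF Ffin] [mG Gfin]] := (Foo k, Goo k).
split; first by rewrite -[X in measurable X]setTI; apply: mh => //; exact: measurableX.
rewrite /power_step /pushforward (_ : _ @^-1` _ = F k `*` G k).
  by rewrite product_measure1E// lte_mul_pinfty// ge0_fin_numE.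
have hK p : h (tcons p) = p.
  by case: p => x t; rewrite /h /tcons /= theadE; congr (_, _); exact: val_inj.
by apply/funext => p; exact: (congr1 (F k `*` G k) (hK p)).
Qed.

HB.instance Definition _ := Measure_isSigmaFinite.Build _ _ _ power_step
  step_sigma_finite.

End step.

Fixpoint power_measure (n : nat) : {sigma_finite_measure set (n.-tuple T) -> \bar R} :=
  match n with
  | 0%N => (\d_ [tuple] : set (0.-tuple T) -> \bar R)
  | n'.+1 => power_step (power_measure n')
  end.
End PowerMeasure.

Definition lebesgue_tuple (R : realType) (n : nat) :
    {sigma_finite_measure set (n.-tuple (measurableTypeR R)) -> \bar R} :=
  power_measure lebesgue_measure n.

Section Distributions.
Variables (R : realType) (n : nat).
Local Notation Rn := 'rV[R]_n.
Local Notation leb := (lebesgue_tuple R n).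

Definition Cintegral (f : Rn -> CC R) : CC R :=
  mkC (\int[leb]_t ReC (f (rv t))) (\int[leb]_t ImC (f (rv t))).

Definition locally_integrable_Rn (f : Rn -> CC R) :=
  forall A : set Rn, compact A ->
    leb.-integrable (@rv R n @^-1` A) (fun t => (ReC (f (rv t)))%:E) /\
    leb.-integrable (@rv R n @^-1` A) (fun t => (ImC (f (rv t)))%:E).

Definition partial (i : 'I_n) (g : Rn -> R) : Rn -> R :=
  fun x => 'D_(delta_mx 0 i) g x.

Definition Cpartial (i : 'I_n) (phi : Rn -> CC R) : Rn -> CC R :=
  fun x => mkC (partial i (fun y => ReC (phi y)) x)
               (partial i (fun y => ImC (phi y)) x).

Definition smooth (g : Rn -> R) := forall s : seq 'I_n,
  let gs := foldr partial g s in
  continuous gs /\ forall i x, derivable gs x (delta_mx 0 i).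

Definition test_function (phi : Rn -> CC R) :=
  [/\ smooth (fun x => ReC (phi x)), smooth (fun x => ImC (phi x)) &
      compact (closure [set x | phi x != 0])].

(* A distribution is represented by its action on functions; only the values
   on test functions are meaningful, and dist_eq compares only those. *)
Definition dist := (Rn -> CC R) -> CC R.

Definition dist_eq (u v : dist) :=
  forall phi, test_function phi -> u phi = v phi.

Definition Pf (f : Rn -> CC R) : dist :=
  fun phi => Cintegral (fun x => f x * phi x).

Definition dirac0 : dist := fun phi => phi 0.

Definition dist_partial (i : 'I_n) (u : dist) : dist :=
  fun phi => - u (Cpartial i phi).

Definition dist_laplacian (u : dist) : dist :=
  fun phi => \sum_i dist_partial i (dist_partial i u) phi.

Definition shifted_laplacian (kappa : R) (u : dist) : dist :=
  fun phi => dist_laplacian u phi - ofR kappa ^+ 2 * u phi.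

Definition fundamental_solution (kappa : R) (u : dist) :=
  dist_eq (shifted_laplacian kappa u) dirac0.

(* Surface measure on the unit sphere, defined through polar coordinates:
   sigma(E) is n times the Lebesgue measure of the cone over E. *)
Definition surface_measure (E : set Rn) : \bar R :=
  (n%:R%:E * leb [set t | exists2 s : R, (0 < s <= 1)%R &
                          exists2 x, E x & rv t = (s *: x)%R])%E.

Definition vol_sphere : R := fine (surface_measure [set x | enorm x = 1]).

End Distributions.

Section Kernels.
Variables (R : realType) (n : nat) (kappa : R).
Implicit Types (r : R) (j : nat) (Gam : set (CC R)).

Definition Gamma (c : R) : set (CC R) := [set w | ReC w = c].

Definition p0 : R := (vol_sphere R n)^-1.

Definition hinv_at0 j (w : CC R) : CC R := hinv n kappa j w 0.

(* The residue at w = n enters because the contour runs to the left of n; the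
   first test records that requirement. *)
Definition radial_coef Gam j r : CC R :=
  let a : CC R := n%:R in
  let f := hinv_at0 j in
  if ~~ `[< forall w, Gam w -> ReC w < n%:R >] then 0
  else if `[< pole_of_order 1 f a >] then
    - ofR (r ^ (2 - n%:Z)) * ofR p0 * residue f a
  else if `[< pole_of_order 2 f a >] then
    ofR (r ^ (2 - n%:Z)) * ofR p0 * (ofR (ln r) * Res1 f a - Res2 f a)
  else 0.

Definition radial_series Gam r : (CC R)^nat :=
  series (fun j => ofR (r ^+ j) * radial_coef Gam j r).

Definition radial_kernel Gam r : CC R := lim (radial_series Gam r @ \oo).

End Kernels.

(* Main.v *)
Require Import Defs.
From HB Require Import structures.
From mathcomp Require Import all_boot all_order all_algebra.
From mathcomp Require Import all_classical all_reals all_analysis.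
From mathcomp Require Import measurable_realfun complex ring lra.
Set Implicit Arguments.
Unset Strict Implicit.
Unset Printing Implicit Defensive.
Import Order.TTheory GRing.Theory Num.Theory numFieldNormedType.Exports.
Local Open Scope classical_set_scope.
Local Open Scope ring_scope.

(** Only the constants on the sphere enter, so the statement is about a radial
    function, and everything reduces to one recurrence between coefficients.

    The even symbols are [kappa^(2m) / D_m(w)], where [D_m] is the product of the
    factors [(w - 2i - 2) (w - 2i - n)] for [i <= m], and the odd ones vanish
    ([hinv_even], [hinv_odd]).  For [n = 3] the point [w = n] is a simple zero of
    every [D_m]; for [n = 4] it is a simple zero of [D_0] and a double zero of all
    the others.  Reading off residues gives
    [r^(2m) k_(2m)(r) = p0 f_m(r)] with
    [f_m(r) = r^(2m + 2 - n) (a_m ln r - b_m)]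
    ([radial_coefs3], [radial_coefs4]), where [a_0 = 0] and [b_0 = 1/(n - 2)].
    The passage from [D_m] to [D_(m+1)] is a recurrence for [a_m] and [b_m], and
    that recurrence is exactly the radial equation
    [f_(m+1)'' + ((n - 1)/r) f_(m+1)' = kappa^2 f_m].  It also gives
    [|a_m|, |b_m| <= D kappa^(2m) / m!] ([log_term_coef_bound]), so that on a ball
    of radius [M] the series and all its partial sums are bounded by a constant
    times [r^(1 - n)], which is locally integrable.

    It remains to apply the Laplace operator in the sense of distributions.  For
    one radial function [K] with [K'' + ((n - 1)/r) K' = g] away from the origin
    and [r^(n-1) K'(r) --> l] at the origin, [weak_radial_laplacian] states that
    the distributional Laplacian of [K] is [g + l vol(S^(n-1)) delta].  To avoid
    boundary integrals over small spheres, [K(|x|)] is replaced by the twice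
    differentiable function [K(sqrt (|x|^2 + e))], for which integration by parts
    is elementary.  Its Laplacian is [g] of the new radius times a weight that
    tends to [1], plus a bump of the scale of [sqrt e] whose mass tends to
    [l n vol(B)]; no polar coordinates are needed beyond the scaling of
    volumes of balls.  For [f_0 = - r^(2-n) / (n - 2)] one has [g = 0] and [l = 1];
    for [f_(m+1)] one has [g = kappa^2 f_m] and [l = 0].  Summing over [m]
    telescopes, dominated convergence lets the number of terms tend to infinity
    ([weak_laplacian_radial_sum]), and [p0 = 1 / vol(S^(n-1))] normalises the mass
    at the origin to [1]. *)

(** * Lebesgue measure on coordinate space *)

Section Tonelli.
Variables (R : realType) (n : nat).
Local Notation T := (measurableTypeR R).

(** The measure on tuples is a pushforward of a product measure, so Tonelli's
    theorem applies after pulling back along the constructor. *)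
Lemma ge0_integral_tuple_cons (f : n.+1.-tuple T -> \bar R) :
  measurable_fun setT f -> (forall t, 0 <= f t)%E ->
  (\int[lebesgue_tuple R n.+1]_t f t =
   \int[lebesgue_measure]_x \int[lebesgue_tuple R n]_t f (tcons (x, t)))%E.
Proof.
move=> mf f0.
have mc : measurable_fun setT (@tcons _ T n) := @measurable_tcons _ T n.
rewrite [LHS](_ : _ = \int[pushforward (lebesgue_measure \x lebesgue_tuple R n)
   (@tcons _ T n)]_t f t)%E //.
rewrite ge0_integral_pushforward //=.
rewrite preimage_setT fubini_tonelli1 //=.
exact: measurableT_comp.
Qed.

(** Both orders of integration are needed: an integral of a partial derivative
    is computed by integrating first over the coordinate in question. *)
Lemma integral_tuple_cons (f : n.+1.-tuple T -> R) :
  (lebesgue_tuple R n.+1).-integrable setT (EFin \o f) ->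
  (\int[lebesgue_tuple R n.+1]_t (f t)%:E =
   \int[lebesgue_measure]_x \int[lebesgue_tuple R n]_t (f (tcons (x, t)))%:E)%E
  /\
  (\int[lebesgue_tuple R n.+1]_t (f t)%:E =
   \int[lebesgue_tuple R n]_t \int[lebesgue_measure]_x (f (tcons (x, t)))%:E)%E.
Proof.
move=> intf.
have mf : measurable_fun setT (EFin \o f) by case/integrableP : intf.
have mc : measurable_fun setT (@tcons _ T n) := @measurable_tcons _ T n.
have mft : measurable_fun setT (EFin \o f \o @tcons _ T n) by exact: measurableT_comp.
have intf' : (lebesgue_measure \x lebesgue_tuple R n)%E.-integrable setT
    (EFin \o f \o @tcons _ T n).
  apply/integrableP; split => //.
  case/integrableP : intf => _; apply: le_lt_trans.
  rewrite ge0_integral_tuple_cons //; last by exact: measurableT_comp.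
  by rewrite fubini_tonelli1 //; exact: measurableT_comp mft.
have E := integral_pushforward mc mf intf' measurableT.
rewrite preimage_setT in E.
split; apply: (eq_trans E).
  by rewrite -integral12_prod_meas1.
by rewrite -integral21_prod_meas1.
Qed.
End Tonelli.

Section ContinuousMeasurable.
Variables (R : realType) (n : nat).
Local Notation T := (measurableTypeR R).
Local Notation leb := (lebesgue_tuple R n).
Implicit Types (U : set 'rV[R]_n).

Lemma measurable_rv_coord (i : 'I_n) :
  measurable_fun setT (fun t : n.-tuple T => rv t 0 i).
Proof.
rewrite (_ : (fun _ => _) = (@tnth _ T ^~ i)); first exact: measurable_tnth.
by apply/funext => t; rewrite mxE.
Qed.

Lemma measurable_rv_coords (P : 'I_n -> set R) :
  (forall i, measurable (P i : set T)) ->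
  measurable [set t : n.-tuple T | forall i, P i (rv t 0 i)].
Proof.
move=> mP.
rewrite (_ : [set _ | _] =
    \bigcap_(i in setT) ((fun t : n.-tuple T => rv t 0 i) @^-1` P i)).
  apply: fin_bigcap_measurable => // i _.
  by have := measurable_rv_coord i measurableT (mP i); rewrite setTI.
by apply/seteqP; split => t /= h i; [move=> _|]; exact: h.
Qed.

(** The sigma-algebra comes from tuples and the topology from row vectors;
    they agree because an open set is a countable union of sup-norm balls with
    rational centres and radii [1/(m+1)], which are boxes. *)
Lemma open_rv_measurable U : open U -> measurable (@rv R n @^-1` U : set (n.-tuple T)).
Proof.
move=> oU.
pose B (p : 'rV[rat]_n * nat) : set 'rV[R]_n :=
  ball (map_mx ratr p.1 : 'rV[R]_n) (p.2.+1%:R^-1).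
pose F p : set (n.-tuple T) :=
  if `[< B p `<=` U >] then @rv R n @^-1` (B p) else set0.
rewrite (_ : _ @^-1` _ = \bigcup_(p in setT) F p).
  apply: countable_bigcupT_measurable => [|p]; first exact: countableP.
  rewrite /F; case: asboolP => // _.
  rewrite (_ : _ @^-1` _ = [set t : n.-tuple T |
     forall i, ball (ratr (p.1 0 i) : R) p.2.+1%:R^-1 (rv t 0 i)]).
    have mB i : measurable (ball (ratr (p.1 0 i) : R) p.2.+1%:R^-1 : set T).
      exact: measurable_ball.
    exact: (measurable_rv_coords mB).
  apply/seteqP; split => t.
    by move=> [_ h] i; have := h 0 i; rewrite mxE.
  by move=> h; split; [rewrite invr_gt0 ltr0n|move=> i j; rewrite ord1 mxE].
apply/seteqP; split => t /=; last first.
  by move=> [p _]; rewrite /F; case: asboolP => // h /h.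
move=> Ut.
have /nbhs_ballP [e /= e0 He] : nbhs (rv t) U by exact: open_nbhs_nbhs.
have [m Hm] : exists m : nat, m.+1%:R^-1 < e / 2.
  have e2 : 0 < e / 2 by rewrite divr_gt0.
  have [m] := ltr_add_invr e2.
  by rewrite add0r; exists m.
have m0 : 0 < m.+1%:R^-1 :> R by rewrite invr_gt0 ltr0n.
have /choice[q Hq] : forall i, exists q : rat, `|ratr q - rv t 0 i| < m.+1%:R^-1.
  move=> i; have := @rat_in_itvoo R (rv t 0 i) (rv t 0 i + m.+1%:R^-1).
  rewrite ltrDl => /(_ m0) [q]; rewrite in_itv /= => /andP[q1 q2].
  exists q; rewrite ger0_norm ?subr_ge0; last exact: ltW.
  by rewrite ltrBlDl.
exists (\row_i q i, m) => //.
rewrite /F; case: asboolP => [_|].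
  split; first by rewrite /= invr_gt0 ltr0n.
  by move=> i j; rewrite ord1 !mxE; have := Hq j; rewrite mxE.
case=> y [_ yB]; apply: He; split => // i j; rewrite ord1.
have := yB 0 j; rewrite !mxE => H1; have := Hq j; rewrite !mxE.
move: H1; rewrite /ball /= => H1 H2.
have := ler_distD (ratr (q j)) (tnth t j) (y 0 j).
rewrite (distrC (tnth t j)) => /le_lt_trans; apply.
rewrite [e]splitr; apply: ltrD; apply: lt_trans Hm => //.
by rewrite distrC.
Qed.

Lemma continuous_rv_measurable (f : 'rV[R]_n -> R) :
  continuous f -> measurable_fun setT (fun t : n.-tuple T => f (rv t)).
Proof.
move=> /continuousP cf.
apply: (measurability _ (RGenOpens.measurableE R)).
move=> _ [_ [a [b ->]] <-]; rewrite setTI.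
apply: (@open_rv_measurable (f @^-1` `]a, b[%classic)).
by apply: cf; exact: interval_open.
Qed.

(** The cubes centred at the origin stand for all bounded sets: in the sup
    norm they are the closed balls, and their measure is immediate. *)
Definition box (M : R) : set 'rV[R]_n := [set x | forall i, `|x 0 i| <= M].

Lemma box_le M N : M <= N -> box M `<=` box N.
Proof. by move=> MN x xM i; apply: le_trans MN. Qed.

Lemma compact_box M : compact (box M).
Proof.
rewrite (_ : box M = [set v : 'rV[R]_n | forall i, `[- M, M]%classic (v ord0 i)]).
  by apply: (@rV_compact _ _ (fun=> `[- M, M]%classic)) => _; exact: segment_compact.
by apply/seteqP; split => x h i; have := h i; rewrite /= in_itv /= ler_norml.
Qed.

Lemma compact_sub_box (A : set 'rV[R]_n) :
  compact A -> exists2 M, 0 < M & A `<=` box M.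
Proof.
move=> /compact_bounded[M [Mr HM]].
exists (`|M| + 1); first by rewrite ltr_wpDl.
move=> x Ax i; have : M < `|M| + 1.
  by rewrite (le_lt_trans (ler_norm M))// ltrDl.
move=> /HM /(_ x Ax) /=; apply: le_trans.
rewrite [leRHS]/Num.norm /= mx_normrE.
by rewrite (le_bigmax _ (fun ij : 'I_1 * 'I_n => `|x ij.1 ij.2|) (0, i)).
Qed.

Lemma measurable_box M : measurable (@rv R n @^-1` box M : set (n.-tuple T)).
Proof.
have mI (i : 'I_n) : measurable (`[- M, M]%classic : set T) by exact: measurable_itv.
have := measurable_rv_coords mI; congr measurable.
by apply/seteqP; split => t h i; have := h i; rewrite /= in_itv /= ler_norml.
Qed.

Lemma compact_rv_measurable (A : set 'rV[R]_n) : compact A ->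
  measurable (@rv R n @^-1` A : set (n.-tuple T)).
Proof.
move=> /compact_closed -/(_ (@norm_hausdorff _ _)) Acl.
rewrite -[A]setCK preimage_setC; apply: measurableC.
exact: (open_rv_measurable (closed_openC Acl)).
Qed.
End ContinuousMeasurable.

Section Box.
Variables (R : realType).
Local Notation T := (measurableTypeR R).

Lemma lebesgue_tuple_box n (M : R) : 0 <= M ->
  lebesgue_tuple R n (@rv R n @^-1` box M) = ((M *+ 2) ^+ n)%:E.
Proof.
move=> M0; elim: n => [|n IH].
  rewrite expr0 /lebesgue_tuple /= /dirac indicE mem_set //.
  by case.
rewrite /lebesgue_tuple /= /power_step /pushforward.
rewrite (_ : _ @^-1` _ = `[- M, M]%classic `*` (@rv R n @^-1` box M)).
  rewrite product_measure1E //=; last exact: measurable_box.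
  rewrite [X in (_ * X)%E]IH lebesgue_measure_itv /= lte_fin.
  rewrite exprS EFinM opprK -mulr2n; case: ltP => // M0'.
  have -> : M = 0 by lra.
  by rewrite mul0rn.
apply/seteqP; split => -[x t] /=.
  move=> h; split.
    by have := h ord0; rewrite mxE /= (tnth_nth x) /= in_itv /= ler_norml.
  by move=> i; have := h (lift ord0 i); rewrite !mxE !(tnth_nth x) /=.
move=> [h1 h2] i; rewrite mxE; case: (unliftP ord0 i) => [j|] ->.
  by have := h2 j; rewrite !mxE !(tnth_nth x).
by rewrite (tnth_nth x) /=; move: h1; rewrite in_itv /= ler_norml.
Qed.
End Box.

Section BoundedSupport.
Variables (R : realType) (n : nat).
Local Notation T := (measurableTypeR R).
Local Notation leb := (lebesgue_tuple R n).
Implicit Types f : 'rV[R]_n -> R.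

Lemma continuous_box_bounded f (M : R) : continuous f ->
  exists2 C, 0 < C & forall x, box M x -> `|f x| <= C.
Proof.
move=> cf.
have : compact (f @` box M).
  apply: continuous_compact; last exact: compact_box.
  exact: continuous_subspaceT.
move=> /compact_bounded[C [Cr HC]].
exists (`|C| + 1); first by rewrite ltr_wpDl.
move=> x xM; apply: (HC (`|C| + 1)); last by exists x.
by rewrite (le_lt_trans (ler_norm C))// ltrDl.
Qed.

Lemma bounded_box_integrable (f : n.-tuple T -> R) (M C : R) :
  measurable_fun setT f -> (forall t, ~ box M (rv t) -> f t = 0) ->
  (forall t, box M (rv t) -> `|f t| <= C) ->
  leb.-integrable setT (EFin \o f).
Proof.
move=> mf f0 fC.
have mB : measurable (@rv R n @^-1` box M : set (n.-tuple T)) by exact: measurable_box.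
have : leb.-integrable (@rv R n @^-1` box M) (EFin \o f).
  apply: measurable_bounded_integrable => //.
  - have MM : M <= Num.max 0 M by rewrite le_max lexx orbT.
    apply: (@le_lt_trans _ _ (leb (@rv R n @^-1` box (Num.max 0 M)))).
      apply: le_measure; rewrite ?inE//; first exact: measurable_box.
      by move=> t; exact: box_le.
    by rewrite lebesgue_tuple_box ?ltry// le_max lexx.
  - exact: measurable_funTS.
  - exists C; split; first exact: num_real.
    by move=> y Cy t Bt; exact: le_trans (fC _ Bt) (ltW Cy).
rewrite integrable_mkcond //; apply: eq_integrable => //= t _.
by rewrite patchE; case: ifPn => //; rewrite notin_setE => /f0 /= ->.
Qed.

Lemma continuous_box_integrable f (M : R) : continuous f ->
  (forall x, ~ box M x -> f x = 0) ->
  leb.-integrable setT (fun t => (f (rv t))%:E).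
Proof.
move=> cf f0; have [C C0 HC] := continuous_box_bounded M cf.
apply: (@bounded_box_integrable (fun t => f (rv t)) M C).
- exact: continuous_rv_measurable.
- by move=> t; exact: f0.
- by move=> t; exact: HC.
Qed.
End BoundedSupport.

Section Scaling.
Variable R : realType.
Local Notation T := (measurableTypeR R).

(** Lebesgue measure is determined by its values on half-open intervals; on
    these the claim is the computation of a length. *)
Lemma lebesgue_measure_scale (a : R) (A : set T) : 0 < a -> measurable A ->
  lebesgue_measure A =
  (a%:E * pushforward lebesgue_measure ( *%R a : T -> T) A)%E.
Proof.
move=> a0 mA.
have ma : measurable_fun setT ( *%R a : T -> T) by exact: measurable_funM.
pose mf := isMeasurableFun.Build _ _ _ _ _ ma.
pose F : {mfun T >-> T} := HB.pack ( *%R a : T -> T) mf.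
apply: (@lebesgue_measure_unique R (mscale (NngNum (ltW a0))
  (pushforward lebesgue_measure F))) => // _ [[x y]] _ <-.
rewrite [RHS](_ : _ = (a%:E * lebesgue_measure ( *%R a @^-1` `]x, y]%classic))%E)//.
rewrite (_ : _ @^-1` _ = `]x / a, y / a]%classic); last first.
  apply/seteqP; split => z /=; rewrite !in_itv /= ltr_pdivrMr// ler_pdivlMr//;
  by rewrite (mulrC z).
rewrite !lebesgue_measure_itv /= !lte_fin ltr_pM2r ?invr_gt0//.
case: ifP => _; last by rewrite mule0.
by rewrite -EFinM -mulrBl mulrC divfK ?gt_eqF.
Qed.

Lemma ge0_integral_scale1 (a : R) (f : T -> \bar R) : 0 < a ->
  measurable_fun setT f -> (forall x, 0 <= f x)%E ->
  (\int[lebesgue_measure]_x f (a * x)%R = a^-1%:E * \int[lebesgue_measure]_x f x)%E.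
Proof.
move=> a0 mf f0.
have ma : measurable_fun setT ( *%R a : T -> T) by exact: measurable_funM.
pose mF := isMeasurableFun.Build _ _ _ _ _ ma.
pose F : {mfun T >-> T} := HB.pack ( *%R a : T -> T) mF.
have := @ge0_integral_pushforward _ _ T T R F ma lebesgue_measure setT f measurableT mf.
rewrite preimage_setT => <-//.
have -> : (\int[lebesgue_measure]_x f x = \int[mscale (NngNum (ltW a0))
    (pushforward lebesgue_measure F)]_x f x)%E.
  move=> m; apply: eq_measure_integral => A mA _; exact: lebesgue_measure_scale.
rewrite ge0_integral_mscale//= muleA -EFinM mulVf ?mul1e// gt_eqF//.
Qed.

Definition tscale n (a : R) (t : n.-tuple T) : n.-tuple T := map_tuple ( *%R a) t.

Lemma rv_tscale n a (t : n.-tuple T) : rv (tscale a t) = a *: rv t.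
Proof. by apply/rowP => i; rewrite !mxE tnth_map. Qed.

Lemma measurable_tscale n a : measurable_fun setT (@tscale n a).
Proof.
apply/measurable_fun_tnthP => i.
rewrite (_ : _ \o _ = (fun t : n.-tuple T => a * tnth t i)).
  by apply: measurable_funM => //; exact: measurable_tnth.
by apply/funext => t /=; rewrite tnth_map.
Qed.

(** By induction on the dimension: each coordinate contributes one factor
    [a^-1] from the one-dimensional change of variables. *)
Lemma ge0_integral_tscale n (a : R) (f : n.-tuple T -> \bar R) : 0 < a ->
  measurable_fun setT f -> (forall x, 0 <= f x)%E ->
  (\int[lebesgue_tuple R n]_t f (tscale a t) =
   (a^-1 ^+ n)%:E * \int[lebesgue_tuple R n]_t f t)%E.
Proof.
move=> a0; elim: n f => [|n IH] f mf f0.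
  rewrite expr0 mul1e; apply: eq_integral => t _.
  by congr f; rewrite [LHS]tuple0 [RHS]tuple0.
have ms := @measurable_tscale n.+1 a.
have mc : measurable_fun setT (@tcons _ T n) := @measurable_tcons _ T n.
rewrite ge0_integral_tuple_cons//; last exact: measurableT_comp mf ms.
rewrite ge0_integral_tuple_cons//.
have mfc : measurable_fun setT (f \o @tcons _ T n) by exact: measurableT_comp.
pose g x := (\int[lebesgue_tuple R n]_t f (tcons (x, t)))%E.
have mg : measurable_fun setT (g : T -> \bar R).
  apply: (@measurable_fun_fubini_tonelli_F _ _ T (n.-tuple T) R
    (lebesgue_tuple R n) (f \o @tcons _ T n)) => // x.
  exact: f0.
transitivity (\int[lebesgue_measure]_x ((a^-1 ^+ n)%:E * g (a * x)%R))%E.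
  apply: eq_integral => x _; rewrite -IH//; last first.
    by apply: measurableT_comp mf _; exact: measurableT_comp.
  apply: eq_integral => t _; congr f; apply: val_inj => /=.
  by [].
have g0 x : (0 <= g x)%E by exact: integral_ge0.
rewrite ge0_integralZl//; last first.
- by rewrite lee_fin exprn_ge0// invr_ge0 ltW.
- by apply: measurableT_comp mg _; exact: measurable_funM.
by rewrite ge0_integral_scale1// muleA -EFinM -exprSr.
Qed.
End Scaling.

(** * The Euclidean norm and the volume of balls *)

Section Enorm.
Variables (R : realType) (n : nat).
Local Notation T := (measurableTypeR R).
Local Notation leb := (lebesgue_tuple R n).
Implicit Types x : 'rV[R]_n.

Definition sqnorm x : R := \sum_i x 0 i ^+ 2.

Lemma sqnorm_ge0 x : 0 <= sqnorm x.
Proof. by apply: sumr_ge0 => i _; exact: sqr_ge0. Qed.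

Lemma enorm_ge0 x : 0 <= enorm x.
Proof. exact: sqrtr_ge0. Qed.

Lemma enorm_sqr x : enorm x ^+ 2 = sqnorm x.
Proof. by rewrite sqr_sqrtr// sqnorm_ge0. Qed.

Lemma enormZ (a : R) x : enorm (a *: x) = `|a| * enorm x.
Proof.
rewrite /enorm (eq_bigr (fun i => a ^+ 2 * x 0 i ^+ 2)); last first.
  by move=> i _; rewrite mxE exprMn.
by rewrite -mulr_sumr sqrtrM ?sqr_ge0// sqrtr_sqr.
Qed.

Lemma coord_le_enorm x i : `|x 0 i| <= enorm x.
Proof.
rewrite -sqrtr_sqr ler_wsqrtr// (bigD1 i)//= lerDl.
by apply: sumr_ge0 => j _; exact: sqr_ge0.
Qed.

Lemma enorm_eq0 x : (enorm x == 0) = (x == 0).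
Proof.
apply/eqP/eqP => [x0|->]; last first.
  by rewrite /enorm big1 ?sqrtr0// => i _; rewrite mxE expr0n.
apply/rowP => i; apply/eqP; rewrite mxE -normr_le0 -x0.
exact: coord_le_enorm.
Qed.

Lemma enorm_gt0 x : (0 < enorm x) = (x != 0).
Proof. by rewrite lt_def enorm_ge0 andbT enorm_eq0. Qed.

Lemma enorm_sub_box M : [set x | enorm x <= M] `<=` @box R n M.
Proof. by move=> x xM i; exact: le_trans (coord_le_enorm _ _) xM. Qed.

Lemma sqnorm_box M x : box M x -> sqnorm x <= M ^+ 2 *+ n.
Proof.
move=> xM; rewrite -[leRHS]mulr_natl -[X in X%:R](card_ord n) -sumr_const mulr_suml.
apply: ler_sum => i _; rewrite mul1r -(ger0_norm (sqr_ge0 _)) normrX.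
by rewrite lerXn2r// ?nnegrE// (le_trans _ (xM i)).
Qed.

Lemma enorm_box (M : R) x : 0 <= M -> box M x -> enorm x <= M * n%:R.
Proof.
move=> M0 /sqnorm_box xM.
rewrite -(@ler_pXn2r _ 2)// ?nnegrE ?enorm_ge0 ?mulr_ge0//.
rewrite enorm_sqr (le_trans xM)// exprMn -natrX -mulr_natr ler_wpM2l ?sqr_ge0//.
by rewrite ler_nat; case: (n) => // k; rewrite leq_pmulr.
Qed.

Lemma continuous_sqnorm : continuous sqnorm.
Proof.
rewrite /sqnorm; apply: continuous_big => [|i _]; first exact: add_continuous.
move=> x; apply: (@continuous_comp _ _ _ (fun y : 'rV[R]_n => y 0 i) (fun z : R => z ^+ 2)).
  exact: coord_continuous.
exact: exprn_continuous.
Qed.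

Lemma continuous_enorm : continuous (@enorm R n).
Proof.
move=> x; apply: continuous_comp; first exact: continuous_sqnorm.
exact: sqrt_continuous.
Qed.
Definition cball (r : R) : set (n.-tuple T) := @rv R n @^-1` [set x | enorm x <= r].

Lemma measurable_enorm : measurable_fun setT (fun t : n.-tuple T => enorm (rv t)).
Proof. exact: continuous_rv_measurable continuous_enorm. Qed.

Lemma measurable_cball r : measurable (cball r).
Proof.
have mI : measurable (`]-oo, r]%classic : set T) by exact: measurable_itv.
have := measurable_enorm measurableT mI; by rewrite setTI; congr measurable.
Qed.

Lemma leb_cball_fin r : (leb (cball r) < +oo)%E.
Proof.
have rr : r <= Num.max 0 r by rewrite le_max lexx orbT.
apply: (@le_lt_trans _ _ (leb (@rv R n @^-1` box (Num.max 0 r)))).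
  apply: le_measure; rewrite ?inE; [exact: measurable_cball|exact: measurable_box|].
  by move=> t /(le_trans) /(_ rr) /enorm_sub_box.
by rewrite lebesgue_tuple_box ?ltry// le_max lexx.
Qed.

Definition ball_vol : R := fine (leb (cball 1)).

Lemma ball_volE : leb (cball 1) = ball_vol%:E.
Proof. by rewrite fineK// ge0_fin_numE// leb_cball_fin. Qed.

Lemma ball_vol_ge0 : 0 <= ball_vol.
Proof. by rewrite fine_ge0. Qed.

(** The unit ball is the preimage of the ball of radius [r] under scaling by
    [r], so the scaling of integrals applied to an indicator gives the power
    of [r]. *)
Lemma leb_cball (r : R) : 0 < r -> leb (cball r) = (r ^+ n * ball_vol)%:E.
Proof.
move=> r0; have mr := measurable_cball r.
have mf : measurable_fun setT (fun t : n.-tuple T => (\1_(cball r) t : R)%:E).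
  by apply/measurable_EFinP; exact: measurable_indic.
have := ge0_integral_tscale r0 mf (fun t => ltac:(by rewrite lee_fin)).
have -> : (\int[leb]_t (\1_(cball r) t)%:E = leb (cball r))%E.
  by rewrite integral_indic// setIT.
have -> : (\int[leb]_t (\1_(cball r) (tscale r t))%:E = ball_vol%:E)%E.
  rewrite -ball_volE -[X in leb X]setIT -integral_indic//; last exact: measurable_cball.
  apply: eq_integral => t _; rewrite !indicE; congr (_%:R%:E); congr nat_of_bool.
  apply/idP/idP; rewrite !inE /cball /= rv_tscale enormZ gtr0_norm//;
  by rewrite -ler_pdivlMl// mulVf// gt_eqF.
move=> E; rewrite EFinM E muleA -EFinM -exprMn mulfV ?gt_eqF// expr1n.
by rewrite mul1e.
Qed.

End Enorm.

Section Enorm1.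
Variables (R : realType) (n : nat).
Local Notation T := (measurableTypeR R).
Local Notation leb := (lebesgue_tuple R n).
Hypothesis n0 : (0 < n)%N.

Lemma leb_origin : leb (@rv R n @^-1` [set 0]) = 0%E.
Proof.
rewrite (_ : [set 0] = box 0).
  by rewrite lebesgue_tuple_box// mul0rn expr0n eqn0Ngt n0.
apply/seteqP; split => x /=; first by move=> -> i; rewrite mxE normr0.
by move=> x0; apply/rowP => i; apply/eqP; rewrite mxE -normr_le0; exact: x0.
Qed.

Lemma measurable_origin : measurable (@rv R n @^-1` [set 0] : set (n.-tuple T)).
Proof. by apply: compact_rv_measurable; exact: compact_set1. Qed.

Lemma ball_vol_gt0 : 0 < ball_vol R n.
Proof.
rewrite lt_neqAle ball_vol_ge0 andbT; apply/eqP => V0.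
(* A box of half-side [e] has positive measure and lies in the unit ball,
   since [|x| <= e n] on it. *)
pose e : R := n.+1%:R^-1.
have e0 : 0 < e by rewrite invr_gt0 ltr0n.
have : (leb (@rv R n @^-1` box e) <= leb (cball 1))%E.
  apply: le_measure; rewrite ?inE; [exact: measurable_box|exact: measurable_cball|].
  move=> t /(enorm_box (ltW e0)) /=; rewrite /cball/= => /le_trans; apply.
  by rewrite /e mulrC ler_pdivrMr ?ltr0n// mul1r ler_nat.
rewrite ball_volE -V0 lebesgue_tuple_box; last exact: ltW.
by rewrite lee_fin leNgt exprn_gt0// mulrn_wgt0.
Qed.

(** The cone over the unit sphere is the punctured closed unit ball, and a
    point has measure zero in positive dimension. *)
Lemma vol_sphereE : vol_sphere R n = n%:R * ball_vol R n.
Proof.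
rewrite /vol_sphere /surface_measure.
rewrite (_ : [set t | _] = @cball R n 1 `\` @rv R n @^-1` [set 0]); last first.
  apply/seteqP; split => t /=.
    move=> [s /andP[s0 s1] [x x1 tE]]; rewrite /cball/= tE enormZ x1 mulr1 gtr0_norm//.
    split => //; apply/eqP; rewrite scaler_eq0 gt_eqF//= -enorm_eq0 x1.
    exact: oner_neq0.
  rewrite /cball /= => -[t1 /eqP t0]; exists (enorm (rv t)).
    by rewrite enorm_gt0 t0.
  exists ((enorm (rv t))^-1 *: rv t).
    by rewrite /= enormZ ger0_norm ?invr_ge0 ?enorm_ge0// mulVf// enorm_eq0.
  by rewrite scalerA mulfV ?scale1r// enorm_eq0.
rewrite measureD; [|exact: measurable_cball|exact: measurable_origin|exact: leb_cball_fin].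
rewrite [X in (_ - X)%E](_ : _ = 0%E).
  by rewrite sube0 [X in (_ * X)%E](ball_volE R n).
apply/eqP; rewrite eq_le measure_ge0 andbT -leb_origin.
by apply: le_measure; rewrite ?inE;
  [exact: measurableI (measurable_cball _) measurable_origin|exact: measurable_origin|].
Qed.

End Enorm1.

Section LayerCake.
Variables (R : realType) (n : nat).
Local Notation T := (measurableTypeR R).
Local Notation leb := (lebesgue_tuple R n).
Hypothesis n0 : (0 < n)%N.

Lemma measurable_bool_natr d (X : measurableType d) (b : X -> bool) :
  measurable_fun setT b -> measurable_fun setT (fun x => (b x)%:R : T).
Proof.
move=> mb; rewrite (_ : (fun _ => _) = (fun x => if b x then 1 else 0 : T)).
  exact: measurable_fun_ifT.
by apply/funext => x; case: (b x).
Qed.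

Variable phi : R -> R.
Hypothesis mphi : measurable_fun setT (phi : T -> T).
Hypothesis phi0 : forall r, 0 <= phi r.

Let f (z : n.-tuple T * T) : \bar R :=
  (phi z.2 * (enorm (rv z.1) <= z.2)%R%:R)%:E.

Let mf : measurable_fun setT f.
Proof.
apply/measurable_EFinP; apply: measurable_funM.
  exact: measurableT_comp.
apply: measurable_bool_natr.
apply: measurable_fun_ler => //.
exact: measurableT_comp (@measurable_enorm R n) _.
Qed.

Let f0 z : (0 <= f z)%E.
Proof. by rewrite lee_fin mulr_ge0// ler0n. Qed.

Let fE (t : n.-tuple T) : (\int[lebesgue_measure]_r f (t, r) =
  \int[lebesgue_measure]_(r in `[enorm (rv t), +oo[) (phi r)%:E)%E.
Proof.
rewrite [RHS]integral_mkcond; apply: eq_integral => r _.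
rewrite patchE /f /= mem_setE in_itv /= andbT.
by case: ifP => _; rewrite ?mulr1 ?mulr0.
Qed.

Lemma measurable_tail_integral : measurable_fun setT (fun t : n.-tuple T =>
  \int[lebesgue_measure]_(r in `[enorm (rv t), +oo[) (phi r)%:E)%E.
Proof.
rewrite (_ : (fun _ => _) = fubini_F lebesgue_measure f).
  exact: measurable_fun_fubini_tonelli_F.
by apply/funext => t; rewrite -fE.
Qed.

(** Exchange the order of integration over the pairs [(x, r)] with [|x| <= r]:
    for fixed [r] the inner integral is the volume of a ball. This reduces
    integrals of radial functions to one-dimensional ones without polar
    coordinates. *)
Lemma layer_cake :
  (\int[leb]_t \int[lebesgue_measure]_(r in `[enorm (rv t), +oo[) (phi r)%:E =
   \int[lebesgue_measure]_(r in `[0%R, +oo[) (phi r * (r ^+ n * ball_vol R n))%:E)%E.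
Proof.
have := @fubini_tonelli2 _ _ _ _ R leb lebesgue_measure f mf f0.
rewrite fubini_tonelli1 // => E.
transitivity (\int[leb]_t \int[lebesgue_measure]_r f (t, r))%E.
  by apply: eq_integral => t _; rewrite fE.
rewrite [LHS]E [RHS]integral_mkcond; apply: eq_integral => r _.
rewrite /fubini_G patchE mem_setE in_itv /= andbT /f /=.
under eq_integral => t _ do rewrite EFinM.
rewrite ge0_integralZl//; last first.
- by rewrite lee_fin.
- apply/measurable_EFinP.
  apply: measurable_bool_natr.
  by apply: measurable_fun_ler => //; exact: measurable_enorm.
have -> : (\int[leb]_t (enorm (rv t) <= r)%R%:R%:E = leb (cball r))%E.
  rewrite -[X in leb X]setIT -integral_indic//; last exact: measurable_cball.
  apply: eq_integral => t _; rewrite indicE; congr (_%:R%:E); congr nat_of_bool.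
  by apply/idP/idP; rewrite inE.
have [r0|r0|<-] := ltgtP 0 r.
- by rewrite leb_cball// EFinM.
- rewrite (_ : cball r = set0) ?measure0 ?mule0//.
  apply/seteqP; split => t //=; rewrite /cball/= => tr.
  by have := le_lt_trans tr r0; rewrite ltNge enorm_ge0.
- rewrite expr0n eqn0Ngt n0 mul0r mulr0.
  rewrite (_ : cball 0 = @rv R n @^-1` [set 0]) ?leb_origin ?mule0//.
  apply/seteqP; split => t; rewrite /cball/=; [move=> tr|move=> ->].
    by apply/eqP; rewrite -enorm_eq0 eq_le enorm_ge0 tr.
  by rewrite (_ : enorm 0 = 0)//; apply/eqP; rewrite enorm_eq0.
Qed.

End LayerCake.

(** * Integrability of inverse powers of the norm *)

Lemma continuous_invX (R : realType) k :
  {in `]0, +oo[, continuous (fun r : R => r^-1 ^+ k)}.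
Proof.
move=> r /[!in_itv]/= /[!andbT] r0.
have h : {for r, continuous (@GRing.inv R)} by apply: inv_continuous; rewrite gt_eqF.
exact: (cvg_comp _ _ h (@exprn_continuous _ k _)).
Qed.

Section Radial.
Variables (R : realType) (n : nat).
Local Notation T := (measurableTypeR R).
Local Notation leb := (lebesgue_tuple R n).

(** The value at the origin is split off, so that radial functions with a
    singularity there are covered. *)
Lemma measurable_radial (K : R -> R) : {in `]0, +oo[, continuous K} ->
  measurable_fun setT (fun t : n.-tuple T => K (enorm (rv t))).
Proof.
move=> cK.
pose K' r := if (r : T) \in `]0, +oo[ then K r else K 0.
have mK : measurable_fun setT (K' : T -> T).
  rewrite (_ : K' = (fun r => ((K : T -> T) \_ `]0%R, +oo[%classic) r +
     ((cst (K 0) : T -> T) \_ (~` `]0%R, +oo[%classic)) r)); last first.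
    apply/funext => r; rewrite /K' !patchE mem_setE in_setC mem_setE.
    by case: ifP => _; rewrite /= ?addr0 ?add0r.
  apply: measurable_funD.
    apply/(measurable_restrictT _ _).1; first exact: measurable_itv.
    apply: open_continuous_measurable_fun => //.
    by move=> r /[!inE]; exact: cK.
  by apply/(measurable_restrictT _ _).1 => //; exact: measurableC.
rewrite (_ : (fun _ => _) = K' \o (fun t => enorm (rv t))); last first.
  apply/funext => t; rewrite /K' /= in_itv /= andbT; case: ltP => //.
  by move=> t0; congr K; apply/eqP; rewrite eq_le enorm_ge0 t0.
by apply: measurableT_comp => //; exact: measurable_enorm.
Qed.

Hypothesis n1 : (1 < n)%N.
Let n0 : (0 < n)%N := ltnW n1.

(** The layer-cake formula is applied to [phi r = r^(-n)] cut off at twice the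
    largest radius. Its tail integral over [[s, 2s]] alone is at least [2^(-n)
    s^(1-n)], and against the volume [r^n] of balls it integrates a constant
    over a bounded interval. *)
Lemma enorm_exp_integrable (M : R) : 0 < M ->
  leb.-integrable (@rv R n @^-1` box M) (fun t => ((enorm (rv t))^-1 ^+ n.-1)%:E).
Proof.
move=> M0.
have mB : measurable (@rv R n @^-1` box M : set (n.-tuple T)) by exact: measurable_box.
have mf : measurable_fun setT (fun t : n.-tuple T => ((enorm (rv t))^-1 ^+ n.-1)%:E).
  apply/measurable_EFinP.
  apply: (@measurable_radial (fun r => r^-1 ^+ n.-1)).
  exact: continuous_invX.
pose N := M * n%:R; have N0 : 0 < N by rewrite mulr_gt0// ltr0n.
pose N2 : R := N *+ 2.
pose phi : T -> T := (fun r => r^-1 ^+ n) \_ `]0%R, N2]%classic.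
have mphi : measurable_fun setT phi.
  apply/(measurable_restrictT _ _).1; first exact: measurable_itv.
  have mpos : measurable_fun (`]0%R, +oo[%classic : set T) (fun r : T => (r : R)^-1 ^+ n : T).
    apply: open_continuous_measurable_fun => //.
    by move=> r /[!inE]; exact: continuous_invX.
  apply: (measurable_funS _ _ mpos); first exact: measurable_itv.
  by apply: subset_itvl.
have phi0 r : 0 <= phi r.
  rewrite /phi patchE; case: ifP => //; rewrite mem_setE in_itv /= => /andP[r0 _].
  by rewrite exprn_ge0// invr_ge0 ltW.
have inner_ge0 s : (0 <= \int[lebesgue_measure]_(r in `[s, +oo[) (phi r)%:E)%E.
  by apply: integral_ge0 => r _; rewrite lee_fin.
have inner (s : R) : 0 < s -> s <= N ->
    ((s^-1 ^+ n.-1)%:E <=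
      (2 ^+ n)%:E * \int[lebesgue_measure]_(r in `[s, +oo[) (phi r)%:E)%E.
  move=> s0 sN.
  (* [c] is the least value of [phi] on [[s, 2s]]. *)
  pose c : R := (s *+ 2)^-1 ^+ n.
  pose s2 : R := s *+ 2.
  apply: (@le_trans _ _ ((2 ^+ n)%:E * \int[lebesgue_measure]_(r in `[s, s2]) c%:E)%E).
    rewrite integral_cst//= lebesgue_measure_itv /= lte_fin.
    rewrite ifT; last by rewrite /s2 mulr2n ltrDl.
    rewrite -EFinB /s2 mulr2n addrK -!EFinM lee_fin.
    rewrite /c -(mulr_natr s) invfM exprMn.
    rewrite (_ : _ * _ = s^-1 ^+ n.-1 * (2 ^+ n * 2^-1 ^+ n) * (s^-1 * s)); last first.
      by rewrite -{2}(prednK n0) (exprS s^-1); ring.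
    by rewrite -exprMn mulfV ?pnatr_eq0// expr1n mulVf ?gt_eqF// !mulr1.
  rewrite lee_pmul2l ?lte_fin ?exprn_gt0//.
  apply: (@le_trans _ _ (\int[lebesgue_measure]_(r in `[s, s2]) (phi r)%:E)%E).
    apply: ge0_le_integral => //.
    - by move=> r _; rewrite lee_fin exprn_ge0// invr_ge0 mulrn_wge0// ltW.
    - by apply/measurable_EFinP; exact: measurable_funTS.
    - move=> r /=; rewrite in_itv /= => /andP[sr r2s].
      have r0 := lt_le_trans s0 sr.
      rewrite lee_fin /phi patchE ifT; last first.
        rewrite mem_setE in_itv /= r0 (le_trans r2s)//.
        by rewrite lerMn2r.
      have s20 : 0 < s2 by rewrite mulrn_wgt0.
      have ir : s2^-1 <= r^-1 by rewrite lef_pV2 ?posrE.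
      have is2 : 0 <= s2^-1 by rewrite invr_ge0 ltW.
      by apply: lerXn2r => //; rewrite nnegrE// (le_trans is2).
  apply: ge0_subset_integral => //.
  - by apply/measurable_EFinP; exact: measurable_funTS.
  - by move=> r _; rewrite lee_fin.
  - by apply: subset_itvl.
apply/integrableP; split; first exact: measurable_funTS.
pose g (t : n.-tuple T) :=
  (\int[lebesgue_measure]_(r in `[enorm (rv t), +oo[) (phi r)%:E)%E.
have mg : measurable_fun setT g by exact: measurable_tail_integral.
apply: (@le_lt_trans _ _ (\int[leb]_(t in @rv R n @^-1` box M) ((2 ^+ n)%:E * g t)))%E.
  apply: ge0_le_integral => //.
  - by apply: measurableT_comp => //; exact: measurable_funTS.
  - by apply: measurable_funTS; apply: measurable_funeM.
  move=> t /(enorm_box (ltW M0)) tN; rewrite gee0_abs; last first.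
    by rewrite lee_fin exprn_ge0// invr_ge0 enorm_ge0.
  have := enorm_ge0 (rv t); rewrite le_eqVlt => /orP[/eqP t0|t0]; last exact: inner.
  (* At the origin the left side is [0^-1 ^+ n.-1], which is [0] as [1 < n]. *)
  rewrite -t0 invr0 expr0n; case: eqP => [|_].
    by move: n1; case: (n) => [|[]].
  by rewrite mule_ge0 ?lee_fin ?exprn_ge0// inner_ge0.
rewrite ge0_integralZl//; [|exact: measurable_funTS|by move=> *; rewrite ?lee_fin ?exprn_ge0 ?inner_ge0].
rewrite lte_mul_pinfty ?lee_fin ?exprn_ge0//.
apply: (@le_lt_trans _ _ (\int[leb]_t g t))%E.
  by apply: ge0_subset_integral => // t _; exact: inner_ge0.
rewrite layer_cake//.
rewrite (_ : (\int[_]_(_ in _) _)%E =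
  \int[lebesgue_measure]_(r in `]0%R, N2]) (ball_vol R n)%:E)%E; last first.
  rewrite [LHS]integral_mkcond [RHS]integral_mkcond; apply: eq_integral => r _.
  rewrite !patchE /phi patchE !mem_setE !in_itv /= andbT.
  case: (ltrP 0 r) => [r0|r0] /=; last first.
    by case: ifP => //; rewrite mul0r.
  rewrite (ltW r0); case: ifP => _; last by rewrite mul0r.
  by rewrite mulrA -exprMn mulVf ?gt_eqF// expr1n mul1r.
rewrite integral_cst//= lebesgue_measure_itv /= lte_fin; case: ifP => _.
  by rewrite -EFinB -EFinM ltry.
by rewrite mule0 ltry.
Qed.
End Radial.

(** * Smoothing the radius at the origin *)

Lemma is_derive_ext (R : numFieldType) (V W : normedModType R) (f g : V -> W)
    (x v : V) (df dg : W) :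
  f =1 g -> df = dg -> is_derive x v f df -> is_derive x v g dg.
Proof. by move=> /funext -> ->. Qed.

Section Bracket.
Variable R : realType.
Implicit Types (r e : R).

(** The Japanese bracket of [r] at scale [sqrt e]. As a function of a point it
    is smooth and positive, even at the origin. *)
Definition bracket e r : R := Num.sqrt (r ^+ 2 + e).

Lemma bracket_gt0 e r : 0 < e -> 0 < bracket e r.
Proof. by move=> e0; rewrite sqrtr_gt0 ltr_wpDl// sqr_ge0. Qed.

Lemma bracket_sqr e r : 0 <= e -> bracket e r ^+ 2 = r ^+ 2 + e.
Proof. by move=> e0; rewrite sqr_sqrtr// addr_ge0// sqr_ge0. Qed.

Lemma ge_bracket e r : 0 <= e -> 0 <= r -> r <= bracket e r.
Proof.
move=> e0 r0; rewrite -[leLHS](ger0_norm r0) -sqrtr_sqr ler_wsqrtr//.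
by rewrite lerDl.
Qed.

Lemma is_derive_bracket e r : 0 < e -> is_derive r 1 (bracket e) (r / bracket e r).
Proof.
move=> e0; have p0 : 0 < r ^+ 2 + e by rewrite ltr_wpDl// sqr_ge0.
have h := is_derive1_sqrt p0.
have hd : is_derive r 1 (fun x : R => x ^+ 2 + e) (r *+ 2).
  apply: is_derive_ext (is_deriveD (is_deriveX 2 (is_derive_id r 1)) (is_derive_cst e r 1)) => //.
  by rewrite /GRing.scale /= addr0 mulr1 expr1 mulr_natl.
apply: is_derive_ext
  (@is_derive1_comp _ Num.sqrt (fun x : R => x ^+ 2 + e) r _ _ h hd) => //.
rewrite -/(bracket e r) -mulr_natl.
by field; rewrite gt_eqF ?bracket_gt0.
Qed.

Lemma is_derive_bracket_expV e k r : 0 < e ->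
  is_derive r 1 (fun x => (bracket e x)^-1 ^+ k)
    (- (k%:R * r * (bracket e r)^-1 ^+ k.+2)).
Proof.
move=> e0; have q0 : bracket e r != 0 by rewrite gt_eqF// bracket_gt0.
have h := is_deriveV q0 (is_derive_bracket r e0).
apply: is_derive_ext (is_deriveX k h) => [y|]; first by rewrite fctE.
rewrite /GRing.scale /=; case: k => [|k]; first by rewrite !mul0r oppr0.
by rewrite /= !exprS; field.
Qed.

Lemma continuous_bracket e : continuous (bracket e).
Proof.
move=> r; apply: (@continuous_comp _ _ _ (fun x : R => x ^+ 2 + e) Num.sqrt).
  by apply: continuousD; [exact: exprn_continuous|exact: cst_continuous].
exact: sqrt_continuous.
Qed.

Lemma continuous_bracketV e k : 0 < e -> continuous (fun r => (bracket e r)^-1 ^+ k).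
Proof.
move=> e0 r; have h := is_derive_bracket_expV k r e0.
by apply: differentiable_continuous; apply/derivable1_diffP; case: h.
Qed.

Lemma cvg_bracketV e k : 0 < e -> (fun r => (bracket e r)^-1 ^+ k.+1) r @[r --> +oo] --> 0.
Proof.
move=> e0.
have h : (fun r => (bracket e r)^-1) r @[r --> +oo] --> 0.
  apply: (@squeeze_cvgr _ _ _ _ (cst 0) (fun r => r^-1)).
  - near=> r; have r0 : 0 < r by near: r; exact: nbhs_pinfty_gt.
    rewrite invr_ge0 ltW ?bracket_gt0//= lef_pV2 ?posrE ?bracket_gt0//.
    by apply: ge_bracket; exact: ltW.
  - exact: cvg_cst.
  - by apply/gtr0_cvgV0; [near=> r; near: r; exact: nbhs_pinfty_gt|exact: cvg_id].
by have := cvg_comp _ _ h (@exprn_continuous _ k.+1 0); rewrite expr0n.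
Unshelve. all: by end_near. Qed.

Lemma cvg_div_bracket e : 0 < e -> r * (bracket e r)^-1 @[r --> +oo] --> (1 : R).
Proof.
move=> e0.
have h : Num.sqrt (1 - e * (bracket e r)^-1 ^+ 2) @[r --> +oo] --> (1 : R).
  have h1 : 1 - e * (bracket e r)^-1 ^+ 2 @[r --> +oo] --> (1 : R).
    rewrite -[X in _ --> X]subr0 -[X in _ - X](mulr0 e).
    by apply: cvgB; [exact: cvg_cst|apply: cvgMr; exact: cvg_bracketV].
  by have := cvg_comp _ _ h1 (@sqrt_continuous R 1); rewrite sqrtr1.
apply: cvg_trans h; apply: near_eq_cvg; near=> r.
have r0 : 0 < r by near: r; exact: nbhs_pinfty_gt.
have b0 := bracket_gt0 r e0.
rewrite -[RHS]ger0_norm ?mulr_ge0 ?invr_ge0 ?ltW// -sqrtr_sqr; congr Num.sqrt.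
apply: (mulIf (x := bracket e r ^+ 2)); first by rewrite expf_eq0 gt_eqF.
rewrite mulrBl -mulrA -exprMn mulVf ?gt_eqF// expr1n mul1r mulr1.
by rewrite -exprMn -mulrA mulVf ?gt_eqF// mulr1 bracket_sqr ?ltW// addrK.
Unshelve. all: by end_near. Qed.

End Bracket.

Section PoissonKernel.
Variables (R : realType) (n : nat).
Local Notation T := (measurableTypeR R).
Local Notation leb := (lebesgue_tuple R n).
Hypothesis n0 : (0 < n)%N.

(** The decreasing function [(1 + s^2)^(-(n+2)/2)] is the tail integral of
    [phi r = (n+2) r (1 + r^2)^(-(n+4)/2)], so the layer-cake formula leaves
    the integral of [phi r * r^n] over the half-line, whose primitive is the
    power [n+2] of [r / sqrt (1 + r^2)], a function increasing from [0] to
    [1]. *)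
Lemma integral_bracketV :
  (\int[leb]_t ((bracket 1 (enorm (rv t)))^-1 ^+ n.+2)%:E = (ball_vol R n)%:E)%E.
Proof.
pose phi (r : R) : R := n.+2%:R * `|r| * (bracket 1 r)^-1 ^+ n.+4.
have cphi : continuous phi.
  move=> r; apply: cvgM; last exact: continuous_bracketV.
  by apply: cvgM; [exact: cvg_cst|exact: norm_continuous].
have phi0 r : 0 <= phi r.
  rewrite /phi; apply: mulr_ge0; first exact: mulr_ge0.
  by rewrite exprn_ge0// invr_ge0 sqrtr_ge0.
have mphi : measurable_fun setT (phi : T -> T) by exact: continuous_measurable_fun.
have E := layer_cake n0 mphi phi0.
transitivity (\int[leb]_t \int[lebesgue_measure]_(r in `[enorm (rv t), +oo[) (phi r)%:E)%E.
  apply: eq_integral => t _.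
  rewrite (@ge0_continuous_FTC2y _ phi (fun r => - (bracket 1 r)^-1 ^+ n.+2) _ 0)//.
  - by rewrite sub0e -EFinN opprK.
  - exact: continuous_subspaceT.
  - by rewrite -oppr0; apply: cvgN; exact: cvg_bracketV.
  - move=> r _; apply: derivableN.
    by case: (is_derive_bracket_expV n.+2 r (@ltr01 R)).
  - by apply: cvg_at_right_filter; apply: cvgN; exact: continuous_bracketV.
  - move=> r; rewrite in_itv /= andbT => tr.
    have r0 := le_lt_trans (enorm_ge0 _) tr.
    rewrite derive1E deriveN; last by case: (is_derive_bracket_expV n.+2 r (@ltr01 R)).
    by rewrite (@derive_val _ _ _ _ _ _ _ (is_derive_bracket_expV n.+2 r ltr01)) opprK /phi gtr0_norm.
rewrite E.
(* A primitive of [phi r * (r ^+ n * ball_vol R n)]. *)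
pose G (r : R) := ball_vol R n * (r * (bracket 1 r)^-1) ^+ n.+2.
have dG (r : R) : is_derive r 1 G (ball_vol R n * (n.+2%:R * r ^+ n.+1 * (bracket 1 r)^-1 ^+ n.+4)).
  have b0 : bracket 1 r != 0 by rewrite gt_eqF// bracket_gt0.
  have hV := is_deriveV b0 (is_derive_bracket r ltr01).
  have hq : is_derive r 1 (fun x => x * (bracket 1 x)^-1) ((bracket 1 r)^-1 ^+ 3).
    apply: is_derive_ext (is_deriveM (is_derive_id r 1) hV) => //.
    rewrite /GRing.scale /= mulr1.
    have b2 : bracket 1 r ^+ 2 - r ^+ 2 = 1.
      by rewrite bracket_sqr// addrAC subrr add0r.
    apply: (mulIf (x := bracket 1 r ^+ 3)); first by rewrite expf_eq0.
    rewrite -[RHS]exprMn mulVf// expr1n -[RHS]b2.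
    by field.
  have hX := is_deriveX n.+2 hq.
  apply: is_derive_ext (is_deriveZ (ball_vol R n) hX) => [y|].
    by rewrite fctE.
  rewrite /GRing.scale /= exprMn; congr (_ * _).
  by rewrite -!mulrA -exprD addn3.
have cG : continuous G.
  by move=> r; apply: differentiable_continuous; apply/derivable1_diffP; case: (dG r).
rewrite (@ge0_continuous_FTC2y _ _ G _ (ball_vol R n))//.
- by rewrite /G mul0r expr0n mulr0 sube0.
- move=> r r0; apply: mulr_ge0; first exact: phi0.
  by rewrite mulr_ge0 ?exprn_ge0 ?ball_vol_ge0.
- apply: continuous_subspaceT => r; apply: cvgM; first exact: cphi.
  by apply: cvgM; [exact: exprn_continuous|exact: cvg_cst].
- have h1 : (r * (bracket 1 r)^-1) ^+ n.+2 @[r --> +oo] --> (1 : R).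
    have := cvg_comp _ _ (cvg_div_bracket (@ltr01 R)) (@exprn_continuous _ n.+2 1).
    by rewrite expr1n.
  rewrite -[X in _ --> X]mulr1 /G.
  by apply: cvgM; [exact: cvg_cst|exact: h1].
- by apply: cvg_at_right_filter; exact: cG.
- move=> r; rewrite in_itv /= andbT => r0.
  rewrite derive1E (@derive_val _ _ _ _ _ _ _ (dG r)) /phi gtr0_norm//.
  by rewrite (exprS r n); ring.
Qed.
End PoissonKernel.

(** * Integration by parts *)

Section Lines.
Variable R : realType.
Local Notation T := (measurableTypeR R).

(** A directional derivative is a derivative of the restriction to a line;
    this transports one-variable calculus to several variables. *)
Lemma is_derive_line (V : normedModType R) (f : V -> R) (g : R -> R) x v s d :
  (forall h, g (h + s) = f (h *: v + x)) ->
  is_derive x v f d <-> is_derive s 1 g d.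
Proof.
move=> gf.
have g0 : g s = f x by rewrite -[s]add0r gf scale0r add0r.
have E : (fun h : R => h^-1 *: ((f \o shift x) (h *: v) - f x)) =
         (fun h : R => h^-1 *: ((g \o shift s) (h *: 1) - g s)).
  by apply/funext => h /=; rewrite g0 [h *: 1]mulr1 gf.
by split => -[ed dv]; apply: DeriveDef;
  rewrite ?/derivable ?/derive ?E -?E//; move: ed dv; rewrite /derivable /derive ?E -?E.
Qed.

Lemma integral_derive_eq0 (g dg : R -> R) (M : R) :
  (forall s : R, is_derive s 1 g (dg s)) -> continuous dg ->
  (forall s, M < `|s| -> g s = 0) -> (forall s, M < `|s| -> dg s = 0) ->
  (\int[lebesgue_measure]_s (dg s)%:E = 0)%E.
Proof.
move=> dgP cdg g0 dg0.
pose N : R := `|M| + 1.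
have N0 : 0 < N by rewrite ltr_wpDl.
have MN (s : R) : N <= `|s| -> M < `|s|.
  by apply: lt_le_trans; rewrite (le_lt_trans (ler_norm M))// ltrDl.
have cg : continuous g.
  by move=> s; apply: differentiable_continuous; apply/derivable1_diffP; case: (dgP s).
transitivity (\int[lebesgue_measure]_(s in `[(- N)%R, N]) (dg s)%:E)%E.
  rewrite [RHS]integral_mkcond; apply: eq_integral => s _; rewrite patchE.
  case: ifPn => //; rewrite mem_setE in_itv /= -ler_norml -ltNge => /ltW Ns.
  by rewrite dg0// MN.
rewrite (@continuous_FTC2 _ dg g).
- have NN : N <= `|N| by exact: ler_norm.
  by rewrite !g0 ?subee//; apply: MN; rewrite ?normrN.
- by rewrite -subr_gt0 opprK addr_gt0.
- exact: continuous_subspaceT.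
- split.
  + by move=> s _; case: (dgP s).
  + by apply: cvg_at_right_filter; exact: cg.
  + by apply: cvg_at_left_filter; exact: cg.
- by move=> s _; rewrite derive1E; case: (dgP s).
Qed.

Definition row_cons n (x : R) (y : 'rV[R]_n) : 'rV[R]_n.+1 :=
  \row_i (if unlift ord0 i is Some j then y 0 j else x).

Lemma row_cons0 n x (y : 'rV[R]_n) : row_cons x y 0 ord0 = x.
Proof. by rewrite mxE unlift_none. Qed.

Lemma row_consS n x (y : 'rV[R]_n) j : row_cons x y 0 (lift ord0 j) = y 0 j.
Proof. by rewrite mxE liftK. Qed.

Lemma rv_tcons n (x : R) (t : n.-tuple R) : rv (tcons (x, t)) = row_cons x (rv t).
Proof.
apply/rowP => i; case: (unliftP ord0 i) => [j|] ->.
  by rewrite row_consS !mxE (tnth_nth x) /= -tnth_nth.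
by rewrite row_cons0 !mxE (tnth_nth x).
Qed.

Lemma row_cons_addr n (h x : R) (y v : 'rV[R]_n) :
  row_cons x (h *: v + y) = h *: row_cons 0 v + row_cons x y.
Proof.
apply/rowP => i; case: (unliftP ord0 i) => [j|] ->; rewrite !mxE.
  by rewrite !liftK !mxE.
by rewrite !unlift_none mulr0 add0r.
Qed.

Lemma row_cons_addl n (h x : R) (y : 'rV[R]_n) :
  row_cons (h + x) y = h *: delta_mx 0 ord0 + row_cons x y.
Proof.
apply/rowP => i; case: (unliftP ord0 i) => [j|] ->; rewrite !mxE.
  by rewrite !liftK eqxx /= mulr0 add0r.
by rewrite !unlift_none !eqxx mulr1.
Qed.

Lemma row_cons_delta n (j : 'I_n) :
  row_cons 0 (delta_mx 0 j) = delta_mx 0 (lift ord0 j) :> 'rV[R]_n.+1.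
Proof.
apply/rowP => i; case: (unliftP ord0 i) => [k|] ->; rewrite !mxE.
  by rewrite liftK !mxE (inj_eq lift_inj).
by rewrite unlift_none.
Qed.

Lemma continuous_row_cons n x : continuous (@row_cons n x).
Proof.
move=> y A /nbhs_ballP[e /= e0 HA]; apply/nbhs_ballP; exists e => //= z [_ yz].
apply: HA; split => // i j; rewrite ord1; case: (unliftP ord0 j) => [k|] ->.
  by rewrite !row_consS; exact: yz.
by rewrite !row_cons0; exact: ballxx.
Qed.

Lemma continuous_row_consl n (y : 'rV[R]_n) : continuous (fun x => row_cons x y).
Proof.
move=> x A /nbhs_ballP[e /= e0 HA]; apply/nbhs_ballP; exists e => //= z xz.
apply: HA; split => // i j; rewrite ord1; case: (unliftP ord0 j) => [k|] ->.
  by rewrite !row_consS; exact: ballxx.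
by rewrite !row_cons0.
Qed.

Lemma row_cons_box n M x (y : 'rV[R]_n) :
  box M (row_cons x y) <-> `|x| <= M /\ box M y.
Proof.
split=> [h|[h1 h2] i].
  by split=> [|j]; [have := h ord0|have := h (lift ord0 j)];
    rewrite ?row_cons0 ?row_consS.
by case: (unliftP ord0 i) => [k|] ->; rewrite ?row_cons0 ?row_consS.
Qed.

(** Fubini puts the integration over the [i]-th coordinate innermost, where
    the fundamental theorem of calculus gives zero. The induction peels off
    coordinates until that coordinate is the first. *)
Lemma integral_partial_eq0 n (i : 'I_n) (f df : 'rV[R]_n -> R) (M : R) :
  (forall x, is_derive x (delta_mx 0 i) f (df x)) -> continuous df ->
  (forall x, ~ box M x -> f x = 0) -> (forall x, ~ box M x -> df x = 0) ->
  (\int[lebesgue_tuple R n]_t (df (rv t))%:E = 0)%E.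
Proof.
elim: n i f df => [[]//|n IH] i f df dfP cdf f0 df0.
have idf : (lebesgue_tuple R n.+1).-integrable setT (EFin \o (df \o @rv R n.+1)).
  exact: continuous_box_integrable cdf df0.
have [E1 E2] := integral_tuple_cons idf.
case: (unliftP ord0 i) dfP => [j|] -> dfP.
  apply: (eq_trans E1); rewrite /= integral0_eq// => x _.
  under eq_integral => t _ do rewrite rv_tcons.
  apply: (IH j (f \o row_cons x) (df \o row_cons x)).
  - move=> y /=; apply/(@is_derive_line _ _ (fun h => f (row_cons x (h *: delta_mx 0 j + y))) _ _ 0).
      by move=> h /=; rewrite addr0.
    apply/(@is_derive_line _ f _ (row_cons x y) (delta_mx 0 (lift ord0 j))) => //.
    by move=> h; rewrite addr0 row_cons_addr row_cons_delta.
  - by move=> y; apply: continuous_comp; [exact: continuous_row_cons|exact: cdf].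
  - by move=> y yM; apply: f0 => /row_cons_box[].
  - by move=> y yM; apply: df0 => /row_cons_box[].
apply: (eq_trans E2); rewrite /= integral0_eq// => t _.
under eq_integral => x _ do rewrite rv_tcons.
apply: (@integral_derive_eq0 (fun x => f (row_cons x (rv t))) (fun x => df (row_cons x (rv t))) M).
- move=> x; apply/(@is_derive_line _ f _ (row_cons x (rv t)) (delta_mx 0 ord0)) => //.
  by move=> h; rewrite row_cons_addl.
- by move=> x; apply: continuous_comp; [exact: continuous_row_consl|exact: cdf].
- by move=> x xM; apply: f0 => /row_cons_box[]; rewrite leNgt xM.
- by move=> x xM; apply: df0 => /row_cons_box[]; rewrite leNgt xM.
Qed.

End Lines.

Section ByParts.
Variable R : realType.
Local Notation T := (measurableTypeR R).

Lemma is_derive_near0 (V : normedModType R) (f : V -> R) x v d :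
  is_derive x v f d -> (\forall y \near x, f y = 0) -> d = 0.
Proof.
move=> [fd <-] f0; rewrite /derive; apply: cvg_lim => //.
have f0x : f x = 0 by exact: nbhs_singleton f0.
have hx : (h *: v + x) @[h --> (0 : R)] --> x.
  rewrite -[X in _ --> X]add0r -[X in _ --> X + _](scale0r v).
  by apply: cvgD; [apply: cvgZr_tmp; exact: cvg_id|exact: cvg_cst].
apply: (@cvg_trans _ (cst 0 @ (0 : R)^')); last exact: cvg_cst.
apply: near_eq_cvg; near=> h.
rewrite /= f0x subr0 (_ : f _ = 0) ?scaler0//.
near: h; apply: nbhs_dnbhs; exact: (hx _ f0).
Unshelve. all: by end_near. Qed.

Variable n : nat.
Local Notation leb := (lebesgue_tuple R n).
Implicit Types (f g : 'rV[R]_n -> R).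

Lemma box_closed M : closed (@box R n M).
Proof. by apply: compact_closed; [exact: norm_hausdorff|exact: compact_box]. Qed.

(** The complement of a box is open, so a derivative there is computed where
    the function vanishes identically. *)
Lemma is_derive_outside_box f M x v d :
  is_derive x v f d -> (forall y, ~ box M y -> f y = 0) -> ~ box M x -> d = 0.
Proof.
move=> fd f0 xM; apply: (is_derive_near0 fd).
have : nbhs x (~` box M).
  by apply: open_nbhs_nbhs; split => //; rewrite openC; exact: box_closed.
by apply: filterS => y; exact: f0.
Qed.

(** The difference of the integrands is the partial derivative of [F f1 - F1
    f], which vanishes outside the box. *)
Lemma integral_by_parts2 (i : 'I_n) (F F1 F2 f f1 f2 : 'rV[R]_n -> R) (M : R) :
  (forall x, is_derive x (delta_mx 0 i) F (F1 x)) ->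
  (forall x, is_derive x (delta_mx 0 i) F1 (F2 x)) ->
  (forall x, is_derive x (delta_mx 0 i) f (f1 x)) ->
  (forall x, is_derive x (delta_mx 0 i) f1 (f2 x)) ->
  continuous F -> continuous F2 -> continuous f -> continuous f2 ->
  (forall x, ~ box M x -> f x = 0) ->
  (\int[leb]_t (F (rv t) * f2 (rv t))%:E = \int[leb]_t (F2 (rv t) * f (rv t))%:E)%E.
Proof.
move=> dF dF1 df df1 cF cF2 cf cf2 f0.
have f10 x : ~ box M x -> f1 x = 0 by exact: is_derive_outside_box.
have f20 x : ~ box M x -> f2 x = 0 by exact: is_derive_outside_box.
have c1 : continuous (fun x : 'rV[R]_n => F x * f2 x) by move=> x; exact: cvgM (cF x) (cf2 x).
have c2 : continuous (fun x : 'rV[R]_n => F2 x * f x) by move=> x; exact: cvgM (cF2 x) (cf x).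
have i1 : leb.-integrable setT (fun t => (F (rv t) * f2 (rv t))%:E).
  by apply: (continuous_box_integrable c1) => x /f20 ->; rewrite mulr0.
have i2 : leb.-integrable setT (fun t => (F2 (rv t) * f (rv t))%:E).
  by apply: (continuous_box_integrable c2) => x /f0 ->; rewrite mulr0.
have : (\int[leb]_t (F (rv t) * f2 (rv t) - F2 (rv t) * f (rv t))%:E = 0)%E.
  apply: (@integral_partial_eq0 R n i (fun x => F x * f1 x - F1 x * f x)
    (fun x => F x * f2 x - F2 x * f x) M).
  - move=> x.
    apply: is_derive_ext (is_deriveB (is_deriveM (dF x) (df1 x)) (is_deriveM (dF1 x) (df x))) => //.
    by rewrite /GRing.scale /=; ring.
  - by move=> x; exact: cvgB (c1 x) (c2 x).
  - by move=> x xM; rewrite f0// f10// !mulr0 subr0.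
  - by move=> x xM; rewrite f0// f20// !mulr0 subr0.
under eq_integral do rewrite EFinB.
rewrite integralB// => /eqP; rewrite sube_eq; last 2 first.
- exact: integrable_fin_num.
- by rewrite fin_num_adde_defl// integrable_fin_num.
by rewrite add0e => /eqP.
Qed.

End ByParts.

(** * Derivatives of smoothed radial functions *)

Section RadialDerivatives.
Variables (R : realType) (n : nat).
Local Notation T := (measurableTypeR R).
Local Notation leb := (lebesgue_tuple R n).
Implicit Types (x : 'rV[R]_n) (i : 'I_n).

(** Along a line the chain rule is the one-variable one. *)
Lemma is_derive_comp1 (V : normedModType R) (f : V -> R) (K : R -> R) (x v : V) (d k : R) :
  is_derive (f x) 1 K k -> is_derive x v f d ->
  is_derive x v (fun y => K (f y)) (k * d).
Proof.
move=> dK df; pose g h := f (h *: v + x).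
have gE : g 0 = f x by rewrite /g scale0r add0r.
have dg : is_derive (0 : R) 1 g d.
  by apply/(@is_derive_line _ _ f g x v 0) => // h; rewrite addr0.
apply/(@is_derive_line _ _ (fun y => K (f y)) (K \o g) x v 0).
  by move=> h /=; rewrite addr0.
by apply: is_derive1_comp => //; rewrite gE.
Qed.

Lemma sqnorm_line x i (h : R) :
  sqnorm (h *: delta_mx 0 i + x) = sqnorm x + (h * x 0 i) *+ 2 + h ^+ 2.
Proof.
rewrite /sqnorm (bigD1 i)//= [X in _ = X + _ + _](bigD1 i)//= !mxE !eqxx mulr1.
rewrite (eq_bigr (fun j => x 0 j ^+ 2)).
  by rewrite sqrrD; ring.
by move=> j ji; rewrite !mxE (negbTE ji) andbF mulr0 add0r.
Qed.

Lemma is_derive_coord x i : is_derive x (delta_mx 0 i) (fun y : 'rV[R]_n => y 0 i) (1 : R).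
Proof.
apply/(@is_derive_line _ _ (fun y : 'rV[R]_n => y 0 i) (fun h : R => h + x 0 i) x _ 0).
  by move=> h; rewrite !mxE !eqxx mulr1 addr0.
apply: is_derive_ext (is_deriveD (is_derive_id (0 : R) 1) (is_derive_cst (x 0 i) (0 : R) 1)) => //.
by rewrite addr0.
Qed.

Definition qnorm (e : R) x : R := bracket e (enorm x).

Lemma qnormE e x : qnorm e x = Num.sqrt (sqnorm x + e).
Proof. by rewrite /qnorm /bracket enorm_sqr. Qed.

Lemma qnorm_gt0 e x : 0 < e -> 0 < qnorm e x.
Proof. exact: bracket_gt0. Qed.

Lemma qnorm_sqr e x : 0 <= e -> qnorm e x ^+ 2 = sqnorm x + e.
Proof. by move=> e0; rewrite /qnorm bracket_sqr// enorm_sqr. Qed.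

Lemma continuous_qnorm e : continuous (qnorm e).
Proof.
move=> x; apply: continuous_comp; first exact: continuous_enorm.
exact: continuous_bracket.
Qed.

Lemma is_derive_qnorm e x i : 0 < e ->
  is_derive x (delta_mx 0 i) (qnorm e) (x 0 i / qnorm e x).
Proof.
move=> e0.
have p0 : 0 < sqnorm x + e by rewrite ltr_wpDl// sqnorm_ge0.
have ds : is_derive x (delta_mx 0 i) (fun y => sqnorm y + e) (x 0 i *+ 2).
  pose g (h : R) := h ^+ 2 + (x 0 i *+ 2) * h + (sqnorm x + e).
  apply/(@is_derive_line _ _ (fun y => sqnorm y + e) g x _ 0).
    by move=> h; rewrite sqnorm_line addr0 /g; ring.
  apply: is_derive_ext (is_deriveD (is_deriveD (is_deriveX 2 (is_derive_id (0 : R) 1))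
    (is_deriveZ (x 0 i *+ 2) (is_derive_id (0 : R) 1))) (is_derive_cst (sqnorm x + e) (0 : R) 1)) => //.
  by rewrite /GRing.scale /=; ring.
have := @is_derive_comp1 _ (fun y : 'rV[R]_n => sqnorm y + e) _ _ _ _ _
  (is_derive1_sqrt p0) ds.
apply: is_derive_ext => [y|]; first by rewrite qnormE.
rewrite -qnormE -mulr_natl; field.
by rewrite gt_eqF ?qnorm_gt0.
Qed.

Variables (K K1 g : R -> R).
Hypothesis dK : forall r : R, 0 < r -> is_derive r 1 K (K1 r).
Hypothesis dK1 : forall r : R, 0 < r ->
  is_derive r 1 K1 (g r - n.-1%:R * K1 r / r).
Hypothesis cg : {in `]0, +oo[, continuous g}.

Let cK : {in `]0, +oo[, continuous K}.
Proof.
move=> r; rewrite in_itv /= andbT => r0.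
by apply: differentiable_continuous; apply/derivable1_diffP; case: (dK r0).
Qed.

Let cK1 : {in `]0, +oo[, continuous K1}.
Proof.
move=> r; rewrite in_itv /= andbT => r0.
by apply: differentiable_continuous; apply/derivable1_diffP; case: (dK1 r0).
Qed.

Definition radial_partial e i x : R := K1 (qnorm e x) * (x 0 i / qnorm e x).

(** The second derivative of [K (qnorm e x)] in the direction [i], in which
    [K''] has been expressed by [g] and [K'] through the radial equation. *)
Definition radial_partial2 e i x : R :=
  (g (qnorm e x) - n.-1%:R * K1 (qnorm e x) / qnorm e x) * (x 0 i / qnorm e x) ^+ 2
  + K1 (qnorm e x) * ((qnorm e x)^-1 - x 0 i ^+ 2 * (qnorm e x)^-1 ^+ 3).

Lemma is_derive_radial e i x : 0 < e ->
  is_derive x (delta_mx 0 i) (fun y => K (qnorm e y)) (radial_partial e i x).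
Proof.
by move=> e0; apply: is_derive_comp1 (is_derive_qnorm x i e0); exact/dK/qnorm_gt0.
Qed.

Lemma is_derive_radial_partial e i x : 0 < e ->
  is_derive x (delta_mx 0 i) (radial_partial e i) (radial_partial2 e i x).
Proof.
move=> e0; have q0 := qnorm_gt0 x e0.
have dq := is_derive_qnorm x i e0.
have h1 := is_derive_comp1 (dK1 q0) dq.
have qN0 : qnorm e x != 0 by rewrite gt_eqF.
have dV : is_derive (qnorm e x) 1 (fun r : R => r^-1) (- (qnorm e x)^-1 ^+ 2).
  have := @is_deriveV R id _ _ _ qN0 (is_derive_id (qnorm e x) 1).
  apply: is_derive_ext => //.
  by rewrite /GRing.scale /= mulr1 exprVn.
have h2 : is_derive x (delta_mx 0 i) (fun y : 'rV[R]_n => y 0 i / qnorm e y)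
    ((qnorm e x)^-1 - x 0 i ^+ 2 * (qnorm e x)^-1 ^+ 3).
  apply: is_derive_ext (is_deriveM (is_derive_coord x i) (is_derive_comp1 dV dq)) => //.
  by rewrite /GRing.scale /= mulr1; field.
apply: is_derive_ext (is_deriveM h1 h2) => //.
rewrite /GRing.scale /= /radial_partial2 addrC; congr (_ + _).
have rE (a b : R) : b * (a * b) = a * b ^+ 2 by ring.
exact: rE.
Qed.

(** Since [qnorm e x ^+ 2 = |x|^2 + e], the terms in [K1] do not cancel
    completely as they would for the true radius: what is left is proportional
    to [e] and concentrates at the origin. *)
Lemma sum_radial_partial2 e x : 0 < e -> (0 < n)%N ->
  \sum_i radial_partial2 e i x =
  g (qnorm e x) * (sqnorm x * (qnorm e x)^-1 ^+ 2)
  + n%:R * e * K1 (qnorm e x) * (qnorm e x)^-1 ^+ 3.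
Proof.
move=> e0 n0; set q := qnorm e x.
have q0 : q != 0 by rewrite gt_eqF ?qnorm_gt0.
have q2 : sqnorm x = q ^+ 2 - e by rewrite qnorm_sqr ?ltW// addrK.
pose A := g q - n.-1%:R * K1 q / q.
transitivity (\sum_i ((A * q^-1 ^+ 2 - K1 q * q^-1 ^+ 3) * x 0 i ^+ 2 + K1 q * q^-1)).
  by apply: eq_bigr => i _; rewrite /radial_partial2 -/q -/A; ring.
rewrite big_split /= -mulr_sumr -/(sqnorm x) sumr_const card_ord.
rewrite -[X in _ + X = _]mulr_natr /A.
have nE : n%:R = n.-1%:R + 1 :> R by rewrite natr1 prednK.
by rewrite q2 nE; field.
Qed.

Lemma continuous_qnorm_comp (e : R) (H : R -> R) : 0 < e ->
  {in `]0, +oo[, continuous H} -> continuous (fun x => H (qnorm e x)).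
Proof.
move=> e0 cH x; apply: continuous_comp; first exact: continuous_qnorm.
by apply: cH; rewrite in_itv /= andbT qnorm_gt0.
Qed.

Lemma continuous_radial e : 0 < e -> continuous (fun x => K (qnorm e x)).
Proof. by move=> e0; exact: continuous_qnorm_comp. Qed.

Lemma continuous_radial_partial2 e i : 0 < e -> continuous (radial_partial2 e i).
Proof.
move=> e0 x.
have cH (H : R -> R) : {in `]0, +oo[, continuous H} ->
    {for x, continuous (fun y : 'rV[R]_n => H (qnorm e y))}.
  by move=> cH; apply: continuous_qnorm_comp.
have h1 := cH _ cg.
have h2 := cH _ cK1.
have h3 k := cH _ (@continuous_invX R k).
have hx : {for x, continuous (fun y : 'rV[R]_n => y 0 i)} by exact: coord_continuous.
have E : radial_partial2 e i = fun y =>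
  (g (qnorm e y) - n.-1%:R * K1 (qnorm e y) * (qnorm e y)^-1 ^+ 1) *
    ((y 0 i * y 0 i) * (qnorm e y)^-1 ^+ 2)
  + K1 (qnorm e y) * ((qnorm e y)^-1 ^+ 1 - (y 0 i * y 0 i) * (qnorm e y)^-1 ^+ 3).
  by apply/funext => y; rewrite /radial_partial2; ring.
rewrite E.
have cM (u v : 'rV[R]_n -> R) : {for x, continuous u} -> {for x, continuous v} ->
  {for x, continuous (fun y => u y * v y)} by move=> cu cv; exact: cvgM cu cv.
have cB (u v : 'rV[R]_n -> R) : {for x, continuous u} -> {for x, continuous v} ->
  {for x, continuous (fun y => u y - v y)} by move=> cu cv; exact: cvgB cu cv.
have cD (u v : 'rV[R]_n -> R) : {for x, continuous u} -> {for x, continuous v} ->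
  {for x, continuous (fun y => u y + v y)} by move=> cu cv; exact: cvgD cu cv.
have hxx := cM _ _ hx hx.
have hn : {for x, continuous (fun _ : 'rV[R]_n => n.-1%:R : R)}.
  exact: (@cst_continuous 'rV[R]_n R n.-1%:R x).
have ha := cM _ _ (cB _ _ h1 (cM _ _ (cM _ _ hn h2) (h3 1%N))) (cM _ _ hxx (h3 2%N)).
exact: cD _ _ ha (cM _ _ h2 (cB _ _ (h3 1%N) (cM _ _ hxx (h3 3%N)))).
Qed.
End RadialDerivatives.

(** * The distributional Laplacian of a radial function *)

Section IntegralTools.
Variables (R : realType) (n : nat).
Local Notation T := (measurableTypeR R).
Local Notation leb := (lebesgue_tuple R n).
Hypothesis n0 : (0 < n)%N.

Lemma ae_away_origin (P : n.-tuple T -> Prop) :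
  (forall t, rv t != 0 -> P t) -> {ae leb, forall t, P t}.
Proof.
move=> h; exists (@rv R n @^-1` [set 0]); split.
- exact: measurable_origin.
- exact: leb_origin.
- by move=> t /= nP; apply: contrapT => /eqP t0; apply: nP; exact: h.
Qed.

(** The origin is negligible, so pointwise convergence and domination may fail
    there; this is where the kernels are singular. *)
Lemma Rintegral_dominated (f_ : nat -> n.-tuple T -> R) (f h : n.-tuple T -> R) :
  (forall k, measurable_fun setT (f_ k)) -> measurable_fun setT f ->
  leb.-integrable setT (EFin \o h) ->
  (forall t, rv t != 0 -> f_ ^~ t @ \oo --> f t) ->
  (forall k t, rv t != 0 -> `|f_ k t| <= h t) ->
  leb.-integrable setT (EFin \o f) /\
  \int[leb]_t f_ k t @[k --> \oo] --> \int[leb]_t f t.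
Proof.
move=> mf_ mf ih ff fh.
have [] := @dominated_convergence _ _ _ leb setT measurableT
  (fun k => EFin \o f_ k) (EFin \o f) (EFin \o h).
- by move=> k; exact/measurable_EFinP.
- exact/measurable_EFinP.
- apply: ae_away_origin => t t0 _.
  by apply: cvg_EFin; [exact: nearW|exact: ff].
- exact: ih.
- by apply: ae_away_origin => t t0 k _; rewrite /= lee_fin fh.
move=> intf _ cv; split => //.
by apply: fine_cvg; rewrite fineK//; exact: integrable_fin_num.
Qed.

Lemma Rintegral_sum (I : finType) (F : I -> n.-tuple T -> R) :
  (forall i, leb.-integrable setT (EFin \o F i)) ->
  \int[leb]_t (\sum_i F i t) = \sum_i \int[leb]_t F i t.
Proof.
move=> iF; apply: EFin_inj; rewrite -sumEFin fineK.
  under eq_integral do rewrite -sumEFin.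
  rewrite (integral_sum measurableT iF); apply: eq_bigr => i _.
  by rewrite /Rintegral fineK//; exact: (integrable_fin_num _ (iF i)).
apply: integrable_fin_num => //.
have := integrable_sum measurableT (index_enum I) (P := xpredT) (fun i _ => iF i).
by congr (leb.-integrable); apply/funext => t; rewrite /= sumEFin.
Qed.

Lemma Rintegral_tscale (a : R) (f : n.-tuple T -> R) : 0 < a ->
  leb.-integrable setT (EFin \o f) ->
  \int[leb]_t f (tscale a t) = a^-1 ^+ n * \int[leb]_t f t.
Proof.
move=> a0 intf; have mf : measurable_fun setT (EFin \o f) by case/integrableP : intf.
have E : (\int[leb]_t (f (tscale a t))%:E = (a^-1 ^+ n)%:E * \int[leb]_t (f t)%:E)%E.
  rewrite integralE [in RHS]integralE muleBr//; last first.
    by apply: fin_num_adde_defl; rewrite fin_numN; exact: integrable_neg_fin_num.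
  rewrite -!(ge0_integral_tscale a0)//; first last.
  - exact: measurable_funepos.
  - exact: measurable_funeneg.
  by congr (_ - _)%E; apply: eq_integral => t _; rewrite ?funeposE ?funenegE.
by rewrite /Rintegral E fineM// integrable_fin_num.
Qed.
End IntegralTools.

Section Regularization.
Variables (R : realType) (n : nat).
Local Notation T := (measurableTypeR R).
Local Notation leb := (lebesgue_tuple R n).
Hypothesis n1 : (1 < n)%N.
Let n0 : (0 < n)%N := ltnW n1.

(** The smoothing scales; the smoothing parameter is their square, so that
    [step k] is a length. *)
Definition step (k : nat) : R := k.+1%:R^-1.

Lemma step_gt0 k : 0 < step k.
Proof. by rewrite invr_gt0 ltr0n. Qed.

Lemma step_le1 k : step k <= 1.
Proof. by rewrite invf_le1 ?ltr0n// ler1n. Qed.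

Lemma cvg_step : step k @[k --> \oo] --> (0 : R).
Proof. exact: cvg_harmonic. Qed.

Lemma step2_gt0 k : 0 < step k ^+ 2.
Proof. by rewrite exprn_gt0// step_gt0. Qed.

Lemma cvg_step2 : step k ^+ 2 @[k --> \oo] --> (0 : R).
Proof.
by have := cvg_comp _ _ cvg_step (@exprn_continuous R 2 0); rewrite expr0n.
Qed.

Lemma cvg_qnorm (x : 'rV[R]_n) : qnorm (step k ^+ 2) x @[k --> \oo] --> enorm x.
Proof.
have h : sqnorm x + step k ^+ 2 @[k --> \oo] --> sqnorm x.
  by rewrite -[X in _ --> X]addr0; apply: cvgD; [exact: cvg_cst|exact: cvg_step2].
have := cvg_comp _ _ h (@sqrt_continuous R (sqnorm x)).
rewrite /comp; under eq_fun do rewrite -qnormE.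
by [].
Qed.

Lemma ge_qnorm e (x : 'rV[R]_n) : 0 <= e -> enorm x <= qnorm e x.
Proof. by move=> e0; exact: ge_bracket (enorm_ge0 x). Qed.

(** Over a box of half-side [M] this bounds the Euclidean norm together with
    all the smoothed radii at scale at most [1]. *)
Definition radius_bound (M : R) : R := Num.sqrt ((M * n%:R) ^+ 2 + 1).

Lemma radius_bound_gt0 M : 0 < radius_bound M.
Proof. by rewrite sqrtr_gt0 ltr_wpDl// sqr_ge0. Qed.

Lemma qnorm_le_bound M k (x : 'rV[R]_n) : 0 <= M -> box M x ->
  qnorm (step k ^+ 2) x <= radius_bound M.
Proof.
move=> M0 xM; apply: ler_wsqrtr; apply: lerD.
  by apply: lerXn2r; rewrite ?nnegrE ?enorm_ge0 ?mulr_ge0 ?enorm_box.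
by rewrite exprn_ile1// ?step_le1// ltW// step_gt0.
Qed.

Lemma enorm_le_bound M (x : 'rV[R]_n) : 0 <= M -> box M x ->
  enorm x <= radius_bound M.
Proof.
move=> M0 xM; apply: le_trans (qnorm_le_bound 0 M0 xM).
exact/ge_qnorm/ltW/step2_gt0.
Qed.

(** The growth [r^(1-n)] is the one that stays integrable near the origin and
    that the derivative of the fundamental solution attains. *)
Definition radial_bounded (H : R -> R) := forall N : R, 0 < N ->
  exists2 C : R, 0 <= C & forall r, 0 < r <= N -> `|H r| <= C * r^-1 ^+ n.-1.

Lemma invX_ge0 (r : R) k : 0 <= r -> 0 <= r^-1 ^+ k.
Proof. by move=> r0; rewrite exprn_ge0// invr_ge0. Qed.

Lemma invX_le (r s : R) k : 0 < r -> r <= s -> s^-1 ^+ k <= r^-1 ^+ k.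
Proof.
move=> r0 rs; have s0 := lt_le_trans r0 rs.
have ir : s^-1 <= r^-1 by rewrite lef_pV2 ?posrE.
by apply: lerXn2r => //; rewrite nnegrE invr_ge0 ltW.
Qed.

(** The common majorant in all applications of dominated convergence. *)
Lemma majorant_integrable (C M : R) : 0 < M ->
  leb.-integrable setT (EFin \o (fun t =>
    C * ((fun t => (enorm (rv t))^-1 ^+ n.-1) \_ (@rv R n @^-1` box M)) t)).
Proof.
move=> M0; have mB : measurable (@rv R n @^-1` box M : set (n.-tuple T)) by exact: measurable_box.
have := enorm_exp_integrable n1 M0.
rewrite integrable_mkcond// => /(integrableZl measurableT C).
congr (leb.-integrable); apply/funext => t.
by rewrite /= EFinM; congr (_ * _)%E; rewrite !patchE; case: ifP.
Qed.

(** The weight [w k] accounts for the factor [|x|^2 / (|x|^2 + e)] that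
    smoothing introduces. As the smoothed radius exceeds the true one,
    [r^(1-n)] at the true radius dominates. *)
Lemma cvg_radial_integral (H : R -> R) (w : nat -> 'rV[R]_n -> R) (f : 'rV[R]_n -> R) (M : R) :
  {in `]0, +oo[, continuous H} -> radial_bounded H -> 0 < M ->
  (forall k, continuous (w k)) ->
  (forall k x, `|w k x| <= 1) ->
  (forall x, x != 0 -> w k x @[k --> \oo] --> (1 : R)) ->
  continuous f -> (forall x, ~ box M x -> f x = 0) ->
  leb.-integrable setT (fun t => (H (enorm (rv t)) * f (rv t))%:E) /\
  \int[leb]_t (H (qnorm (step k ^+ 2) (rv t)) * w k (rv t) * f (rv t)) @[k --> \oo]
    --> \int[leb]_t (H (enorm (rv t)) * f (rv t)).
Proof.
move=> cH bH M0 cw w1 ww cf f0.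
have [C C0 HC] := bH _ (radius_bound_gt0 M).
have [D D0 HD] := continuous_box_bounded M cf.
apply: (@Rintegral_dominated R n n0 _ _ (fun t =>
  (C * D) * ((fun t => (enorm (rv t))^-1 ^+ n.-1) \_ (@rv R n @^-1` box M)) t)).
- move=> k; apply: (@continuous_rv_measurable R n
    (fun x => H (qnorm (step k ^+ 2) x) * w k x * f x)) => x.
  have h1 : {for x, continuous (fun y : 'rV[R]_n => H (qnorm (step k ^+ 2) y))}.
    by apply: continuous_qnorm_comp => //; exact: step2_gt0.
  exact: cvgM (cvgM h1 (cw k x)) (cf x).
- apply: measurable_funM; first exact: measurable_radial.
  exact: continuous_rv_measurable.
- exact: majorant_integrable.
- move=> t t0; rewrite -[H (enorm _)]mulr1.
  apply: cvgM; last exact: cvg_cst.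
  apply: cvgM; last exact: ww.
  have hH : {for enorm (rv t), continuous H}.
    by apply: cH; rewrite in_itv /= andbT enorm_gt0.
  have hq : qnorm (step k ^+ 2) (rv t) @[k --> \oo] --> enorm (rv t).
    exact: cvg_qnorm.
  exact: (cvg_comp _ _ hq hH).
- move=> k t t0; rewrite patchE; case: ifPn => [|/negP tM]; last first.
    rewrite f0 ?mulr0 ?normr0// => tM'; apply: tM.
    by rewrite inE.
  rewrite inE /= => tM; rewrite !normrM mulrAC.
  have q0 : 0 < qnorm (step k ^+ 2) (rv t) by apply: qnorm_gt0; exact: step2_gt0.
  have x0 : 0 < enorm (rv t) by rewrite enorm_gt0.
  have xq : enorm (rv t) <= qnorm (step k ^+ 2) (rv t) by exact/ge_qnorm/ltW/step2_gt0.
  have HH : `|H (qnorm (step k ^+ 2) (rv t))| <= C * (enorm (rv t))^-1 ^+ n.-1.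
    apply: le_trans (HC _ _) _; first by rewrite q0 qnorm_le_bound// ltW.
    by rewrite ler_wpM2l// invX_le.
  apply: (@le_trans _ _ (C * (enorm (rv t))^-1 ^+ n.-1 * D * 1)).
    apply: ler_pM; [exact: mulr_ge0|exact: normr_ge0| |exact: w1].
    by apply: ler_pM; [exact: normr_ge0|exact: normr_ge0|exact: HH|exact: HD].
  by rewrite mulr1 mulrAC.
Qed.

Variables (K K1 g : R -> R) (l : R).
Hypothesis dK : forall r : R, 0 < r -> is_derive r 1 K (K1 r).
Hypothesis dK1 : forall r : R, 0 < r ->
  is_derive r 1 K1 (g r - n.-1%:R * K1 r / r).
Hypothesis cg : {in `]0, +oo[, continuous g}.
Hypothesis bK : radial_bounded K.
Hypothesis bg : radial_bounded g.
Hypothesis bK1 : radial_bounded K1.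
Hypothesis lK1 : r ^+ n.-1 * K1 r @[r --> 0^'+] --> l.

Let cK : {in `]0, +oo[, continuous K}.
Proof.
move=> r; rewrite in_itv /= andbT => r0.
by apply: differentiable_continuous; apply/derivable1_diffP; case: (dK r0).
Qed.

Let cK1 : {in `]0, +oo[, continuous K1}.
Proof.
move=> r; rewrite in_itv /= andbT => r0.
by apply: differentiable_continuous; apply/derivable1_diffP; case: (dK1 r0).
Qed.

Variables (f : 'rV[R]_n -> R) (f1 f2 : 'I_n -> 'rV[R]_n -> R) (M : R).
Hypothesis M0 : 0 < M.
Hypothesis df : forall i x, is_derive x (delta_mx 0 i) f (f1 i x).
Hypothesis df1 : forall i x, is_derive x (delta_mx 0 i) (f1 i) (f2 i x).
Hypothesis cf : continuous f.
Hypothesis cf2 : forall i, continuous (f2 i).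
Hypothesis f0 : forall x, ~ box M x -> f x = 0.

Let f20 i x : ~ box M x -> f2 i x = 0.
Proof.
move=> xM; apply: (is_derive_outside_box (df1 i x)) xM => y.
exact: is_derive_outside_box (df i y) f0.
Qed.

(** The part of the Laplacian of [K (qnorm e x)] that becomes the point mass
    at the origin. *)
Definition bump e (x : 'rV[R]_n) : R := n%:R * e * K1 (qnorm e x) * (qnorm e x)^-1 ^+ 3.

Let weight e (x : 'rV[R]_n) : R := sqnorm x * (qnorm e x)^-1 ^+ 2.

Let continuous_mul (u v : 'rV[R]_n -> R) : continuous u -> continuous v ->
  continuous (fun x => u x * v x).
Proof. by move=> cu cv x; exact: cvgM (cu x) (cv x). Qed.

Let continuous_weight e : 0 < e -> continuous (weight e).
Proof.
move=> e0; apply: continuous_mul; first exact: continuous_sqnorm.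
by apply: (continuous_qnorm_comp (H := fun r => r^-1 ^+ 2)) => //; exact: continuous_invX.
Qed.

Let continuous_bump e : 0 < e -> continuous (bump e).
Proof.
move=> e0; apply: continuous_mul.
  apply: continuous_mul; first exact: cst_continuous.
  exact: continuous_qnorm_comp.
by apply: (continuous_qnorm_comp (H := fun r => r^-1 ^+ 3)) => //; exact: continuous_invX.
Qed.

Lemma regularized_identity e : 0 < e ->
  \sum_i \int[leb]_t (K (qnorm e (rv t)) * f2 i (rv t)) =
  \int[leb]_t (g (qnorm e (rv t)) * weight e (rv t) * f (rv t)) +
  \int[leb]_t (bump e (rv t) * f (rv t)).
Proof.
move=> e0.
transitivity (\sum_i \int[leb]_t (radial_partial2 K1 g e i (rv t) * f (rv t))).
  apply: eq_bigr => i _; congr fine.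
  apply: (@integral_by_parts2 R n i (fun x => K (qnorm e x)) (radial_partial K1 e i)
    (radial_partial2 K1 g e i) f (f1 i) (f2 i) M) => //.
  - by move=> x; exact: is_derive_radial.
  - by move=> x; exact: is_derive_radial_partial.
  - exact: continuous_radial.
  - exact: continuous_radial_partial2.
have iF (H : 'rV[R]_n -> R) : continuous H ->
    leb.-integrable setT (EFin \o (fun t => H (rv t) * f (rv t))).
  move=> cH; apply: (continuous_box_integrable (f := fun x => H x * f x)).
    exact: continuous_mul.
  by move=> x /f0 ->; rewrite mulr0.
rewrite -Rintegral_sum//; last by move=> i; apply: iF; exact: continuous_radial_partial2.
rewrite -RintegralD//; last 2 first.
- apply: (iF (fun x => g (qnorm e x) * weight e x)).
  by apply: continuous_mul; [exact: continuous_qnorm_comp|exact: continuous_weight].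
- by apply: iF; exact: continuous_bump.
apply: eq_Rintegral => t _; rewrite -mulr_suml sum_radial_partial2//.
by rewrite -mulrDl.
Qed.

Let bump_scale k (t : n.-tuple T) :
  bump (step k ^+ 2) (rv (tscale (step k) t)) =
  (step k)^-1 ^+ n * (n%:R * ((step k * bracket 1 (enorm (rv t))) ^+ n.-1 *
    K1 (step k * bracket 1 (enorm (rv t)))) * (bracket 1 (enorm (rv t)))^-1 ^+ n.+2).
Proof.
move: (step k) (step_gt0 k) => s s0.
have qE : qnorm (s ^+ 2) (rv (tscale s t)) = s * bracket 1 (enorm (rv t)).
  rewrite rv_tscale /qnorm enormZ gtr0_norm// /bracket exprMn.
  rewrite -[X in _ + X]mulr1 -mulrDr sqrtrM ?sqr_ge0// sqrtr_sqr gtr0_norm//.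
rewrite /bump qE.
move: (bracket 1 (enorm (rv t))) (bracket_gt0 (enorm (rv t)) (@ltr01 R)) => b b0.
have -> : n.+2 = (n.-1 + 3)%N by rewrite addn3 prednK.
have -> : s^-1 ^+ n = s^-1 * s^-1 ^+ n.-1 by rewrite -exprS prednK.
rewrite exprD exprMn !exprVn.
have : s ^+ n.-1 != 0 by rewrite gt_eqF ?exprn_gt0.
have : b ^+ n.-1 != 0 by rewrite gt_eqF ?exprn_gt0.
have : b != 0 by rewrite gt_eqF.
have : s != 0 by rewrite gt_eqF.
move: (s ^+ n.-1) (b ^+ n.-1) (K1 _) (n%:R) => u v w N s1 b1 v1 u1.
by field; rewrite s1 b1 v1 u1.
Qed.

(** After the substitution [x = step k * y] the bump becomes [n L(step k * b)
    b^(-n-2)] with [b = sqrt (1 + |y|^2)] and [L r = r^(n-1) K1 r]. By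
    hypothesis [L] is bounded on bounded intervals and tends to [l] at the
    origin, so dominated convergence applies and the limit contains the
    integral of [b^(-n-2)], which is the volume of the unit ball. *)
Lemma cvg_bump_integral :
  \int[leb]_t (bump (step k ^+ 2) (rv t) * f (rv t)) @[k --> \oo]
    --> l * (n%:R * ball_vol R n) * f 0.
Proof.
have [C C0 HC] := bK1 (radius_bound_gt0 M).
have [D D0 HD] := continuous_box_bounded M cf.
pose b (t : n.-tuple T) := bracket 1 (enorm (rv t)).
have b0 t : 0 < b t by exact: bracket_gt0.
pose F k (t : n.-tuple T) := n%:R * ((step k * b t) ^+ n.-1 * K1 (step k * b t)) *
  (b t)^-1 ^+ n.+2 * f (step k *: rv t).
pose F0 (t : n.-tuple T) := n%:R * l * (b t)^-1 ^+ n.+2 * f 0.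
have iB : leb.-integrable setT (EFin \o (fun t => (b t)^-1 ^+ n.+2)).
  apply/integrableP; split.
    apply/measurable_EFinP.
    apply: (@continuous_rv_measurable R n (fun x => (bracket 1 (enorm x))^-1 ^+ n.+2)).
    move=> x.
    have h : {for enorm x, continuous (fun r : R => (bracket 1 r)^-1 ^+ n.+2)}.
      exact: continuous_bracketV.
    exact: (cvg_comp _ _ (@continuous_enorm R n x) h).
  rewrite (eq_integral (fun t => ((b t)^-1 ^+ n.+2)%:E)).
    by rewrite integral_bracketV// ltry.
  by move=> t _; rewrite /= ger0_norm// invX_ge0// ltW.
have cs k (u : 'rV[R]_n -> R) : continuous u ->
    continuous (fun x : 'rV[R]_n => u (step k *: x)).
  by move=> cu x; exact: (cvg_comp _ _ (@scaler_continuous _ _ (step k) x) (cu _)).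
have FE k : \int[leb]_t (bump (step k ^+ 2) (rv t) * f (rv t)) = \int[leb]_t F k t.
  have s0 := step_gt0 k.
  have iF : leb.-integrable setT (EFin \o (fun t => bump (step k ^+ 2) (rv t) * f (rv t))).
    apply: (continuous_box_integrable (f := fun x => bump (step k ^+ 2) x * f x)).
      by apply: continuous_mul => //; exact/continuous_bump/step2_gt0.
    by move=> x /f0 ->; rewrite mulr0.
  have E := Rintegral_tscale s0 iF.
  have iFs : leb.-integrable setT
      (EFin \o (fun t => bump (step k ^+ 2) (step k *: rv t) * f (step k *: rv t))).
    apply: (continuous_box_integrable (M := M / step k)
      (f := fun x => bump (step k ^+ 2) (step k *: x) * f (step k *: x))).
      by apply: continuous_mul; apply: cs => //; exact/continuous_bump/step2_gt0.
    move=> x xM; rewrite f0 ?mulr0// => sxM; apply: xM => i.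
    have := sxM i; rewrite mxE normrM (gtr0_norm s0) mulrC => h.
    by rewrite ler_pdivlMr.
  transitivity (step k ^+ n * \int[leb]_t (bump (step k ^+ 2) (step k *: rv t) * f (step k *: rv t))).
    transitivity (step k ^+ n * \int[leb]_t (bump (step k ^+ 2) (rv (tscale (step k) t)) *
        f (rv (tscale (step k) t)))); last first.
      by congr (_ * _); apply: eq_Rintegral => t _; rewrite rv_tscale.
    by rewrite E mulrA -exprMn mulfV ?gt_eqF// expr1n mul1r.
  rewrite -RintegralZl//; apply: eq_Rintegral => t _.
  rewrite -rv_tscale bump_scale rv_tscale /F -/(b t) !mulrA; congr (_ * _ * _ * _).
  by rewrite -exprMn mulfV ?gt_eqF// expr1n mul1r.
rewrite (_ : (fun k => _) = (fun k => \int[leb]_t F k t)); last exact/funext.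
pose L (r : R) := r ^+ n.-1 * K1 r.
have cL : {in `]0, +oo[, continuous L}.
  by move=> r r0; exact: cvgM (@exprn_continuous R n.-1 r) (cK1 r0).
have mbV : measurable_fun setT (fun t => (b t)^-1 ^+ n.+2).
  by case/integrableP : iB => /measurable_EFinP.
have mF k : measurable_fun setT (F k).
  apply: measurable_funM; first apply: measurable_funM => //.
    apply: measurable_funM => //.
    apply: (@continuous_rv_measurable R n (fun x => L (step k * bracket 1 (enorm x)))) => x.
    have h : {for x, continuous (fun y : 'rV[R]_n => step k * bracket 1 (enorm y))}.
      have hb := cvg_comp _ _ (@continuous_enorm R n x) (@continuous_bracket R 1 _).
      exact: (cvgM (@cst_continuous 'rV[R]_n R (step k) x) hb).
    have hL : {for step k * bracket 1 (enorm x), continuous L}.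
      by apply: cL; rewrite in_itv /= andbT mulr_gt0 ?step_gt0 ?bracket_gt0.
    exact: (cvg_comp _ _ h hL).
  exact: continuous_rv_measurable (cs k f cf).
have mF0 : measurable_fun setT F0.
  by do 2! apply: measurable_funM => //.
pose h (t : n.-tuple T) := n%:R * C * D * (b t)^-1 ^+ n.+2.
have ih : leb.-integrable setT (EFin \o h).
  exact: (integrableZl measurableT (n%:R * C * D) iB).
have cvF t : rv t != 0 -> F ^~ t @ \oo --> F0 t.
  move=> _; apply: cvgM; last first.
    have hs : step k *: rv t @[k --> \oo] --> (0 : 'rV[R]_n).
      by rewrite -[X in _ --> X](scale0r (rv t)); apply: cvgZr_tmp; exact: cvg_step.
    have c0 : {for (0 : 'rV[R]_n), continuous f} by exact: cf.
    exact: (cvg_comp _ _ hs c0).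
  apply: cvgM; last exact: cvg_cst.
  apply: cvgM; first exact: cvg_cst.
  have := (cvg_at_rightP L 0 l).1 lK1 (fun k => step k * b t); apply.
  split=> [k|]; first by rewrite mulr_gt0 ?step_gt0.
  by rewrite -[X in _ --> X](mul0r (b t)); apply: cvgM; [exact: cvg_step|exact: cvg_cst].
have bF k t : rv t != 0 -> `|F k t| <= h t.
  move=> _; rewrite /F /h.
  have hge : 0 <= n%:R * C * D * (b t)^-1 ^+ n.+2.
    apply: mulr_ge0; last by rewrite invX_ge0// ltW.
    by apply: mulr_ge0; [exact: mulr_ge0|exact: ltW].
  have [sM|sM] := pselect (box M (step k *: rv t)); last first.
    by rewrite f0// mulr0 normr0.
  have r0 : 0 < step k * b t by rewrite mulr_gt0 ?step_gt0.
  have rN : step k * b t <= radius_bound M.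
    apply: le_trans (qnorm_le_bound k (ltW M0) sM).
    rewrite /qnorm enormZ gtr0_norm ?step_gt0// /bracket exprMn.
    rewrite -[X in _ + X]mulr1 -mulrDr sqrtrM ?sqr_ge0// sqrtr_sqr gtr0_norm ?step_gt0//.
  have LC : `|L (step k * b t)| <= C.
    rewrite normrM ger0_norm ?exprn_ge0 ?(ltW r0)//.
    apply: le_trans (ler_wpM2l (exprn_ge0 _ (ltW r0)) (HC _ _)) _; first by rewrite r0.
    by rewrite mulrCA -exprMn mulfV ?gt_eqF// expr1n mulr1.
  have : 0 <= (b t)^-1 ^+ n.+2 by rewrite invX_ge0// ltW.
  rewrite -/(L _); move: ((b t)^-1 ^+ n.+2) (L _) LC => v y yC v0.
  rewrite !normrM normr_nat (ger0_norm v0).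
  rewrite [leRHS]mulrAC; apply: ler_pM; [|exact: normr_ge0| |exact: HD].
    by apply: mulr_ge0 => //; exact: mulr_ge0.
  by apply: ler_wpM2r => //; exact: ler_wpM2l.
have [_ cv] := Rintegral_dominated n0 mF mF0 ih cvF bF.
have EF0 : \int[leb]_t F0 t = l * (n%:R * ball_vol R n) * f 0.
  transitivity (\int[leb]_t (n%:R * l * f 0 * (b t)^-1 ^+ n.+2)).
    by apply: eq_Rintegral => t _; rewrite /F0; ring.
  rewrite RintegralZl// [X in _ * X](_ : _ = ball_vol R n).
    by ring.
  by rewrite /Rintegral integral_bracketV.
by rewrite EF0 in cv.
Qed.

(** Let the smoothing parameter tend to [0] in [regularized_identity]: the
    left side and the first integral converge by dominated convergence, the
    second one to the point mass. *)
Theorem weak_radial_laplacian :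
  \sum_i \int[leb]_t (K (enorm (rv t)) * f2 i (rv t)) =
  \int[leb]_t (g (enorm (rv t)) * f (rv t)) + l * (n%:R * ball_vol R n) * f 0.
Proof.
have weight1 k (x : 'rV[R]_n) : `|weight (step k ^+ 2) x| <= 1.
  have e0 := step2_gt0 k; have q0 := qnorm_gt0 x e0.
  rewrite ger0_norm; last by rewrite mulr_ge0 ?sqnorm_ge0// invX_ge0// ltW.
  rewrite /weight exprVn ler_pdivrMr ?exprn_gt0// mul1r qnorm_sqr; last exact: ltW.
  by rewrite lerDl ltW.
have cvg_weight (x : 'rV[R]_n) : x != 0 -> weight (step k ^+ 2) x @[k --> \oo] --> (1 : R).
  move=> x0; have h0 : 0 < enorm x by rewrite enorm_gt0.
  have hV : {for enorm x, continuous (fun r : R => r^-1 ^+ 2)}.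
    by apply: continuous_invX; rewrite in_itv /= andbT.
  have hq : qnorm (step k ^+ 2) x @[k --> \oo] --> enorm x by exact: cvg_qnorm.
  have := cvgM (cvg_cst (sqnorm x)) (cvg_comp _ _ hq hV).
  have -> : sqnorm x * (enorm x)^-1 ^+ 2 = 1.
    by rewrite -enorm_sqr -exprMn mulfV ?gt_eqF// expr1n.
  by apply.
have cvg1 : \sum_i \int[leb]_t (K (qnorm (step k ^+ 2) (rv t)) * f2 i (rv t)) @[k --> \oo]
    --> \sum_i \int[leb]_t (K (enorm (rv t)) * f2 i (rv t)).
  apply: cvg_big => [|i _]; first exact: add_continuous.
  pose w (_ : nat) (_ : 'rV[R]_n) : R := 1.
  have cw k : continuous (w k) by exact: cst_continuous.
  have w1 k x : `|w k x| <= 1 by rewrite normr1.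
  have ww (x : 'rV[R]_n) : x != 0 -> w k x @[k --> \oo] --> (1 : R).
    by move=> _; exact: cvg_cst.
  have [_] := cvg_radial_integral cK bK M0 cw w1 ww (@cf2 i) (@f20 i).
  by under eq_fun do under eq_Rintegral do rewrite mulr1.
have cvg2 : \int[leb]_t (g (qnorm (step k ^+ 2) (rv t)) * weight (step k ^+ 2) (rv t) * f (rv t))
    @[k --> \oo] --> \int[leb]_t (g (enorm (rv t)) * f (rv t)).
  have cw k : continuous (weight (step k ^+ 2)) by exact/continuous_weight/step2_gt0.
  by have [] := cvg_radial_integral cg bg M0 cw weight1 cvg_weight cf f0.
apply: (@cvg_unique _ (@norm_hausdorff _ R) _ _ _ _ cvg1).
rewrite (_ : (fun k => _) = (fun k =>
  \int[leb]_t (g (qnorm (step k ^+ 2) (rv t)) * weight (step k ^+ 2) (rv t) * f (rv t)) +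
  \int[leb]_t (bump (step k ^+ 2) (rv t) * f (rv t)))).
  exact: cvgD cvg2 cvg_bump_integral.
by apply/funext => k; exact/regularized_identity/step2_gt0.
Qed.
End Regularization.

(** * Powers of the radius times a logarithm *)

(** Crude but uniform: one power of [r] absorbs the logarithm both near [0]
    and at infinity. *)
Lemma normr_ln_le (R : realType) (r : R) : 0 < r -> `|ln r| <= r + r^-1.
Proof.
move=> r0; have V0 : 0 < r^-1 by rewrite invr_gt0.
rewrite ler_norml; apply/andP; split; last first.
  by rewrite (le_trans (ltW (ln_sublinear r0)))// lerDl ltW.
rewrite lerNl -lnV ?posrE//.
by rewrite (le_trans (ltW (ln_sublinear V0)))// lerDr ltW.
Qed.

Section RadialTerms.
Variables (R : realType) (N : nat).
Local Notation n := N.+2.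
Implicit Types (r : R).

(** The power [r^(2m - N)], written with natural exponents so that it is [0]
    at [r = 0] when [N] is positive. *)
Definition pw (m : nat) r : R := r^-1 ^+ N * r ^+ (2 * m).

Definition log_term (m : nat) (a b : R) r : R := pw m r * (a * ln r - b).

Definition expo (m : nat) : R := (2 * m)%:R - N%:R.

Definition log_term' (m : nat) (a b : R) r : R :=
  r^-1 * pw m r * (expo m * (a * ln r - b) + a).

Lemma is_derive_pw m r : 0 < r -> is_derive r 1 (pw m) (expo m * (r^-1 * pw m r)).
Proof.
move=> r0; have rN0 : r != 0 by rewrite gt_eqF.
have hV := @is_deriveV R id _ _ _ rN0 (is_derive_id r 1).
have h1 := is_deriveX N hV.
have h2 := is_deriveX (2 * m) (is_derive_id r 1).
apply: is_derive_ext (is_deriveM h1 h2) => [y|].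
  by rewrite /pw fctE/= !fctE.
rewrite /GRing.scale /= !fctE /= /expo /pw !mulr1.
have -> : r^-1 ^+ N * ((2 * m)%:R * r ^+ (2 * m).-1) =
          (2 * m)%:R * (r^-1 * (r^-1 ^+ N * r ^+ (2 * m))).
  case: (2 * m)%N => [|j]; first by rewrite !mul0r mulr0.
  rewrite /= exprS; move: (r^-1 ^+ N) (j.+1%:R : R) (r ^+ j) => u c v.
  by field.
rewrite mulrBl; congr (_ + _).
case: (N) => [|k]; first by rewrite !mul0r mulr0 oppr0.
rewrite /= -exprVn [r^-1 ^+ k.+1]exprS.
move: (r^-1 ^+ k) (k.+1%:R : R) (r ^+ (2 * m)) => u c v.
by ring.
Qed.

Lemma is_derive_log_term m a b r : 0 < r ->
  is_derive r 1 (log_term m a b) (log_term' m a b r).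
Proof.
move=> r0; have rN0 : r != 0 by rewrite gt_eqF.
have hl : is_derive r 1 (fun x => a * ln x - b) (a * r^-1).
  apply: is_derive_ext (is_deriveB (is_deriveZ a (is_derive1_ln r0)) (is_derive_cst b r 1)) => //.
  by rewrite subr0.
apply: is_derive_ext (is_deriveM (is_derive_pw m r0) hl) => //.
by rewrite /GRing.scale /= /log_term'; ring.
Qed.

(** In this form the radial operator acts on the pair of coefficients alone:
    it multiplies [a] by [2m (2m - N)] and sends [b] to [2m (2m - N) b - (4m -
    N) a]. *)
Lemma is_derive_log_term' m a b r : 0 < r ->
  is_derive r 1 (log_term' m a b)
    (r^-1 ^+ 2 * pw m r * ((2 * m)%:R * expo m * (a * ln r - b) +
       ((2 * m)%:R + expo m) * a) - N.+1%:R * log_term' m a b r / r).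
Proof.
move=> r0; have rN0 : r != 0 by rewrite gt_eqF.
have hl : is_derive r 1 (fun x => expo m * (a * ln x - b) + a) (expo m * (a * r^-1)).
  apply: is_derive_ext (is_deriveD (is_deriveZ (expo m)
    (is_deriveB (is_deriveZ a (is_derive1_ln r0)) (is_derive_cst b r 1))) (is_derive_cst a r 1)) => //.
  by rewrite subr0 addr0.
have hV := @is_deriveV R id _ _ _ rN0 (is_derive_id r 1).
have hp : is_derive r 1 (fun x => x^-1 * pw m x)
    ((expo m - 1) * (r^-1 ^+ 2 * pw m r)).
  apply: is_derive_ext (is_deriveM hV (is_derive_pw m r0)) => //.
  by rewrite /GRing.scale /= mulr1 -exprVn; ring.
apply: is_derive_ext (is_deriveM hp hl) => //.
rewrite /GRing.scale /= /log_term' /expo -[N.+1%:R]natr1; ring.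
Qed.

Lemma pwS m r : 0 < r -> pw m.+1 r = r ^+ 2 * pw m r.
Proof. by move=> r0; rewrite /pw mulnS exprD; ring. Qed.

Lemma continuous_log_term m a b : {in `]0, +oo[, continuous (log_term m a b)}.
Proof.
move=> r; rewrite in_itv /= andbT => r0.
apply: differentiable_continuous; apply/derivable1_diffP.
by case: (is_derive_log_term m a b r0).
Qed.

Lemma log_term_le m a b r M : 0 < r <= M ->
  `|log_term m a b r| <=
    (M ^+ 2) ^+ m * (`|a| * (M ^+ 2 + 1) + `|b| * M) * r^-1 ^+ N.+1.
Proof.
move=> /andP[r0 rM].
have M0 : 0 <= M by rewrite (le_trans _ rM)// ltW.
have V0 : 0 <= r^-1 ^+ N.+1 by rewrite exprn_ge0// invr_ge0 ltW.
have -> : log_term m a b r = (r ^+ 2) ^+ m * (r * (a * ln r - b)) * r^-1 ^+ N.+1.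
  rewrite /log_term /pw exprM [r^-1 ^+ N.+1]exprS.
  move: (r^-1 ^+ N) (r ^+ 2 ^+ m) (a * ln r - b) => u v w.
  by field; rewrite gt_eqF.
rewrite normrM (ger0_norm V0) ler_wpM2r// normrM.
have rM2 : r ^+ 2 <= M ^+ 2 by rewrite lerXn2r ?nnegrE ?(ltW r0).
apply: ler_pM => //.
  rewrite ger0_norm ?exprn_ge0 ?(ltW r0)//.
  by rewrite lerXn2r ?nnegrE ?sqr_ge0.
rewrite mulrBr (le_trans (ler_normB _ _))//; apply: lerD; last first.
  by rewrite normrM (gtr0_norm r0) mulrC ler_wpM2l.
rewrite mulrCA normrM ler_wpM2l// normrM (gtr0_norm r0).
apply: le_trans (ler_wpM2l (ltW r0) (normr_ln_le r0)) _.
by rewrite mulrDr mulfV ?gt_eqF// -expr2 lerD2r.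
Qed.

Lemma log_majorant_ge0 (a b M : R) : 0 <= M ->
  0 <= `|a| * (M ^+ 2 + 1) + `|b| * M.
Proof.
move=> M0; apply: addr_ge0; last exact: mulr_ge0.
by apply: mulr_ge0 => //; rewrite addr_ge0 ?sqr_ge0.
Qed.

Lemma radial_bounded_log_term m a b : radial_bounded n (log_term m a b).
Proof.
move=> M M0; exists ((M ^+ 2) ^+ m * (`|a| * (M ^+ 2 + 1) + `|b| * M)).
  by rewrite mulr_ge0 ?log_majorant_ge0 ?(ltW M0)// exprn_ge0// sqr_ge0.
by move=> r r0; exact: log_term_le.
Qed.

Lemma log_term'E m a b r : 0 < r ->
  r ^+ N.+1 * log_term' m a b r = (r ^+ 2) ^+ m * (expo m * (a * ln r - b) + a).
Proof.
move=> r0; rewrite /log_term' /pw [r ^+ N.+1]exprS exprM exprVn.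
have : r ^+ N != 0 by rewrite gt_eqF// exprn_gt0.
move: (r ^+ N) (r ^+ 2 ^+ m) (expo m * _ + a) => u v w u0.
by field; rewrite u0 gt_eqF.
Qed.

(** A logarithm in the leading term [m = 0] would make the derivative too
    large; for positive [m] the factor [r^2] compensates it. *)
Lemma radial_bounded_log_term' m a b : (m = 0%N -> a = 0) ->
  radial_bounded n (log_term' m a b).
Proof.
move=> ma M M0.
pose A : R := `|expo m| * (`|a| * (M ^+ 2 + 1) * M + `|b| * M ^+ 2) + `|a| * M ^+ 2.
have A0 : 0 <= A.
  rewrite /A; apply: addr_ge0; last by rewrite mulr_ge0 ?sqr_ge0.
  apply: mulr_ge0 => //; apply: addr_ge0; last by rewrite mulr_ge0 ?sqr_ge0.
  apply: mulr_ge0; last exact: ltW.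
  by apply: mulr_ge0 => //; rewrite addr_ge0 ?sqr_ge0.
have B0 : 0 <= (M ^+ 2) ^+ m.-1 * A by rewrite mulr_ge0// exprn_ge0// sqr_ge0.
exists (`|expo m * b| + (M ^+ 2) ^+ m.-1 * A); first by rewrite addr_ge0.
move=> r /andP[r0 rM].
have V0 : 0 <= r^-1 ^+ N.+1 by rewrite exprn_ge0// invr_ge0 ltW.
have E : log_term' m a b r = r ^+ N.+1 * log_term' m a b r * r^-1 ^+ N.+1.
  by rewrite mulrAC -exprMn mulfV ?gt_eqF// expr1n mul1r.
rewrite E log_term'E// normrM (ger0_norm V0) ler_wpM2r//.
have rM2 : r ^+ 2 <= M ^+ 2 by rewrite lerXn2r ?nnegrE ?(ltW r0) ?(ltW M0).
case: m ma @A A0 B0 E => [|m] ma A A0 B0 _.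
  rewrite ma// mul0r add0r addr0 expr0 mul1r mulrN normrN.
  by rewrite lerDl.
apply: (@le_trans _ _ (M ^+ 2 ^+ m * A)); last by rewrite /= lerDr.
rewrite exprSr -mulrA normrM; apply: ler_pM => //.
  rewrite ger0_norm ?exprn_ge0 ?(ltW r0)//.
  by rewrite lerXn2r ?nnegrE ?sqr_ge0.
rewrite mulrDr (le_trans (ler_normD _ _))//; apply: lerD; last first.
  by rewrite normrM mulrC (ger0_norm (sqr_ge0 r)) ler_wpM2l.
rewrite mulrCA normrM ler_wpM2l// mulrBr (le_trans (ler_normB _ _))//; apply: lerD; last first.
  by rewrite normrM mulrC (ger0_norm (sqr_ge0 r)) ler_wpM2l.
rewrite mulrCA normrM -mulrA ler_wpM2l// normrM (ger0_norm (sqr_ge0 r)).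
apply: le_trans (ler_wpM2l (sqr_ge0 r) (normr_ln_le r0)) _.
have -> : r ^+ 2 * (r + r^-1) = (r ^+ 2 + 1) * r by field; rewrite gt_eqF.
by apply: ler_pM => //; rewrite ?addr_ge0 ?sqr_ge0 ?(ltW r0)// lerD2r.
Qed.

Lemma cvg_at_right_mul_ln (c d : R) :
  r ^+ 2 * (c * ln r + d) @[r --> 0^'+] --> (0 : R).
Proof.
have h k : r ^+ k.+1 @[r --> (0 : R)^'+] --> (0 : R).
  apply: cvg_at_right_filter.
  by have := @exprn_continuous R k.+1 0; rewrite /continuous_at expr0n.
have hl : r ^+ 2 * ln r @[r --> 0^'+] --> (0 : R).
  apply/norm_cvg0P.
  apply: (@squeeze_cvgr _ _ _ _ (cst 0) (fun r => r ^+ 3 + r ^+ 1)).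
  - near=> r; have r0 : 0 < r by near: r; exact: nbhs_right_gt.
    rewrite normr_ge0 /= normrM ger0_norm ?exprn_ge0 ?(ltW r0)//.
    apply: le_trans (ler_wpM2l (exprn_ge0 2 (ltW r0)) (normr_ln_le r0)) _.
    by rewrite mulrDr -exprSr expr2 mulfK ?gt_eqF// expr1.
  - exact: cvg_cst.
  - by rewrite -[X in _ --> X]addr0; apply: cvgD; exact: h.
have -> : (fun r => r ^+ 2 * (c * ln r + d)) = (fun r => c * (r ^+ 2 * ln r) + d * r ^+ 2).
  by apply/funext => r; ring.
have hc : c * (r ^+ 2 * ln r) @[r --> 0^'+] --> c * 0.
  by apply: cvgM; [exact: cvg_cst|exact: hl].
have hd : d * r ^+ 2 @[r --> 0^'+] --> d * 0.
  by apply: cvgM; [exact: cvg_cst|exact: h].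
have E : c * 0 + d * 0 = 0 :> R by rewrite !mulr0 addr0.
by rewrite -[X in _ --> X]E; exact: cvgD hc hd.
Unshelve. all: by end_near. Qed.

End RadialTerms.

(** * Series solutions of the radial equation *)

(** The hypotheses [recA] and [recB] say that the radial operator maps the
    term of index [m.+1] to [k2] times the term of index [m]; [a0] and [b0]
    normalise the term of index [0], which is harmonic away from the origin. *)
Section LogSeries.
Variables (R : realType) (N : nat).
Local Notation n := N.+2.
Local Notation T := (measurableTypeR R).
Local Notation leb := (lebesgue_tuple R n).
Variables (k2 : R) (a b : nat -> R) (D : R).
Hypothesis N0 : (0 < N)%N.
Hypothesis k20 : 0 <= k2.
Hypothesis a0 : a 0%N = 0.
Hypothesis b0 : b 0%N = N%:R^-1.
Hypothesis recA : forall m,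
  (2 * m.+1)%:R * expo R N m.+1 * a m.+1 = k2 * a m.
Hypothesis recB : forall m,
  (2 * m.+1)%:R * expo R N m.+1 * b m.+1 - ((2 * m.+1)%:R + expo R N m.+1) * a m.+1
  = k2 * b m.
Hypothesis D0 : 0 <= D.
Hypothesis aD : forall m, `|a m| <= D * exp_coeff k2 m.
Hypothesis bD : forall m, `|b m| <= D * exp_coeff k2 m.

Let n1 : (1 < n)%N. Proof. by []. Qed.
Let n0 : (0 < n)%N. Proof. by []. Qed.

Definition term (m : nat) (r : R) : R := log_term N m (a m) (b m) r.

Definition psum (k : nat) (r : R) : R := series (fun m => term m r) k.

Definition radial_sum (r : R) : R := limn (fun k => psum k r).

Lemma psum0 r : psum 0 r = 0.
Proof. by rewrite /psum /series /= big_geq. Qed.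

Lemma psumS k r : psum k.+1 r = psum k r + term k r.
Proof. by rewrite /psum /series /= big_nat_recr. Qed.

Lemma radial_mul_integrable (H : R -> R) (f : 'rV[R]_n -> R) (M : R) :
  {in `]0, +oo[, continuous H} -> radial_bounded n H -> 0 < M ->
  continuous f -> (forall x, ~ box M x -> f x = 0) ->
  leb.-integrable setT (EFin \o (fun t => H (enorm (rv t)) * f (rv t))).
Proof.
move=> cH bH M0 cf f0.
have cw (k : nat) : continuous (fun _ : 'rV[R]_n => 1 : R) by exact: cst_continuous.
have w1 (k : nat) (x : 'rV[R]_n) : `|1 : R| <= 1 by rewrite normr1.
have ww (x : 'rV[R]_n) : x != 0 -> (1 : R) @[k --> \oo] --> (1 : R).
  by move=> _; exact: cvg_cst.
by have [] := cvg_radial_integral n1 cH bH M0 cw w1 ww cf f0.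
Qed.

Section TestFunction.
Variables (f : 'rV[R]_n -> R) (f1 f2 : 'I_n -> 'rV[R]_n -> R) (M : R).
Hypothesis M0 : 0 < M.
Hypothesis df : forall i x, is_derive x (delta_mx 0 i) f (f1 i x).
Hypothesis df1 : forall i x, is_derive x (delta_mx 0 i) (f1 i) (f2 i x).
Hypothesis cf : continuous f.
Hypothesis cf2 : forall i, continuous (f2 i).
Hypothesis f0 : forall x, ~ box M x -> f x = 0.

Let f20 i x : ~ box M x -> f2 i x = 0.
Proof.
move=> xM; apply: (is_derive_outside_box (df1 i x)) xM => y.
exact: is_derive_outside_box (df i y) f0.
Qed.

(** The leading term is [- r^(-N) / N], with [r^(N+1)] times its derivative
    equal to [1]: it carries the whole point mass. *)
Lemma weak_laplacian_term0 :
  \sum_i \int[leb]_t (term 0 (enorm (rv t)) * f2 i (rv t)) = n%:R * ball_vol R n * f 0.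
Proof.
have dK1 (r : R) : 0 < r -> is_derive r 1 (log_term' N 0 (a 0%N) (b 0%N))
    (0 - n.-1%:R * log_term' N 0 (a 0%N) (b 0%N) r / r).
  move=> r0; apply: is_derive_ext (is_derive_log_term' N 0 (a 0%N) (b 0%N) r0) => //.
  by rewrite a0 muln0 !mul0r mulr0 addr0 mulr0.
have b0' : radial_bounded n (fun _ : R => 0 : R).
  move=> M' M'0; exists 0 => // r /andP[r0 _].
  by rewrite normr0 mul0r.
have l0 : r ^+ n.-1 * log_term' N 0 (a 0%N) (b 0%N) r @[r --> 0^'+] --> (1 : R).
  apply: (@cvg_trans _ (cst (1 : R) @ (0 : R)^'+)); last exact: cvg_cst.
  apply: near_eq_cvg; near=> r.
  have r0 : 0 < r by near: r; exact: nbhs_right_gt.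
  rewrite log_term'E// a0 b0 mul0r addr0 sub0r expr0 mul1r /expo muln0 sub0r mulrNN.
  by rewrite mulfV// pnatr_eq0 -lt0n.
have dK (r : R) : 0 < r ->
    is_derive r 1 (log_term N 0 (a 0%N) (b 0%N)) (log_term' N 0 (a 0%N) (b 0%N) r).
  exact: is_derive_log_term.
have bK : radial_bounded n (log_term N 0 (a 0%N) (b 0%N)) by exact: radial_bounded_log_term.
have bK1 : radial_bounded n (log_term' N 0 (a 0%N) (b 0%N)).
  exact: radial_bounded_log_term'.
have cz : {in `]0, +oo[, continuous (fun _ : R => 0 : R)}.
  by move=> r _; exact: cst_continuous.
have := weak_radial_laplacian n1 dK dK1 cz bK b0' bK1 l0 M0 df df1 cf cf2 f0.
rewrite /term => ->; rewrite (_ : \int[_]_t _ = 0) ?add0r ?mul1r//.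
rewrite /Rintegral; under eq_integral do rewrite mul0r.
by rewrite integral0.
Unshelve. all: by end_near. Qed.

(** The derivative of a later term is smaller than [r^(-N-1)] by a factor of
    order [r^2 ln r], so these terms have no mass at the origin. *)
Lemma weak_laplacian_termS m :
  \sum_i \int[leb]_t (term m.+1 (enorm (rv t)) * f2 i (rv t)) =
  k2 * \int[leb]_t (term m (enorm (rv t)) * f (rv t)).
Proof.
have dK1 (r : R) : 0 < r -> is_derive r 1 (log_term' N m.+1 (a m.+1) (b m.+1))
    (k2 * term m r - n.-1%:R * log_term' N m.+1 (a m.+1) (b m.+1) r / r).
  move=> r0; apply: is_derive_ext (is_derive_log_term' N m.+1 (a m.+1) (b m.+1) r0) => //.
  congr (_ - _); rewrite pwS// mulrA -exprMn mulVf ?gt_eqF// expr1n mul1r.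
  rewrite /term /log_term mulrCA; congr (_ * _).
  have -> : k2 * (a m * ln r - b m) = k2 * a m * ln r - k2 * b m by ring.
  rewrite -recA -recB; move: ((2 * m.+1)%:R : R) (expo R N m.+1) => c e.
  by ring.
have ck : {in `]0, +oo[, continuous (fun r => k2 * term m r)}.
  move=> r r0; apply: (@cvgM _ _ _ _ (cst k2)); first exact: cvg_cst.
  exact: continuous_log_term.
have bk : radial_bounded n (fun r => k2 * term m r).
  move=> M' M'0; have [C C0 HC] := @radial_bounded_log_term R N m (a m) (b m) M' M'0.
  exists (k2 * C); first exact: mulr_ge0.
  by move=> r /HC h; rewrite normrM ger0_norm// -mulrA ler_wpM2l.
have l0 : r ^+ n.-1 * log_term' N m.+1 (a m.+1) (b m.+1) r @[r --> 0^'+] --> (0 : R).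
  set e := expo R N m.+1.
  have h1 : (r ^+ 2) ^+ m * (r ^+ 2 * (e * a m.+1 * ln r + (a m.+1 - e * b m.+1)))
      @[r --> 0^'+] --> ((0 : R) ^+ 2) ^+ m * 0.
    apply: cvgM; last exact: cvg_at_right_mul_ln.
    apply: cvg_at_right_filter.
    exact: (cvg_comp _ _ (@exprn_continuous R 2 0) (@exprn_continuous R m _)).
  rewrite mulr0 in h1; apply: cvg_trans h1; apply: near_eq_cvg; near=> r.
  have r0 : 0 < r by near: r; exact: nbhs_right_gt.
  rewrite log_term'E// -/e [r ^+ 2 ^+ m.+1]exprSr.
  by move: (r ^+ 2 ^+ m) (r ^+ 2) (ln r) => u v w; ring.
have dK (r : R) : 0 < r ->
    is_derive r 1 (log_term N m.+1 (a m.+1) (b m.+1)) (log_term' N m.+1 (a m.+1) (b m.+1) r).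
  exact: is_derive_log_term.
have bK : radial_bounded n (log_term N m.+1 (a m.+1) (b m.+1)).
  exact: radial_bounded_log_term.
have bK1 : radial_bounded n (log_term' N m.+1 (a m.+1) (b m.+1)).
  exact: radial_bounded_log_term'.
have := weak_radial_laplacian n1 dK dK1 ck bK bk bK1 l0 M0 df df1 cf cf2 f0.
rewrite /term => ->; rewrite !mul0r addr0.
under eq_Rintegral do rewrite -mulrA.
rewrite RintegralZl//; apply: (@radial_mul_integrable _ f M) => //.
  exact: continuous_log_term.
exact: radial_bounded_log_term.
Unshelve. all: by end_near. Qed.


Let psum_integrable k (h : 'rV[R]_n -> R) : continuous h ->
  (forall x, ~ box M x -> h x = 0) ->
  leb.-integrable setT (EFin \o (fun t => psum k (enorm (rv t)) * h (rv t))).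
Proof.
move=> ch h0; elim: k => [|k IH].
  rewrite (_ : _ \o _ = cst 0%E); first exact: integrable0.
  by apply/funext => t /=; rewrite psum0 mul0r.
have it : leb.-integrable setT (EFin \o (fun t => term k (enorm (rv t)) * h (rv t))).
  apply: (@radial_mul_integrable _ h M) => //.
    exact: continuous_log_term.
  exact: radial_bounded_log_term.
apply: (eq_integrable measurableT _ _ _ (integrableD measurableT IH it)) => t _ /=.
by rewrite -EFinD psumS mulrDl.
Qed.

Let term_integrable k (h : 'rV[R]_n -> R) : continuous h ->
  (forall x, ~ box M x -> h x = 0) ->
  leb.-integrable setT (EFin \o (fun t => term k (enorm (rv t)) * h (rv t))).
Proof.
move=> ch h0; apply: (@radial_mul_integrable _ h M) => //.
  exact: continuous_log_term.
exact: radial_bounded_log_term.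
Qed.

(** The identities for the single terms telescope, with a shift of one in the
    number of terms. *)
Lemma weak_laplacian_psum k :
  \sum_i \int[leb]_t (psum k.+1 (enorm (rv t)) * f2 i (rv t)) =
  k2 * \int[leb]_t (psum k (enorm (rv t)) * f (rv t)) + n%:R * ball_vol R n * f 0.
Proof.
elim: k => [|k IH].
  rewrite [X in k2 * X](_ : _ = 0); last first.
    rewrite /Rintegral; under eq_integral do rewrite psum0 mul0r.
    by rewrite integral0.
  rewrite mulr0 add0r -weak_laplacian_term0; apply: eq_bigr => i _.
  by apply: eq_Rintegral => t _; rewrite psumS psum0 add0r.
transitivity (\sum_i (\int[leb]_t (psum k.+1 (enorm (rv t)) * f2 i (rv t)) +
    \int[leb]_t (term k.+1 (enorm (rv t)) * f2 i (rv t)))).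
  apply: eq_bigr => i _; rewrite -RintegralD//; last 2 first.
  - by apply: psum_integrable => // x; exact: f20.
  - by apply: term_integrable => // x; exact: f20.
  by apply: eq_Rintegral => t _; rewrite psumS mulrDl.
rewrite big_split /= IH weak_laplacian_termS addrAC -mulrDr; congr (_ * _ + _).
rewrite -RintegralD//; last 2 first.
- exact: psum_integrable.
- exact: term_integrable.
by apply: eq_Rintegral => t _; rewrite [in RHS]psumS mulrDl.
Qed.

End TestFunction.

Definition psum_bound (M : R) : R := D * (M ^+ 2 + 1 + M) * expR (M ^+ 2 * k2).

Lemma psum_bound_ge0 M : 0 <= M -> 0 <= psum_bound M.
Proof.
move=> M0; apply: mulr_ge0; last exact: expR_ge0.
by apply: mulr_ge0 => //; rewrite !addr_ge0// sqr_ge0.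
Qed.

Lemma term_le m (r M : R) : 0 < r <= M ->
  `|term m r| <= D * (M ^+ 2 + 1 + M) * exp_coeff (M ^+ 2 * k2) m * r^-1 ^+ N.+1.
Proof.
move=> rM; have /andP[r0 rM'] := rM.
have M0 : 0 <= M by rewrite (le_trans _ rM')// ltW.
have V0 : 0 <= r^-1 ^+ N.+1 by rewrite exprn_ge0// invr_ge0 ltW.
apply: le_trans (log_term_le N m (a m) (b m) rM) _.
apply: ler_wpM2r => //.
rewrite [leRHS](_ : _ = (M ^+ 2) ^+ m * (D * exp_coeff k2 m * (M ^+ 2 + 1)
   + D * exp_coeff k2 m * M)); last first.
  rewrite /exp_coeff /= exprMn.
  by move: (m`!%:R^-1 : R) (M ^+ 2 ^+ m) (k2 ^+ m) => u v w; ring.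
apply: ler_wpM2l; first by rewrite exprn_ge0// sqr_ge0.
apply: lerD; apply: ler_wpM2r => //.
by rewrite addr_ge0// sqr_ge0.
Qed.

Lemma psum_le k (r M : R) : 0 < r <= M ->
  `|psum k r| <= psum_bound M * r^-1 ^+ N.+1.
Proof.
move=> rM; have /andP[r0 rM'] := rM.
have M0 : 0 <= M by rewrite (le_trans _ rM')// ltW.
have V0 : 0 <= r^-1 ^+ N.+1 by rewrite exprn_ge0// invr_ge0 ltW.
have x0 : 0 <= M ^+ 2 * k2 by rewrite mulr_ge0 ?sqr_ge0.
rewrite /psum /series /=; apply: le_trans (ler_norm_sum _ _ _) _.
apply: (@le_trans _ _ (\sum_(0 <= m < k)
   D * (M ^+ 2 + 1 + M) * exp_coeff (M ^+ 2 * k2) m * r^-1 ^+ N.+1)).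
  by apply: ler_sum => m _; exact: term_le.
rewrite -mulr_suml ler_wpM2r// -mulr_sumr ler_wpM2l//.
  by apply: mulr_ge0 => //; rewrite !addr_ge0// sqr_ge0.
apply: (nondecreasing_cvgn_le _ (is_cvg_series_exp_coeff _)).
by apply: nondecreasing_series => m _ _; exact: exp_coeff_ge0.
Qed.

Lemma term_at0 m : term m 0 = 0.
Proof. by rewrite /term /log_term /pw invr0 expr0n eqn0Ngt N0 mul0r mul0r. Qed.

Lemma is_cvg_psum (r : R) : 0 <= r -> cvgn (fun k => psum k r).
Proof.
rewrite le_eqVlt => /orP[/eqP<-|r0].
  have -> : (fun k => psum k 0) = cst 0.
    apply/funext => k; rewrite /psum /series /= big1// => m _; exact: term_at0.
  exact: is_cvg_cst.
apply: normed_cvg.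
apply: (@series_le_cvg _ _ (fun m => D * (r ^+ 2 + 1 + r) * r^-1 ^+ N.+1 * exp_coeff (r ^+ 2 * k2) m)).
- by move=> m; exact: normr_ge0.
- move=> m; apply: mulr_ge0; last by rewrite exp_coeff_ge0// mulr_ge0 ?sqr_ge0.
  apply: mulr_ge0; last by rewrite exprn_ge0// invr_ge0 ltW.
  by apply: mulr_ge0 => //; rewrite !addr_ge0 ?sqr_ge0// ltW.
- move=> m; rewrite [leRHS]mulrAC; apply: term_le.
  by rewrite r0 lexx.
- exact: is_cvg_seriesZ (is_cvg_series_exp_coeff _).
Qed.

Lemma cvg_psum (r : R) : 0 <= r -> psum k r @[k --> \oo] --> radial_sum r.
Proof. exact: is_cvg_psum. Qed.

Lemma radial_sum_le (r M : R) : 0 < r <= M ->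
  `|radial_sum r| <= psum_bound M * r^-1 ^+ N.+1.
Proof.
move=> rM; have /andP[/ltW r0 _] := rM.
have h := cvg_norm (cvg_psum r0) _.
by apply: (cvgr_to_le (h _)); apply: nearW => k; exact: psum_le.
Qed.

Lemma radial_sum0 : radial_sum 0 = 0.
Proof.
rewrite /radial_sum (_ : (fun k => psum k 0) = cst 0) ?lim_cst//.
by apply/funext => k; rewrite /psum /series /= big1// => m _; exact: term_at0.
Qed.

Lemma measurable_psum k : measurable_fun setT (fun t : n.-tuple T => psum k (enorm (rv t))).
Proof.
elim: k => [|k IH].
  rewrite (_ : (fun _ => _) = cst 0)//.
  by apply/funext => t; rewrite psum0.
rewrite (_ : (fun _ => _) = (fun t : n.-tuple T => psum k (enorm (rv t)) + term k (enorm (rv t)))).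
  apply: measurable_funD => //; apply: measurable_radial; exact: continuous_log_term.
by apply/funext => t; rewrite psumS.
Qed.

Lemma measurable_radial_sum :
  measurable_fun setT (fun t : n.-tuple T => radial_sum (enorm (rv t))).
Proof.
apply: (@measurable_fun_cvg _ _ _ _ (fun k t => psum k (enorm (rv t)))).
  exact: measurable_psum.
by move=> t _; apply: cvg_psum; exact: enorm_ge0.
Qed.

Lemma radial_sum_integrable (M : R) : 0 < M ->
  leb.-integrable (@rv R n @^-1` box M) (fun t => (radial_sum (enorm (rv t)))%:E).
Proof.
move=> M0.
have mB : measurable (@rv R n @^-1` box M : set (n.-tuple T)) by exact: measurable_box.
have iM := enorm_exp_integrable n1 M0.
apply: (le_integrable mB _ _ (integrableZl mB (psum_bound (radius_bound n M)) iM)).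
  by apply/measurable_EFinP; apply: measurable_funTS; exact: measurable_radial_sum.
move=> t tM; rewrite /= lee_fin.
have B0 := psum_bound_ge0 (ltW (radius_bound_gt0 n M)).
rewrite [leRHS]ger0_norm; last by rewrite mulr_ge0// exprn_ge0// invr_ge0 enorm_ge0.
have := enorm_ge0 (rv t); rewrite le_eqVlt => /orP[/eqP <-|x0].
  by rewrite radial_sum0 normr0 mulr_ge0// exprn_ge0// invr0.
by apply: radial_sum_le; rewrite x0 enorm_le_bound// ltW.
Qed.

(** All partial sums and their limit have the same majorant, a constant times
    [r^(1-n)] on a box. *)
Lemma cvg_psum_integral (h : 'rV[R]_n -> R) (M : R) : 0 < M ->
  continuous h -> (forall x, ~ box M x -> h x = 0) ->
  leb.-integrable setT (EFin \o (fun t => radial_sum (enorm (rv t)) * h (rv t))) /\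
  \int[leb]_t (psum k (enorm (rv t)) * h (rv t)) @[k --> \oo] -->
  \int[leb]_t (radial_sum (enorm (rv t)) * h (rv t)).
Proof.
move=> M0 ch h0.
have [C C0 HC] := continuous_box_bounded M ch.
have mh : measurable_fun setT (fun t : n.-tuple T => h (rv t)) by exact: continuous_rv_measurable.
apply: (@Rintegral_dominated R n n0 _ _ (fun t =>
  (psum_bound (radius_bound n M) * C) *
  ((fun t => (enorm (rv t))^-1 ^+ n.-1) \_ (@rv R n @^-1` box M)) t)).
- by move=> k; apply: measurable_funM => //; exact: measurable_psum.
- by apply: measurable_funM => //; exact: measurable_radial_sum.
- exact: majorant_integrable.
- move=> t _; apply: cvgM; last exact: cvg_cst.
  by apply: cvg_psum; exact: enorm_ge0.
- move=> k t t0; rewrite patchE; case: ifPn => [|/negP tM]; last first.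
    rewrite h0 ?mulr0 ?normr0// => tM'; apply: tM.
    by rewrite inE.
  rewrite inE /= => tM; rewrite normrM [leRHS]mulrAC.
  apply: ler_pM; [exact: normr_ge0|exact: normr_ge0| |exact: HC].
  by apply: psum_le; rewrite enorm_gt0 t0 enorm_le_bound// ltW.
Qed.

Theorem weak_laplacian_radial_sum (f : 'rV[R]_n -> R) (f1 f2 : 'I_n -> 'rV[R]_n -> R) (M : R) :
  0 < M ->
  (forall i x, is_derive x (delta_mx 0 i) f (f1 i x)) ->
  (forall i x, is_derive x (delta_mx 0 i) (f1 i) (f2 i x)) ->
  continuous f -> (forall i, continuous (f2 i)) ->
  (forall x, ~ box M x -> f x = 0) ->
  \sum_i \int[leb]_t (radial_sum (enorm (rv t)) * f2 i (rv t)) =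
  k2 * \int[leb]_t (radial_sum (enorm (rv t)) * f (rv t)) + n%:R * ball_vol R n * f 0.
Proof.
move=> M0 df df1 cf cf2 f0.
have f20 i x : ~ box M x -> f2 i x = 0.
  move=> xM; apply: (is_derive_outside_box (df1 i x)) xM => y.
  exact: is_derive_outside_box (df i y) f0.
have cvg1 : \sum_i \int[leb]_t (psum k.+1 (enorm (rv t)) * f2 i (rv t)) @[k --> \oo] -->
    \sum_i \int[leb]_t (radial_sum (enorm (rv t)) * f2 i (rv t)).
  apply: cvg_big => [|i _]; first exact: add_continuous.
  have [_ h] := cvg_psum_integral M0 (@cf2 i) (@f20 i).
  by rewrite -cvg_shiftS in h.
have [_ cvg2] := cvg_psum_integral M0 cf f0.
apply: (@cvg_unique _ (@norm_hausdorff _ R) _ _ _ _ cvg1).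
rewrite (_ : (fun k => _) = (fun k => k2 * \int[leb]_t (psum k (enorm (rv t)) * f (rv t)) +
  n%:R * ball_vol R n * f 0)).
  by apply: cvgD; [apply: cvgM; [exact: cvg_cst|exact: cvg2]|exact: cvg_cst].
by apply/funext => k; exact: weak_laplacian_psum M0 df df1 cf cf2 f0 k.
Qed.

End LogSeries.

(** * Poles and residues *)

Section Residues.
Variable K : numClosedFieldType.
Implicit Types (f g h : K -> K) (a c w : K) (p q : {poly K}).

Lemma is_derive_horner p w : is_derive w 1 (horner p) (p^`()).[w].
Proof.
elim/poly_ind: p => [|p c IH].
  apply: is_derive_ext (is_derive_cst (0 : K) w 1) => [x|]; first by rewrite horner0.
  by rewrite deriv0 horner0.
apply: is_derive_ext
  (is_deriveD (is_deriveM IH (is_derive_id w 1)) (is_derive_cst c w 1)) => [x|].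
  by rewrite hornerMXaddC.
rewrite derivMXaddC hornerD hornerMX /GRing.scale /= mulr1 addr0.
by rewrite [w * _]mulrC.
Qed.

Lemma continuous_horner_num p : continuous (horner p).
Proof.
move=> w; have [d _] := is_derive_horner p w.
by apply: differentiable_continuous; apply/derivable1_diffP.
Qed.

Lemma horner_neq0_near p a : p.[a] != 0 -> \forall w \near a, p.[w] != 0.
Proof.
by move=> pa; exact: (cvgr_neq0 _ (@continuous_horner_num p a) pa).
Qed.

Lemma is_derive_hornerV q w : q.[w] != 0 ->
  is_derive w 1 (fun w => q.[w]^-1) (- (q^`()).[w] / q.[w] ^+ 2).
Proof.
move=> qw; have [d e] := is_derive_horner q w; apply: DeriveDef.
  exact: derivableV.
by rewrite deriveV// e /GRing.scale /= mulNr mulNr mulrC.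
Qed.

Lemma holomorphic_near_horner_div p q a : q.[a] != 0 ->
  holomorphic_near (fun w => p.[w] / q.[w]) a.
Proof.
move=> /horner_neq0_near; apply: filterS => w qw.
have dp := is_derive_horner p w; have dq := is_derive_hornerV qw.
by have [] := is_deriveM dp dq.
Qed.

Lemma holomorphic_near_continuous g a : holomorphic_near g a -> {for a, continuous g}.
Proof.
by move=> /nbhs_singleton /derivable1_diffP; exact: differentiable_continuous.
Qed.

Lemma dnbhs_neq a : \forall w \near a^', w != a.
Proof. by rewrite /dnbhs; apply: withinT. Qed.

Lemma holomorphic_near_dcvg g a : holomorphic_near g a -> g w @[w --> a^'] --> g a.
Proof. by move=> /holomorphic_near_continuous; exact: cvg_trans (cvg_app _ (@nbhs_dnbhs _ a)). Qed.

Lemma sub_dcvg0 a : w - a @[w --> a^'] --> (0 : K).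
Proof.
rewrite -[X in _ --> X](subrr a); apply: cvgB; last exact: cvg_cst.
exact: nbhs_dnbhs.
Qed.


Lemma sub_exp_dcvg0 a k : (0 < k)%N -> (w - a) ^+ k @[w --> a^'] --> (0 : K).
Proof.
move=> k0; have -> : (0 : K) = ('X^k).[0] by rewrite hornerXn expr0n gtn_eqF.
rewrite (_ : (fun w => _) = (fun w => ('X^k).[w - a])).
  exact: (cvg_comp _ _ (sub_dcvg0 a) (@continuous_horner_num 'X^k 0)).
by apply/funext => w; rewrite hornerXn.
Qed.

Lemma dnbhs_cvg_eq f g a c : (\forall w \near a^', f w = g w) ->
  f w @[w --> a^'] --> c -> g w @[w --> a^'] --> c.
Proof. by move=> fg; apply: cvg_trans; apply: near_eq_cvg; apply: filterS fg. Qed.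

Lemma dnbhs_cvg_unique f a c d :
  f w @[w --> a^'] --> c -> f w @[w --> a^'] --> d -> c = d.
Proof. by move=> h1 h2; exact: (cvg_unique (@norm_hausdorff _ K) h1 h2). Qed.

(** If [f] behaves like [g w / (w - a)^k] with [g a] nonzero and also had a
    pole of smaller order, then [g] would be a continuous function times a
    positive power of [w - a], hence would vanish at [a]. *)
Lemma pole_of_order_max f g a k l : holomorphic_near g a -> g a != 0 ->
  (\forall w \near a^', f w = g w / (w - a) ^+ k) ->
  pole_of_order l f a -> (k <= l)%N.
Proof.
move=> hg ga fg [h [hh ha fh]]; rewrite leqNgt; apply/negP => lk.
have gh : \forall w \near a^', h w * (w - a) ^+ (k - l) = g w.
  near=> w; have wa : w != a by near: w; exact: dnbhs_neq.
  have eg : f w = g w / (w - a) ^+ k by near: w.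
  have eh : f w = h w / (w - a) ^+ l by near: w.
  have wa0 (i : nat) : (w - a) ^+ i != 0 by rewrite expf_neq0// subr_eq0.
  apply: (mulIf (wa0 l)); rewrite -mulrA -exprD subnK ?(ltnW lk)//.
  apply: (mulIf (invr_neq0 (wa0 k))); rewrite mulfK// mulrAC -eg eh divfK//.
move/eqP: ga; apply; apply: (dnbhs_cvg_unique (holomorphic_near_dcvg hg)).
apply: dnbhs_cvg_eq gh _; rewrite -[X in _ --> X](mulr0 (h a)).
apply: cvgM; first exact: holomorphic_near_dcvg.
by apply: sub_exp_dcvg0; rewrite subn_gt0.
Unshelve. all: by end_near. Qed.

Lemma no_pole_of_order_eq0 f a k : (\forall w \near a^', f w = 0) ->
  ~ pole_of_order k f a.
Proof.
move=> f0 [h [hh ha fh]]; move/eqP: ha; apply.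
apply: (dnbhs_cvg_unique (holomorphic_near_dcvg hh)).
apply: (@dnbhs_cvg_eq (fun=> 0)); last exact: cvg_cst.
near=> w; have wa : w != a by near: w; exact: dnbhs_neq.
have : f w = 0 by near: w.
rewrite (_ : f w = h w / (w - a) ^+ k); last by near: w.
move=> /eqP; rewrite mulf_eq0 invr_eq0 expf_eq0 subr_eq0 (negPf wa) andbF orbF.
by move/eqP.
Unshelve. all: by end_near. Qed.

(** A polynomial in [(w - a)^-1] that stays bounded near [a] is constant: the
    reversed polynomial, evaluated at [w - a], is [(w - a)^d] times a bounded
    function, so its value at [a], the leading coefficient, is [0]. *)
Lemma principal_part_coef (P : {poly K}) g a k : holomorphic_near g a ->
  (\forall w \near a^', P.[(w - a)^-1] = g w) -> P`_k.+1 = 0.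
Proof.
move=> hg Pg.
have [sP|] := leqP (size P) 1; first by rewrite nth_default// (leq_trans sP).
case sP : (size P) => [|[|d]]// _; exfalso.
have lP : P`_d.+1 != 0.
  by rewrite -[d.+1]/(d.+2.-1) -sP -lead_coefE lead_coef_eq0 -size_poly_eq0 sP.
move/eqP: lP; apply.
(* [P] with its coefficients reversed: [Q.[u] = u ^+ d.+1 * P.[u^-1]]. *)
pose Q : {poly K} := \poly_(i < d.+2) P`_(d.+1 - i).
have QE u : u != 0 -> Q.[u] = u ^+ d.+1 * P.[u^-1].
  move=> u0; rewrite horner_poly horner_coef sP mulr_sumr.
  rewrite (reindex_inj rev_ord_inj) /=; apply: eq_bigr => i _.
  have id : (i <= d.+1)%N by rewrite -ltnS.
  rewrite !subSS subKn// mulrCA; congr (_ * _).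
  rewrite exprVn; apply: (mulIf (expf_neq0 i u0)).
  by rewrite divfK ?expf_neq0// -exprD subnK.
have Q0 : Q.[w - a] @[w --> a^'] --> Q.[0].
  exact: (cvg_comp _ _ (sub_dcvg0 a) (@continuous_horner_num Q 0)).
have -> : P`_d.+1 = Q.[0] by rewrite horner_coef0 coef_poly subn0.
apply: (dnbhs_cvg_unique Q0).
apply: (@dnbhs_cvg_eq (fun w => (w - a) ^+ d.+1 * g w)).
  near=> w; have wa : w != a by near: w; exact: dnbhs_neq.
  rewrite QE ?subr_eq0//; congr (_ * _); apply/esym; by near: w.
rewrite -[X in _ --> X](mul0r (g a)); apply: cvgM; last exact: holomorphic_near_dcvg.
exact: sub_exp_dcvg0.
Unshelve. all: by end_near. Qed.

(** The chosen residue is determined because two principal parts of [f] differ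
    by a holomorphic function. *)
Lemma residueE f a c : is_residue f a c -> residue f a = c.
Proof.
move=> fc; apply: xget_unique => // d [Q [h [hh fh <-]]].
have [P [g [hg fg <-]]] := fc.
apply/eqP; rewrite -subr_eq0 -coefB; apply/eqP.
apply: (@principal_part_coef (Q - P) (fun w => g w - h w) a 0).
  apply: filterS2 hg hh => w dg dh.
  exact: (@derivableB _ _ _ g h w 1 dg dh).
near=> w; have e1 : f w = P.[(w - a)^-1] + g w by near: w.
have e2 : f w = Q.[(w - a)^-1] + h w by near: w.
move: e2; rewrite e1 hornerD hornerN => /(congr1 (fun z => z - h w - P.[(w - a)^-1])).
by rewrite addrK => <-; rewrite addrAC [_ + g w]addrC addrK.
Unshelve. all: by end_near. Qed.

Section SimplePole.
Variables (f : K -> K) (a c : K) (q : {poly K}).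
Hypotheses (c0 : c != 0) (qa : q.[a] != 0).
Hypothesis fE : forall w, f w = c / ((w - a) * q.[w]).

Lemma simple_pole : pole_of_order 1 f a.
Proof.
exists (fun w => (c%:P).[w] / q.[w]); split.
- exact: holomorphic_near_horner_div.
- by rewrite hornerC mulf_neq0// invr_neq0.
- by apply: nearW => w; rewrite fE hornerC expr1 invfM mulrCA mulrC.
Qed.

(** By the factor theorem [q w = q a + (w - a) s w], so [c / q w - c / q a] is
    divisible by [w - a] and the quotient is holomorphic at [a]. *)
Lemma simple_pole_residue : residue f a = c / q.[a].
Proof.
have /factor_theorem[s qs] : root (q - (q.[a])%:P) a.
  by rewrite /root !hornerE subrr.
have qs' w : q.[w] = q.[a] + s.[w] * (w - a).
  have /(congr1 (fun p => p.[w])) := qs.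
  by rewrite !hornerE => <-; rewrite addrC subrK.
apply: residueE; exists ((c / q.[a]) *: 'X),
  (fun w => ((- (c / q.[a])) *: s).[w] / q.[w]); split.
- exact: holomorphic_near_horner_div.
- near=> w; have wa : w - a != 0 by rewrite subr_eq0; near: w; exact: dnbhs_neq.
  have qw : q.[w] != 0 by near: w; apply: nbhs_dnbhs; exact: horner_neq0_near.
  rewrite fE !hornerE.
  rewrite qs' in qw *; move: wa qa qw; move: (w - a) q.[a] s.[w] => u v s' u0 v0 w0.
  by field; rewrite u0 v0 w0.
- by rewrite coefZ coefX mulr1.
Unshelve. all: by end_near. Qed.

End SimplePole.

Section DoublePole.
Variables (f : K -> K) (a c : K) (q : {poly K}).
Hypotheses (c0 : c != 0) (qa : q.[a] != 0).
Hypothesis fE : forall w, f w = c / ((w - a) ^+ 2 * q.[w]).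

Let g w := (c%:P).[w] / q.[w].

Let hg : holomorphic_near g a. Proof. exact: holomorphic_near_horner_div. Qed.

Let fg w : f w = g w / (w - a) ^+ 2.
Proof. by rewrite fE /g hornerC invfM mulrCA mulrC. Qed.

Let gf w : w != a -> (w - a) ^+ 2 * f w = g w.
Proof. by move=> wa; rewrite fg mulrC divfK// expf_neq0// subr_eq0. Qed.

Let ga : g a != 0. Proof. by rewrite /g hornerC mulf_neq0// invr_neq0. Qed.

Lemma double_pole : pole_of_order 2 f a.
Proof. by exists g; split => //; apply: nearW => w; exact: fg. Qed.

Lemma double_pole_not_simple : ~ pole_of_order 1 f a.
Proof. by move=> /(pole_of_order_max hg ga) h; have /= := h 2%N (nearW _ fg); rewrite ltnn => /(_ _). Qed.

Lemma double_pole_Res1 : Res1 f a = c / q.[a].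
Proof.
apply: (cvg_lim (@norm_hausdorff _ K)).
have -> : c / q.[a] = g a by rewrite /g hornerC.
apply: dnbhs_cvg_eq (holomorphic_near_dcvg hg).
by near=> w; rewrite gf//; near: w; exact: dnbhs_neq.
Unshelve. all: by end_near. Qed.

(** The derivative is taken of a function that agrees with the holomorphic
    function [c / q] except at [a]; near any other point it is therefore the
    derivative of [c / q], which is continuous at [a]. *)
Lemma double_pole_Res2 : Res2 f a = - (c * (q^`()).[a] / q.[a] ^+ 2).
Proof.
pose G := (- c) *: q^`().
have qa2 : (q ^+ 2).[a] != 0 by rewrite horner_exp expf_neq0.
have hG := holomorphic_near_horner_div G qa2.
apply: (cvg_lim (@norm_hausdorff _ K)).
have -> : - (c * (q^`()).[a] / q.[a] ^+ 2) = G.[a] / (q ^+ 2).[a].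
  by rewrite hornerZ horner_exp !mulNr.
apply: dnbhs_cvg_eq (holomorphic_near_dcvg hG).
near=> w; have wa : w != a by near: w; exact: dnbhs_neq.
have qw : q.[w] != 0 by near: w; apply: nbhs_dnbhs; exact: horner_neq0_near.
have wXa : ('X - a%:P).[w] != 0 by rewrite hornerXsubC subr_eq0.
rewrite derive1E (@near_eq_derive _ _ _ _ g); last first.
  apply: filterS (horner_neq0_near wXa) => z.
  by rewrite hornerXsubC subr_eq0; exact: gf.
have := is_deriveM (is_derive_cst c w 1) (is_derive_hornerV qw).
move=> /(@is_derive_ext _ _ _ _ g) h.
have [_ ->] := h _ (fun z => congr1 (fun c => c / q.[z]) (esym (hornerC c z))) erefl.
by rewrite /GRing.scale /= mulr0 addr0 hornerZ horner_exp !mulNr mulrN mulrA.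
Unshelve. all: by end_near. Qed.

End DoublePole.
End Residues.

(** * The parametrix symbols *)

(** The denominator of the symbol of index [2m]; all its zeros are real and
    explicit. *)
Definition symbol_den (K : nzRingType) (n m : nat) : {poly K} :=
  \prod_(i < m.+1) (('X - (2 * i + 2)%:R%:P) * ('X - (2 * i + n)%:R%:P)).

Section Symbols.
Variables (R : realType) (n : nat) (kappa : R).
Implicit Types w : CC R.

(** The operator has a single lower-order symbol, so the recursive sum has one
    term. *)
Lemma hinvSS j w lam : hinv n kappa j.+2 w lam =
  ofR kappa ^+ 2 * hinv n kappa j (w - 2) lam * hinv n kappa 0 w lam.
Proof.
rewrite hinvS// big_ltn// big_ltn//= [X in _ + (_ + X)]big1_seq; last first.
  move=> i /andP[_]; rewrite mem_index_iota => /andP[i3 _].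
  by case: i i3 => [|[|[|i]]]//= _; rewrite mulr0.
rewrite mulr0 add0r addr0 !subSS subn0 mulrN opprK.
by congr (_ * _); rewrite mulrC.
Qed.

Lemma hinv_odd m w : hinv n kappa m.*2.+1 w 0 = 0.
Proof.
elim: m w => [|m IH] w; last by rewrite doubleS hinvSS IH mulr0 mul0r.
by rewrite hinvS// big_ltn// big_geq//= mulr0 addr0 oppr0 mul0r.
Qed.

(** Both sides are inverses in the totalised sense, so the formula holds at
    the poles as well and no exceptional points have to be excluded. *)
Lemma hinv_even m w : hinv n kappa m.*2 w 0 =
  ofR kappa ^+ m.*2 / (symbol_den (CC R) n m).[w].
Proof.
have h0 u : hinv n kappa 0 u 0 = ((u - 2) * (u - n%:R))^-1.
  by rewrite hinv0 /= subr0; congr (_^-1); ring.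
elim: m w => [|m IH] w.
  rewrite h0 expr0 mul1r /symbol_den big_ord1 hornerM !hornerXsubC.
  by rewrite muln0.
rewrite doubleS hinvSS IH h0 -[m.*2.+2]addn2 exprD.
rewrite (_ : (symbol_den (CC R) n m.+1).[w] =
  (symbol_den (CC R) n m).[w - 2] * ((w - 2) * (w - n%:R))).
  by rewrite [in RHS]invfM [RHS]mulrA mulrCA !mulrA.
rewrite /symbol_den big_ord_recl hornerM mulrC muln0 !add0n.
rewrite hornerM !hornerXsubC; congr (_ * _).
rewrite !horner_prod; apply: eq_bigr => i _.
rewrite !hornerM !hornerXsubC lift0.
have E (k : nat) : w - (2 * i.+1 + k)%:R = w - 2 - (2 * i + k)%:R.
  by rewrite mulnS -addnA natrD opprD addrA.
by congr (_ * _); exact: E.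
Qed.

End Symbols.

(** * Coefficients in dimensions three and four *)

(** What remains of [symbol_den 3 m] after removing the simple zero at [3];
    see [symbol_den3]. *)
Definition cofactor3 (K : nzRingType) (m : nat) : {poly K} :=
  ('X - 2%:R%:P) *
  \prod_(i < m) (('X - (2 * i.+1 + 2)%:R%:P) * ('X - (2 * i.+1 + 3)%:R%:P)).

(** What remains of [symbol_den 4 m.+1] after removing the double zero at [4]:
    the factor [i = 0] contributes one such zero through [2i + n] and the
    factor [i = 1] another one through [2i + 2]. See [symbol_den4]. *)
Definition cofactor4 (K : nzRingType) (m : nat) : {poly K} :=
  (('X - 2%:R%:P) * ('X - 6%:R%:P)) *
  \prod_(i < m) (('X - (2 * i.+2 + 2)%:R%:P) * ('X - (2 * i.+2 + 4)%:R%:P)).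

Lemma symbol_den3 (K : comNzRingType) m :
  symbol_den K 3 m = ('X - 3%:R%:P) * cofactor3 K m.
Proof.
rewrite /symbol_den /cofactor3 big_ord_recl /= [in RHS]mulrA; congr (_ * _).
by rewrite mulrC.
Qed.

Lemma symbol_den4 (K : comNzRingType) m :
  symbol_den K 4 m.+1 = ('X - 4%:R%:P) ^+ 2 * cofactor4 K m.
Proof.
rewrite /symbol_den /cofactor4 !big_ord_recl /= [in LHS]mulrA [in RHS]mulrA.
congr (_ * _); rewrite /bump /=.
by move: ('X - 4%:R%:P) ('X - 2%:R%:P) ('X - 6%:R%:P) => p q s; ring.
Qed.

Lemma cofactor3S (K : nzRingType) m : cofactor3 K m.+1 = cofactor3 K m *
  (('X - (2 * m.+1 + 2)%:R%:P) * ('X - (2 * m.+1 + 3)%:R%:P)).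
Proof. by rewrite /cofactor3 big_ord_recr /= mulrA. Qed.

Lemma cofactor4S (K : nzRingType) m : cofactor4 K m.+1 = cofactor4 K m *
  (('X - (2 * m.+2 + 2)%:R%:P) * ('X - (2 * m.+2 + 4)%:R%:P)).
Proof. by rewrite /cofactor4 big_ord_recr /= mulrA. Qed.

Section RealCoefficients.
Variable R : realType.

Lemma ofR_inj : injective (@ofR R).
Proof. by move=> x y [->]. Qed.

Lemma ofRnat k : k%:R = ofR (k%:R : R) :> CC R.
Proof. by rewrite /ofR rmorph_nat. Qed.

Lemma ofRM (x y : R) : ofR (x * y) = ofR x * ofR y.
Proof. by rewrite /ofR rmorphM. Qed.

Lemma ofRN (x : R) : ofR (- x) = - ofR x.
Proof. by rewrite /ofR rmorphN. Qed.

Lemma ofRB (x y : R) : ofR (x - y) = ofR x - ofR y.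
Proof. by rewrite /ofR rmorphB. Qed.

Lemma ofRX (x : R) k : ofR (x ^+ k) = ofR x ^+ k.
Proof. by rewrite /ofR rmorphXn. Qed.

Lemma ofRV (x : R) : ofR (x^-1) = (ofR x)^-1.
Proof. by rewrite /ofR fmorphV. Qed.

Lemma XsubC_map k :
  map_poly (real_complex R) ('X - k%:R%:P) = ('X - k%:R%:P : {poly CC R}).
Proof. by rewrite map_polyXsubC; congr ('X - _%:P); exact: rmorph_nat. Qed.

(** The residues are real: the denominators have real coefficients and are
    evaluated at real points. *)
Lemma cofactor3_map m :
  map_poly (real_complex R) (cofactor3 R m) = cofactor3 (CC R) m.
Proof.
rewrite /cofactor3 rmorphM rmorph_prod; congr (_ * _); first exact: XsubC_map.
by apply: eq_bigr => i _; rewrite rmorphM; congr (_ * _); exact: XsubC_map.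
Qed.

Lemma cofactor4_map m :
  map_poly (real_complex R) (cofactor4 R m) = cofactor4 (CC R) m.
Proof.
rewrite /cofactor4 !rmorphM rmorph_prod; congr (_ * _ * _); try exact: XsubC_map.
by apply: eq_bigr => i _; rewrite rmorphM; congr (_ * _); exact: XsubC_map.
Qed.

Lemma horner_map_ofR (p : {poly R}) k :
  (map_poly (real_complex R) p).[k%:R] = ofR p.[k%:R] :> CC R.
Proof. by rewrite ofRnat horner_map. Qed.

Lemma cofactor3_at3S m : (cofactor3 R m.+1).[3%:R] =
  (cofactor3 R m).[3%:R] * ((2 * m.+1)%:R * ((2 * m.+1)%:R - 1)).
Proof.
rewrite cofactor3S hornerM; congr (_ * _).
rewrite hornerM !hornerXsubC !natrD; move: ((2 * m.+1)%:R : R) => t.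
by rewrite /=; ring.
Qed.

Lemma cofactor3_neq0 m : (cofactor3 R m).[3%:R] != 0.
Proof.
elim: m => [|m IH].
  rewrite /cofactor3 big_ord0 mulr1 hornerXsubC -natrB//; exact: oner_neq0.
by rewrite cofactor3_at3S mulf_neq0// mulf_neq0.
Qed.

Let shift4 m k : (2 * m.+2 + k)%:R = (2 * m.+1)%:R + (k + 2)%:R :> R.
Proof. by rewrite -natrD; congr (_%:R); rewrite mulnS -addnA addnC -addnA. Qed.

Let double_succ m : (2 * m.+2)%:R = (2 * m.+1)%:R + 2%:R :> R.
Proof. by rewrite mulnS addnC natrD. Qed.

Lemma cofactor4_at4S m : (cofactor4 R m.+1).[4%:R] =
  (cofactor4 R m).[4%:R] * ((2 * m.+1)%:R * (2 * m.+2)%:R).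
Proof.
rewrite cofactor4S hornerM; congr (_ * _).
rewrite hornerM !hornerXsubC !shift4 double_succ.
by move: ((2 * m.+1)%:R : R) => t; rewrite /=; ring.
Qed.

Lemma cofactor4_derivS m : ((cofactor4 R m.+1)^`()).[4%:R] =
  ((cofactor4 R m)^`()).[4%:R] * ((2 * m.+1)%:R * (2 * m.+2)%:R) -
  (cofactor4 R m).[4%:R] * ((2 * m.+1)%:R + (2 * m.+2)%:R).
Proof.
rewrite cofactor4S; move: (cofactor4 R m) => p.
have derivM_monic1 (A B : {poly R}) : A^`() = 1 -> B^`() = 1 ->
    (p * (A * B))^`().[4%:R] =
    p^`().[4%:R] * (A.[4%:R] * B.[4%:R]) + p.[4%:R] * (A.[4%:R] + B.[4%:R]).
  move=> A1 B1; rewrite derivM derivM A1 B1 mulr1 mul1r !(hornerD, hornerM).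
  by rewrite [B.[_] + _]addrC.
rewrite derivM_monic1 ?derivXsubC// !hornerXsubC !shift4 double_succ.
by move: ((2 * m.+1)%:R : R) => t; rewrite /=; ring.
Qed.

Lemma cofactor4_neq0 m : (cofactor4 R m).[4%:R] != 0.
Proof.
elim: m => [|m IH]; last first.
  by rewrite cofactor4_at4S mulf_neq0// mulf_neq0// pnatr_eq0 muln_eq0.
rewrite /cofactor4 big_ord0 mulr1 hornerM !hornerXsubC.
have -> : (4%:R - 2%:R) * (4%:R - 6%:R) = - 4%:R :> R by ring.
by rewrite oppr_eq0 pnatr_eq0.
Qed.

End RealCoefficients.

Section RadialCoefficients.
Variables (R : realType) (kappa : R) (Gam : set (CC R)).
Hypothesis kappa0 : 0 < kappa.

Let kappaX_neq0 k : ofR kappa ^+ k != 0 :> CC R.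
Proof.
rewrite -ofRX; apply/eqP => /(@ofR_inj R _ 0) /eqP.
by rewrite expf_eq0 gt_eqF// andbF.
Qed.

Let horner_neq0 (p : {poly R}) k :
  p.[k%:R] != 0 -> (map_poly (real_complex R) p).[k%:R] != 0 :> CC R.
Proof.
by move=> p0; rewrite horner_map_ofR; apply: contra p0 => /eqP /(@ofR_inj R _ 0) ->.
Qed.

Let exprz_succ2 N (r : R) : r ^ (2 - N.+2%:Z) = r^-1 ^+ N.
Proof.
rewrite (_ : 2 - N.+2%:Z = - N%:Z); last by rewrite -[N.+2]addn2 PoszD opprD addrCA subrr addr0.
by rewrite -exprnN exprVn.
Qed.

Section GeneralDimension.
Variable N : nat.
Local Notation n := N.+2.
Hypothesis contour_left : forall w, Gam w -> ReC w < n%:R.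

Let contour_test : `[< forall w, Gam w -> ReC w < n%:R >].
Proof. exact/asboolP. Qed.

Lemma radial_coef_odd m r : radial_coef n kappa Gam m.*2.+1 r = 0.
Proof.
rewrite /radial_coef contour_test /=.
have f0 : \forall w \near (n%:R : CC R)^', hinv_at0 n kappa m.*2.+1 w = 0.
  by apply: nearW => w; exact: hinv_odd.
by rewrite !asboolF//; exact: no_pole_of_order_eq0.
Qed.

(** The totalised inverse makes the formula valid at [r = 0] too. *)
Lemma radial_coef_simple m r (q : {poly R}) : q.[n%:R] != 0 ->
  symbol_den (CC R) n m = ('X - n%:R%:P) * map_poly (real_complex R) q ->
  ofR (r ^+ m.*2) * radial_coef n kappa Gam m.*2 r =
  ofR (p0 R n * log_term N m 0 (kappa ^+ m.*2 / q.[n%:R]) r).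
Proof.
move=> q0 den; rewrite /radial_coef contour_test /=.
have fE w : hinv_at0 n kappa m.*2 w =
    ofR kappa ^+ m.*2 / ((w - n%:R) * (map_poly (real_complex R) q).[w]).
  by rewrite /hinv_at0 hinv_even den hornerM hornerXsubC.
have qn := horner_neq0 q0.
rewrite asboolT; last exact: simple_pole (kappaX_neq0 _) qn fE.
rewrite (simple_pole_residue qn fE) horner_map_ofR.
rewrite exprz_succ2 -ofRX -ofRV -!ofRM -ofRN -!ofRM; congr ofR.
rewrite /log_term /pw mul2n mul0r sub0r.
by move: (r^-1 ^+ N) (r ^+ m.*2) (p0 R n) (kappa ^+ m.*2 / _) => x y z t; ring.
Qed.

Lemma radial_coef_double m r (q : {poly R}) : q.[n%:R] != 0 ->
  symbol_den (CC R) n m = ('X - n%:R%:P) ^+ 2 * map_poly (real_complex R) q ->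
  ofR (r ^+ m.*2) * radial_coef n kappa Gam m.*2 r =
  ofR (p0 R n * log_term N m (kappa ^+ m.*2 / q.[n%:R])
    (- (kappa ^+ m.*2 * (q^`()).[n%:R] / q.[n%:R] ^+ 2)) r).
Proof.
move=> q0 den; rewrite /radial_coef contour_test /=.
have fE w : hinv_at0 n kappa m.*2 w =
    ofR kappa ^+ m.*2 / ((w - n%:R) ^+ 2 * (map_poly (real_complex R) q).[w]).
  by rewrite /hinv_at0 hinv_even den hornerM horner_exp hornerXsubC.
have qn := horner_neq0 q0.
rewrite asboolF; last exact: double_pole_not_simple (kappaX_neq0 _) qn fE.
rewrite asboolT; last exact: double_pole (kappaX_neq0 _) qn fE.
rewrite (double_pole_Res1 qn fE).
rewrite (double_pole_Res2 qn fE) deriv_map !horner_map_ofR.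
rewrite exprz_succ2 -!ofRX -!ofRV -!ofRM -ofRN -ofRB -!ofRM; congr ofR.
rewrite /log_term /pw mul2n.
by move: (r^-1 ^+ N) (r ^+ m.*2) (p0 R n) (_ / q.[_]) (_ / q.[_] ^+ 2) => x y z t s; ring.
Qed.

End GeneralDimension.

(** At [w = 3] passing from index [m] to [m.+1] multiplies the cofactor by
    [(2m+2) (2m+1)], and no logarithm ever appears. *)
Lemma radial_coefs3 : (forall w, Gam w -> ReC w < 3%:R) ->
  exists a b : nat -> R,
  [/\ a 0%N = 0, b 0%N = 1%:R^-1,
      forall m, (2 * m.+1)%:R * expo R 1 m.+1 * a m.+1 = kappa ^+ 2 * a m,
      forall m, (2 * m.+1)%:R * expo R 1 m.+1 * b m.+1 -
        ((2 * m.+1)%:R + expo R 1 m.+1) * a m.+1 = kappa ^+ 2 * b m &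
      forall m r, ofR (r ^+ m.*2) * radial_coef 3 kappa Gam m.*2 r =
        ofR (p0 R 3 * log_term 1 m (a m) (b m) r)].
Proof.
move=> hG; exists (fun=> 0), (fun m => kappa ^+ m.*2 / (cofactor3 R m).[3%:R]).
split=> // [|m|m|m r].
- by rewrite expr0 mul1r /cofactor3 big_ord0 mulr1 hornerXsubC; congr (_^-1); ring.
- by rewrite !mulr0.
- rewrite mulr0 subr0 cofactor3_at3S doubleS -[m.*2.+2]addn2 exprD /expo.
  have := cofactor3_neq0 R m.+1; rewrite cofactor3_at3S.
  move: (_.[_]) ((2 * m.+1)%:R : R) (kappa ^+ m.*2) (kappa ^+ 2) => c t x y.
  rewrite !mulf_eq0 !negb_or => /andP[c0 /andP[t0 s0]].
  by field; rewrite c0 t0 s0.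
- apply: radial_coef_simple => //; first exact: cofactor3_neq0.
  by rewrite cofactor3_map symbol_den3.
Qed.

(** At [w = 4] the first symbol has a simple pole only, which gives [a_0 = 0];
    the recurrence for [b] at [m = 0] then reads [- 2 a_1 = kappa^2 / 2]
    because the exponent [2m - N] vanishes for [m = 1]. For positive [m] the
    recurrences come from the value and the logarithmic derivative of the
    cofactor. *)
Lemma radial_coefs4 : (forall w, Gam w -> ReC w < 4%:R) ->
  exists a b : nat -> R,
  [/\ a 0%N = 0, b 0%N = 2%:R^-1,
      forall m, (2 * m.+1)%:R * expo R 2 m.+1 * a m.+1 = kappa ^+ 2 * a m,
      forall m, (2 * m.+1)%:R * expo R 2 m.+1 * b m.+1 -
        ((2 * m.+1)%:R + expo R 2 m.+1) * a m.+1 = kappa ^+ 2 * b m &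
      forall m r, ofR (r ^+ m.*2) * radial_coef 4 kappa Gam m.*2 r =
        ofR (p0 R 4 * log_term 2 m (a m) (b m) r)].
Proof.
move=> hG; pose Q m : R := (cofactor4 R m).[4%:R].
pose Q' m : R := ((cofactor4 R m)^`()).[4%:R].
exists (fun m => if m is k.+1 then kappa ^+ m.*2 / Q k else 0).
exists (fun m => if m is k.+1 then - (kappa ^+ m.*2 * Q' k / Q k ^+ 2) else 2%:R^-1).
have Q0 : Q 0%N = - 4%:R.
  by rewrite /Q /cofactor4 big_ord0 mulr1 hornerM !hornerXsubC; ring.
have step m : (2 * m.+2)%:R = (2 * m.+1)%:R + 2%:R :> R.
  by rewrite mulnS addnC natrD.
split=> // [[|m]|[|m]|[|m] r].
- by rewrite /expo muln1 subrr !mulr0 mul0r.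
- rewrite doubleS -[m.+1.*2.+2]addn2 exprD /expo /Q cofactor4_at4S.
  have := cofactor4_neq0 R m.+1; rewrite cofactor4_at4S step.
  move: (_.[_]) ((2 * m.+1)%:R : R) (kappa ^+ _.*2) (kappa ^+ 2) => c t x y.
  rewrite !mulf_eq0 !negb_or => /andP[c0 /andP[t0 s0]].
  by field; rewrite c0 t0 s0.
- rewrite /expo muln1 subrr mulr0 mul0r sub0r addr0 Q0.
  rewrite [kappa ^+ _](_ : _ = kappa ^+ 2)//.
  by move: (kappa ^+ 2) => y; field.
- rewrite doubleS -[m.+1.*2.+2]addn2 exprD /expo /Q /Q' cofactor4_at4S cofactor4_derivS.
  have := cofactor4_neq0 R m.+1; rewrite cofactor4_at4S step.
  move: ((_^`()).[_]) ((cofactor4 R m).[_]) ((2 * m.+1)%:R : R) (kappa ^+ _.*2) (kappa ^+ 2).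
  move=> d c t x y.
  rewrite !mulf_eq0 !negb_or => /andP[c0 /andP[t0 s0]].
  by field; rewrite c0 t0 s0.
- have q0 : ('X - 2%:R%:P : {poly R}).[4%:R] != 0.
    rewrite hornerXsubC (_ : _ - _ = 2%:R) ?pnatr_eq0//; by ring.
  rewrite (@radial_coef_simple 2 hG 0 r _ q0).
    congr (ofR (_ * log_term _ _ _ _ _)).
    by rewrite expr0 mul1r hornerXsubC; congr (_^-1); ring.
  rewrite XsubC_map /symbol_den big_ord1 mulrC; congr (_ * _).
- apply: radial_coef_double => //; first exact: cofactor4_neq0.
  by rewrite cofactor4_map symbol_den4.
Qed.

End RadialCoefficients.

(** * The kernel of the parametrix *)

Lemma exp_coeffS (R : realType) (x : R) m :
  m.+1%:R * exp_coeff x m.+1 = x * exp_coeff x m.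
Proof.
rewrite /exp_coeff /= exprS factS natrM invfM.
move: (m`!%:R^-1 : R) (x ^+ m) => u v.
by rewrite mulrCA [m.+1%:R * _]mulrA mulfV ?pnatr_eq0// mul1r mulrA.
Qed.

(** The exponent [2m - N] may vanish at [m = 1], so the recurrence controls
    the coefficients only from index [2] on, and [D] has to accommodate the
    first two by hand. After that the factor [(2m+2) (2m+2-N) >= 4 (m+1)] is
    more than the factorial needs, which leaves room for the contribution of
    [a] to [b]. *)
Lemma log_term_coef_bound (R : realType) (N : nat) (k2 : R) (a b : nat -> R) :
  (N <= 2)%N -> 0 < k2 ->
  (forall m, (2 * m.+1)%:R * expo R N m.+1 * a m.+1 = k2 * a m) ->
  (forall m, (2 * m.+1)%:R * expo R N m.+1 * b m.+1 -
     ((2 * m.+1)%:R + expo R N m.+1) * a m.+1 = k2 * b m) ->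
  exists2 D, 0 <= D & forall m,
    `|a m| <= D * exp_coeff k2 m /\ `|b m| <= D * exp_coeff k2 m.
Proof.
move=> N2 k0 recA recB.
(* Dividing by [k2] offsets [exp_coeff k2 1 = k2]. *)
pose D := `|a 0%N| + `|b 0%N| + (`|a 1%N| + `|b 1%N|) / k2.
have D1 : 0 <= (`|a 1%N| + `|b 1%N|) / k2.
  by rewrite divr_ge0 ?addr_ge0// ltW.
have D0 : 0 <= `|a 0%N| + `|b 0%N| by rewrite addr_ge0.
exists D => [|[|m]]; first exact: addr_ge0.
  rewrite /exp_coeff /= expr0 fact0 invr1 !mulr1 /D.
  by have := normr_ge0 (a 0%N); have := normr_ge0 (b 0%N); lra.
elim: m => [|m [IHa IHb]].
  rewrite /exp_coeff /= expr1 invr1 mulr1 /D mulrDl divfK ?gt_eqF//.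
  have h : 0 <= (`|a 0%N| + `|b 0%N|) * k2 by rewrite mulr_ge0// ltW.
  by have := normr_ge0 (a 1%N); have := normr_ge0 (b 1%N); lra.
have := recA m.+1; have := recB m.+1; have := exp_coeffS k2 m.+1.
have e0 : 2%:R <= expo R N m.+2.
  rewrite /expo lerBrDr -natrD ler_nat (leq_trans (leq_add (leqnn 2) N2))//.
  by rewrite 2!mulnS addnA leq_addr.
have t0 : 4%:R <= (2 * m.+2)%:R :> R by rewrite ler_nat 2!mulnS addnA leq_addr.
have -> : m.+2%:R = (2 * m.+2)%:R / 2%:R :> R by rewrite natrM mulrC mulKf.
have x0 : 0 <= exp_coeff k2 m.+2 by rewrite exp_coeff_ge0// ltW.
move: IHa IHb e0 t0 x0.
move: (exp_coeff k2 m.+1) (exp_coeff k2 m.+2) (expo R N m.+2) ((2 * m.+2)%:R : R).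
move: (a m.+1) (b m.+1) (a m.+2) (b m.+2) => u v u' v' x x' e t hu hv e0 t0 x0 hx hB hA.
have DD : 0 <= D by exact: addr_ge0.
have y0 : 0 <= D * x' by exact: mulr_ge0.
have te : 0 < t * e by rewrite mulr_gt0//; lra.
have k2x : k2 * (D * x) = t / 2%:R * (D * x') by rewrite mulrCA -hx mulrCA.
have h1 : 0 <= D * x' * (t * (e - 2%:R)) by apply: mulr_ge0 => //; apply: mulr_ge0; lra.
have h2 : 0 <= D * x' * (e * (t - 4%:R)) by apply: mulr_ge0 => //; apply: mulr_ge0; lra.
have hA' : `|u'| <= D * x' / 4%:R.
  rewrite -(ler_pM2l te) -[X in X * `|_|](gtr0_norm te) -normrM hA normrM (gtr0_norm k0).
  apply: le_trans (ler_wpM2l (ltW k0) hu) _; rewrite k2x.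
  by move: (D * x') h1 h2 => y h1 h2; lra.
split; first by apply: le_trans hA' _; move: (D * x') y0 => y y0; lra.
rewrite -(ler_pM2l te) -[X in X * `|_|](gtr0_norm te) -normrM.
have -> : t * e * v' = k2 * v + (t + e) * u' by rewrite -hB subrK.
have t_e : 0 <= t + e by lra.
apply: le_trans (ler_normD _ _) _; rewrite !normrM (gtr0_norm k0) (ger0_norm t_e).
apply: le_trans (lerD (ler_wpM2l (ltW k0) hv) (ler_wpM2l t_e hA')) _; rewrite k2x.
have h3 : 0 <= D * x' * (t * e) by apply: mulr_ge0 => //; exact: ltW.
by move: (D * x') h1 h2 h3 => y h1 h2 h3; lra.
Qed.

Lemma norm_ofR (R : realType) (x : R) : `|ofR x| = ofR `|x| :> CC R.
Proof. by rewrite [LHS]normc_def /= expr0n addr0 sqrtr_sqr. Qed.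

Lemma cvg_ofR (R : realType) (T : Type) (F : set_system T) (u : T -> R) (l : R) :
  Filter F -> u t @[t --> F] --> l -> ofR (u t) @[t --> F] --> ofR l.
Proof.
move=> FF /cvgrPdist_lt ul; apply/cvgrPdist_lt => -[e i] /=.
rewrite ltcE /= => /andP[/eqP -> e0].
apply: filterS (ul e e0) => t h.
by rewrite -ofRB norm_ofR ltcR.
Qed.

Lemma cvg_uphalf : uphalf k @[k --> \oo] --> \oo.
Proof.
apply/cvgnyPge => A; near=> k.
rewrite geq_uphalf_double; apply: leqW; near: k; exact: nbhs_infty_ge.
Unshelve. all: by end_near. Qed.

Section Kernel.
Variables (R : realType) (N : nat) (kappa : R) (Gam : set (CC R)).
Local Notation n := N.+2.
Local Notation T := (measurableTypeR R).
Local Notation leb := (lebesgue_tuple R n).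
Variables (a b : nat -> R) (D : R).
Hypothesis N0 : (0 < N)%N.
Hypothesis kappa0 : 0 < kappa.
Hypothesis a0 : a 0%N = 0.
Hypothesis b0 : b 0%N = N%:R^-1.
Hypothesis recA : forall m,
  (2 * m.+1)%:R * expo R N m.+1 * a m.+1 = kappa ^+ 2 * a m.
Hypothesis recB : forall m,
  (2 * m.+1)%:R * expo R N m.+1 * b m.+1 - ((2 * m.+1)%:R + expo R N m.+1) * a m.+1
  = kappa ^+ 2 * b m.
Hypothesis D0 : 0 <= D.
Hypothesis aD : forall m, `|a m| <= D * exp_coeff (kappa ^+ 2) m.
Hypothesis bD : forall m, `|b m| <= D * exp_coeff (kappa ^+ 2) m.
Hypothesis odd0 : forall m r, radial_coef n kappa Gam m.*2.+1 r = 0.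
Hypothesis evenE : forall m r, ofR (r ^+ m.*2) * radial_coef n kappa Gam m.*2 r =
  ofR (p0 R n * log_term N m (a m) (b m) r).

Let k20 : 0 <= kappa ^+ 2. Proof. exact: sqr_ge0. Qed.

Local Notation U := (radial_sum N a b).

(** Only the even indices below [k] contribute, and there are [uphalf k] of
    them. *)
Lemma radial_series_psum k r :
  radial_series n kappa Gam r k = ofR (p0 R n * psum N a b (uphalf k) r).
Proof.
have even m : radial_series n kappa Gam r m.*2 = ofR (p0 R n * psum N a b m r).
  elim: m => [|m IH].
    by rewrite psum0 mulr0 /radial_series /series /= big_geq.
  rewrite doubleS psumS mulrDr /radial_series /series /= !big_nat_recr//=.
  rewrite odd0 mulr0 addr0 evenE /ofR rmorphD; congr (_ + _); exact: IH.
rewrite uphalf_half -[k in LHS]odd_double_half; case: (odd k); last exact: even.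
rewrite !add1n psumS mulrDr /radial_series /series /= big_nat_recr//= evenE.
by rewrite /ofR rmorphD; congr (_ + _); exact: even.
Qed.

Lemma cvg_radial_series r : 0 <= r ->
  radial_series n kappa Gam r @ \oo --> ofR (p0 R n * U r).
Proof.
move=> r0.
rewrite (_ : radial_series n kappa Gam r =
  fun k => ofR (p0 R n * psum N a b (uphalf k) r)); last first.
  by apply/funext => k; exact: radial_series_psum.
apply: cvg_ofR; apply: cvgM; first exact: cvg_cst.
have h := cvg_psum N0 k20 D0 aD bD r0.
exact: (@cvg_comp _ _ _ uphalf (fun k => psum N a b k r) _ _ _ cvg_uphalf h).
Qed.

Lemma radial_kernelE r : 0 <= r -> radial_kernel n kappa Gam r = ofR (p0 R n * U r).
Proof. by move=> r0; apply: (cvg_lim (@norm_hausdorff _ (CC R))); exact: cvg_radial_series. Qed.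

Let k (x : 'rV[R]_n) : CC R := radial_kernel n kappa Gam (enorm x).

Let kE x : k x = ofR (p0 R n * U (enorm x)).
Proof. exact/radial_kernelE/enorm_ge0. Qed.

Lemma kernel_locally_integrable : locally_integrable_Rn k.
Proof.
move=> A cA; have mA := compact_rv_measurable cA.
have [M M0 AM] := compact_sub_box cA.
have mB : measurable (@rv R n @^-1` box M : set (n.-tuple T)) by exact: measurable_box.
split.
  have iU := integrableZl mB (p0 R n) (radial_sum_integrable N0 k20 D0 aD bD M0).
  apply: (@integrableS _ _ _ leb _ _ _ mB mA) => [t|]; first exact: AM.
  by apply: (eq_integrable mB _ _ _ iU) => t _; rewrite /= kE EFinM.
apply: (eq_integrable mA _ _ _ (integrable0 leb (@rv R n @^-1` A))) => t _.
by rewrite /= kE.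
Qed.

(** Here [p0] cancels the mass [n vol(B)] that the series puts at the origin. *)
Lemma kernel_real_identity (f : 'rV[R]_n -> R) M : 0 < M -> smooth f ->
  (forall x, ~ box M x -> f x = 0) ->
  \sum_i \int[leb]_t (p0 R n * U (enorm (rv t)) * partial i (partial i f) (rv t)) -
  kappa ^+ 2 * \int[leb]_t (p0 R n * U (enorm (rv t)) * f (rv t)) = f 0.
Proof.
move=> M0 sf f0.
have df i x : is_derive x (delta_mx 0 i) f (partial i f x).
  by apply: DeriveDef => //; exact: (sf [::]).2.
have df1 i x : is_derive x (delta_mx 0 i) (partial i f) (partial i (partial i f) x).
  by apply: DeriveDef => //; exact: (sf [:: i]).2.
have cf : continuous f := (sf [::]).1.
have cf2 i : continuous (partial i (partial i f)) := (sf [:: i; i]).1.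
have f20 i x : ~ box M x -> partial i (partial i f) x = 0.
  move=> xM; apply: (is_derive_outside_box (df1 i x)) xM => y.
  exact: is_derive_outside_box (df i y) f0.
have pull h : continuous h -> (forall x, ~ box M x -> h x = 0) ->
    \int[leb]_t (p0 R n * U (enorm (rv t)) * h (rv t)) =
    p0 R n * \int[leb]_t (U (enorm (rv t)) * h (rv t)).
  move=> ch h0; have [iU _] := cvg_psum_integral N0 k20 D0 aD bD M0 ch h0.
  under eq_Rintegral do rewrite -mulrA.
  by rewrite RintegralZl.
rewrite (eq_bigr _ (fun i _ => pull _ (cf2 i) (f20 i))) -mulr_sumr pull//.
rewrite (weak_laplacian_radial_sum N0 k20 a0 b0 recA recB D0 aD bD M0 df df1 cf cf2 f0).
rewrite mulrDr mulrCA addrAC subrr add0r mulrA /p0 vol_sphereE// mulVf ?mul1r//.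
by rewrite mulf_neq0// gt_eqF// ball_vol_gt0.
Qed.

(** The kernel is real, so the pairing with a complex test function splits
    into the real and imaginary parts. *)
Lemma kernel_fundamental_solution : fundamental_solution kappa (Pf k).
Proof.
move=> phi [sRe sIm cphi].
have [M M0 AM] := compact_sub_box cphi.
have phi0 x : ~ box M x -> phi x = 0.
  move=> xM; apply: contrapT => /eqP px; apply: xM; apply: AM.
  exact: subset_closure.
have ReM u (z : CC R) : ReC (ofR u * z) = u * ReC z.
  by case: z => x y; rewrite /ReC /= mul0r subr0.
have ImM u (z : CC R) : ImC (ofR u * z) = u * ImC z.
  by case: z => x y; rewrite /ImC /= mul0r addr0.
have PfE psi : Pf k psi = mkC
    (\int[leb]_t (p0 R n * U (enorm (rv t)) * ReC (psi (rv t))))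
    (\int[leb]_t (p0 R n * U (enorm (rv t)) * ImC (psi (rv t)))).
  rewrite /Pf /Cintegral; congr mkC; apply: eq_Rintegral => t _.
    by rewrite kE ReM.
  by rewrite kE ImM.
have mkC_sum (u v : 'I_n -> R) :
    \sum_i mkC (u i) (v i) = mkC (\sum_i u i) (\sum_i v i).
  by elim/big_rec3: _ => // i x y z _ ->.
rewrite /shifted_laplacian /dist_laplacian /Defs.dirac0.
under eq_bigr => i _ do rewrite /dist_partial opprK PfE.
rewrite mkC_sum PfE -ofRX.
have <- : mkC (ReC (phi 0)) (ImC (phi 0)) = phi 0 by case: (phi 0).
rewrite -(@kernel_real_identity (fun x => ReC (phi x)) M)//; last first.
  by move=> x /phi0 ->.
rewrite -(@kernel_real_identity (fun x => ImC (phi x)) M)//; last first.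
  by move=> x /phi0 ->.
apply/eqP; rewrite eq_complex /=; apply/andP; split; apply/eqP.
  by rewrite mul0r subr0.
by rewrite mul0r addr0.
Qed.

End Kernel.

Theorem proposition2 (R : realType) (n : nat) (kappa gamma : R)
    (hn : n = 3%N \/ n = 4%N) (hkappa : 0 < kappa)
    (hgamma : 2 - n%:R / 2 < gamma < 3 - n%:R / 2) :
  let Gam := Gamma ((n%:R + 4) / 2 - gamma) in
  let k := fun x : 'rV[R]_n => radial_kernel n kappa Gam (enorm x) in
  [/\ forall r : R, 0 < r -> cvgn (radial_series n kappa Gam r),
      locally_integrable_Rn k &
      fundamental_solution kappa (Pf k)].
Proof.
move=> Gam k; have k20 : 0 < kappa ^+ 2 by rewrite exprn_gt0.
(* The lower bound on [gamma] puts the contour to the left of [w = n]. *)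
have contour_left w : Gam w -> ReC w < n%:R.
  move=> ->; move: hgamma => /andP[g1 _]; move: (n%:R : R) g1 => x g1; lra.
(* With [n = N.+2] the leading power of the kernel is [r^(-N)]. *)
have [N [nE N0 N2 [a [b [a0 b0 recA recB evenE]]]]] : exists N, [/\ n = N.+2, (0 < N)%N,
    (N <= 2)%N & exists a b : nat -> R,
    [/\ a 0%N = 0, b 0%N = N%:R^-1,
      forall m, (2 * m.+1)%:R * expo R N m.+1 * a m.+1 = kappa ^+ 2 * a m,
      forall m, (2 * m.+1)%:R * expo R N m.+1 * b m.+1 -
        ((2 * m.+1)%:R + expo R N m.+1) * a m.+1 = kappa ^+ 2 * b m &
      forall m r, ofR (r ^+ m.*2) * radial_coef N.+2 kappa Gam m.*2 r =
        ofR (p0 R N.+2 * log_term N m (a m) (b m) r)]].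
  case: hn => n34; rewrite n34 in contour_left.
  - by exists 1%N; split => //; exact: radial_coefs3.
  - by exists 2%N; split => //; exact: radial_coefs4.
have [D D0 abD] := log_term_coef_bound N2 k20 recA recB.
have aD m := (abD m).1; have bD m := (abD m).2.
have odd0 m r : radial_coef N.+2 kappa Gam m.*2.+1 r = 0.
  by apply: radial_coef_odd; rewrite -nE.
move: (Gam) @k contour_left odd0 evenE => G; rewrite nE => k _ odd0 evenE.
split.
- move=> r /ltW r0; apply/cvg_ex; exists (ofR (p0 R N.+2 * radial_sum N a b r)).
  exact: (cvg_radial_series N0 D0 aD bD odd0 evenE r0).
- exact: (kernel_locally_integrable N0 D0 aD bD odd0 evenE).
- exact: (kernel_fundamental_solution N0 a0 b0 recA recB D0 aD bD odd0 evenE).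
Qed.
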